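(* Let $\mathfrak{S}=(\mathfrak{A},\mathfrak{B},\mathfrak{C})$ be a port-Hamiltonian hyperbolic BCS in one spatial variable (as defined in the context) which is impedance passive, i.e. $\operatorname{Re}\langle\mathfrak{A}x,x\rangle_X\le\operatorname{Re}\langle\mathfrak{B}x,\mathfrak{C}x\rangle_{\mathbb{K}^{Nd}}$ for all $x\in\mathcal{D}(\mathfrak{A})$. Then, with $U=\mathbb{K}^{Nd}$, $\mathfrak{S}$ satisfies: (i) there exists $\alpha\in\mathbb{R}$ such that $\operatorname{Re}\langle\mathfrak{A}x,x\rangle_X\le\operatorname{Re}\langle\mathfrak{B}x,\mathfrak{C}x\rangle_U+\alpha\|x\|_X^2$ for all $x\in\mathcal{D}(\mathfrak{A})$; (ii) there exists some $\beta\ge\alpha$ such that $\mathcal{R}(\mathfrak{A}|_{\ker\mathfrak{C}}-\beta I)=X$; (iii) the operator $\begin{bmatrix}\mathfrak{B}\\ \mathfrak{C}\end{bmatrix}:\mathcal{D}(\mathfrak{A})\to U\times U$ is surjective. If, moreover, there exists some $\mu>0$ such that $P_0+P_0^*+\mu I$ is negative definite, then (i) even holds for some $\alpha<0$.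
   Context: $\mathbb{K}\in\{\mathbb{R},\mathbb{C}\}$; $M^*$ is the conjugate transpose of a matrix $M$; $\mathcal{R}(\cdot)$ denotes the range. Port-Hamiltonian hyperbolic BCS in one spatial variable: Let $N,d\in\mathbb{N}$ and, for $k=0,\dots,N$, $P_k\in\mathbb{K}^{d\times d}$ with $P_k=(-1)^{k+1}P_k^*$ for $k\ne0$, $P_N$ invertible, and $P_0+P_0^*\le0$. Let $W_B,W_C\in\mathbb{K}^{Nd\times 2Nd}$ be such that $W=\begin{bmatrix}W_B\\ W_C\end{bmatrix}\in\mathbb{K}^{2Nd\times2Nd}$ is invertible. Let $\mathcal{H}\in L^\infty([0,1];\mathbb{K}^{d\times d})$ be such that, for constants $m,M>0$, $\mathcal{H}(\zeta)=\mathcal{H}(\zeta)^*$ and $mI_d\le\mathcal{H}(\zeta)\le MI_d$ for almost every $\zeta\in[0,1]$. Let $X=L^2([0,1];\mathbb{K}^d)$ with the scalar product $\langle y,x\rangle_X=\langle y,\mathcal{H}x\rangle_{L^2}=\int_0^1 y(\zeta)^*\mathcal{H}(\zeta)x(\zeta)\,d\zeta$. The port-Hamiltonian operator $\mathfrak{A}:\mathcal{D}(\mathfrak{A})\subset X\to X$ is $\mathfrak{A}x=\sum_{k=0}^N P_k\frac{\partial^k}{\partial\zeta^k}(\mathcal{H}x)$ with $\mathcal{D}(\mathfrak{A})=\{x\in X : \mathcal{H}x\in W^{N,2}([0,1];\mathbb{K}^d)\}$, equipped with the graph norm. For $x\in\mathcal{D}(\mathfrak{A})$ define the boundary flow and effort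 $f_{\partial,\mathcal{H}x},e_{\partial,\mathcal{H}x}\in\mathbb{K}^{Nd}$ by $$\begin{pmatrix}f_{\partial,\mathcal{H}x}\\ e_{\partial,\mathcal{H}x}\end{pmatrix}=R_0\begin{pmatrix}(\mathcal{H}x)(1)\\ (\mathcal{H}x)'(1)\\ \vdots\\ (\mathcal{H}x)^{(N-1)}(1)\\ (\mathcal{H}x)(0)\\ (\mathcal{H}x)'(0)\\ \vdots\\ (\mathcal{H}x)^{(N-1)}(0)\end{pmatrix},\qquad R_0=\frac1{\sqrt2}\begin{bmatrix}\Lambda&-\Lambda\\ I_{Nd}&I_{Nd}\end{bmatrix},$$ where $\Lambda\in\mathbb{K}^{Nd\times Nd}$ is the block matrix whose $(i,j)$ block ($1\le i,j\le N$) is $(-1)^{i-1}P_{i+j-1}$ if $i+j-1\le N$ and $0$ otherwise. The input and output maps $\mathfrak{B},\mathfrak{C}:\mathcal{D}(\mathfrak{A})\to\mathbb{K}^{Nd}$ are $$\mathfrak{B}x=W_B\begin{pmatrix}f_{\partial,\mathcal{H}x}\\ e_{\partial,\mathcal{H}x}\end{pmatrix},\qquad \mathfrak{C}x=W_C\begin{pmatrix}f_{\partial,\mathcal{H}x}\\ e_{\partial,\mathcal{H}x}\end{pmatrix}.$$ The triple $(\mathfrak{A},\mathfrak{B},\mathfrak{C})$ is called a port-Hamiltonian hyperbolic BCS in one spatial variable. *)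

(* Defs.v *)
From HB Require Import structures.
From mathcomp Require Import all_boot all_order all_algebra.
From mathcomp Require Import all_classical all_reals all_analysis.
From mathcomp Require Import complex.

Set Implicit Arguments.
Unset Strict Implicit.
Unset Printing Implicit Defensive.

Import Order.TTheory GRing.Theory Num.Theory.
Import numFieldNormedType.Exports.

Local Open Scope classical_set_scope.
Local Open Scope ring_scope.

(* The two admissible scalar fields K = R and K = C = R[i]. *)
Variant scalar_kind := RealScalars | ComplexScalars.

Definition Kfield (R : realType) (k : scalar_kind) : numFieldType :=
  match k return numFieldType with
  | RealScalars => R
  | ComplexScalars => R[i]%C
  end.

Section Scalars.
Context {R : realType} {k : scalar_kind}.
Local Notation K := (Kfield R k).

Definition reK : K -> R :=
  match k return Kfield R k -> R with
  | RealScalars => fun z => z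
  | ComplexScalars => fun z => complex.Re z
  end.

Definition imK : K -> R :=
  match k return Kfield R k -> R with
  | RealScalars => fun=> 0
  | ComplexScalars => fun z => complex.Im z
  end.

(* The scalar a + i b; when K = R the second argument is ignored (it is only
   ever an imaginary part, hence 0). *)
Definition mkK : R -> R -> K :=
  match k return R -> R -> Kfield R k with
  | RealScalars => fun a _ => a
  | ComplexScalars => fun a b => Complex a b
  end.

Definition ofR (a : R) : K := mkK a 0.
Definition conjF (z : K) : K := mkK (reK z) (- imK z).

Definition ctmx m n (M : 'M[K]_(m, n)) : 'M[K]_(n, m) := (map_mx conjF M)^T.

(* The scalar product u^* v of K^n, conjugate-linear in its first argument. *)
Definition dotv n (u v : 'cV[K]_n) : K := (ctmx u *m v) 0 0.

(* The order of K = R[i] only relates numbers with equal imaginary parts, so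
   these inequalities include that the quadratic forms of B - A (resp. A) are
   real-valued. *)
Definition loewner_le n (A B : 'M[K]_n) : Prop :=
  forall v : 'cV[K]_n, dotv v (A *m v) <= dotv v (B *m v).

Definition negative_definite n (A : 'M[K]_n) : Prop :=
  forall v : 'cV[K]_n, v != 0 -> dotv v (A *m v) < 0.

End Scalars.

Section FunctionSpaces.
Context {R : realType} {k : scalar_kind}.
Local Notation K := (Kfield R k).
Local Notation mu := (@lebesgue_measure R).

(* Functions on [0,1] are represented by total functions on R of which only
   the values on [0,1] matter; elements of L^2 are represented by functions,
   and equality in L^2 is equality almost everywhere on [0,1]. *)
Definition I01 : set R := `[0, 1]%classic.

Definition ae01 T (f g : R -> T) : Prop :=
  {ae mu, forall t, I01 t -> f t = g t}.

Definition coordwise (Q : (R -> R) -> Prop) m n (f : R -> 'M[K]_(m, n)) : Prop :=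
  forall i j, Q (fun t => reK (f t i j)) /\ Q (fun t => imK (f t i j)).

Definition measurable01 m n (f : R -> 'M[K]_(m, n)) : Prop :=
  coordwise (measurable_fun I01) f.

Definition continuous01 m n (f : R -> 'M[K]_(m, n)) : Prop :=
  coordwise (fun g : R -> R => {within I01, continuous g}) f.

Definition integralK (f : R -> K) : K :=
  mkK (\int[mu]_(t in I01) reK (f t)) (\int[mu]_(t in I01) imK (f t)).

Definition integralM m n (f : R -> 'M[K]_(m, n)) : 'M[K]_(m, n) :=
  \matrix_(i, j) integralK (fun t => f t i j).

Definition L2 d (x : R -> 'cV[K]_d) : Prop :=
  measurable01 x /\
  (\int[mu]_(t in I01) (reK (dotv (x t) (x t)))%:E < +oo)%E.

Definition Linfty m n (H : R -> 'M[K]_(m, n)) : Prop :=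
  measurable01 H /\
  exists c : R, {ae mu, forall t, I01 t -> forall i j, `|H t i j| <= ofR c}.

(* C_c^oo(]0,1[) *)
Definition test_function (phi : R -> R) : Prop :=
  (forall n t, derivable (derive1n n phi) t 1) /\
  (exists a b : R, [/\ 0 < a, b < 1 &
     forall t, phi t != 0 -> a <= t <= b]).

Definition is_weak_derivative (n : nat) d (u g : R -> 'cV[K]_d) : Prop :=
  forall phi : R -> R, test_function phi ->
    integralM (fun t => ofR (derive1n n phi t) *: u t) =
    (-1) ^+ n *: integralM (fun t => ofR (phi t) *: g t).

(* W^{N,2}([0,1]; K^d) *)
Definition sobolev (N : nat) d (u : R -> 'cV[K]_d) : Prop :=
  L2 u /\
  forall n, (n <= N)%N -> exists g, L2 g /\ is_weak_derivative n u g.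

(* The n-th weak derivative in L^2 (a chosen representative; it is unique
   almost everywhere), and 0 when there is none. *)
Definition wderiv (n : nat) d (u : R -> 'cV[K]_d) : R -> 'cV[K]_d :=
  xget (fun=> 0) [set g | L2 g /\ is_weak_derivative n u g].

(* The continuous representative, whose values on [0,1] are unique, and 0 when
   there is none.  It gives a meaning to the boundary values u^(n)(0), u^(n)(1)
   for n < N of u in W^{N,2}. *)
Definition contrep d (u : R -> 'cV[K]_d) : R -> 'cV[K]_d :=
  xget (fun=> 0) [set g | continuous01 g /\ ae01 u g].

Definition trace (n : nat) d (u : R -> 'cV[K]_d) (a : R) : 'cV[K]_d :=
  contrep (wderiv n u) a.

End FunctionSpaces.

(* The number N * d, in the form expected by the library's block matrices. *)
Definition bdim (N d : nat) : nat := (\sum_(i < N) d)%N.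

Lemma bdimE N d : bdim N d = (N * d)%N.
Proof. by rewrite /bdim sum_nat_const card_ord. Qed.

Section PortHamiltonian.
Context {R : realType} {k : scalar_kind} {N d : nat}.
Local Notation K := (Kfield R k).
Local Notation mu := (@lebesgue_measure R).

(* P 0, ..., P N are the coefficients of the operator; the values of P beyond N
   are never used. *)
Variables (P : nat -> 'M[K]_d) (H : R -> 'M[K]_d).

Definition inner_X (y x : R -> 'cV[K]_d) : K :=
  integralK (fun t => dotv (y t) (H t *m x t)).

Definition norm2_X (x : R -> 'cV[K]_d) : R := reK (inner_X x x).

Definition Hmul (x : R -> 'cV[K]_d) : R -> 'cV[K]_d := fun t => H t *m x t.

Definition pH_dom (x : R -> 'cV[K]_d) : Prop := L2 x /\ sobolev N (Hmul x).

Definition pH_A (x : R -> 'cV[K]_d) : R -> 'cV[K]_d :=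
  fun t => \sum_(n < N.+1) P n *m wderiv n (Hmul x) t.

(* Blocks are indexed from 0: the block (i, j) is (-1)^i P_{i+j+1}. *)
Definition Lambda : 'M[K]_(bdim N d) :=
  \mxblock_(i < N, j < N)
    (if (i + j + 1 <= N)%N then (-1) ^+ i *: P (i + j + 1)%N else 0).

Definition R0 : 'M[K]_(bdim N d + bdim N d) :=
  ofR (Num.sqrt 2)^-1 *: block_mx Lambda (- Lambda) 1%:M 1%:M.

Definition boundary_trace (u : R -> 'cV[K]_d) : 'cV[K]_(bdim N d + bdim N d) :=
  col_mx (\mxcol_(n < N) trace n u 1) (\mxcol_(n < N) trace n u 0).

Definition flow_effort (x : R -> 'cV[K]_d) : 'cV[K]_(bdim N d + bdim N d) :=
  R0 *m boundary_trace (Hmul x).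

(* With W = W_B this is the input map B, with W = W_C the output map C. *)
Definition pH_port (W : 'M[K]_(bdim N d, bdim N d + bdim N d))
  (x : R -> 'cV[K]_d) : 'cV[K]_(bdim N d) := W *m flow_effort x.

Variables WB WC : 'M[K]_(bdim N d, bdim N d + bdim N d).

Definition passive_up_to (alpha : R) : Prop :=
  forall x, pH_dom x ->
    reK (inner_X (pH_A x) x) <=
    reK (dotv (pH_port WB x) (pH_port WC x)) + alpha * norm2_X x.

Definition impedance_passive : Prop :=
  forall x, pH_dom x ->
    reK (inner_X (pH_A x) x) <= reK (dotv (pH_port WB x) (pH_port WC x)).

(* The range of A|_{ker C} - beta I is X: both inclusions, the second one with
   equality in X = L^2. *)
Definition range_ker_eq_X (beta : R) : Prop :=
  (forall x, pH_dom x -> pH_port WC x = 0 ->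
     L2 (fun t => pH_A x t - ofR beta *: x t)) /\
  (forall y : R -> 'cV[K]_d, L2 y -> exists x,
     [/\ pH_dom x, pH_port WC x = 0 &
         ae01 (fun t => pH_A x t - ofR beta *: x t) y]).

Definition ports_surjective : Prop :=
  forall u y : 'cV[K]_(bdim N d),
    exists x, [/\ pH_dom x, pH_port WB x = u & pH_port WC x = y].

End PortHamiltonian.
Arguments pH_dom {R k} N {d} H x.
Arguments pH_A {R k} N {d} P H x _.

(* Main.v *)
Require Import Defs.
From HB Require Import structures.
From mathcomp Require Import all_boot all_order all_algebra.
From mathcomp Require Import all_classical all_reals all_analysis.
From mathcomp Require Import measurable_realfun complex.
From mathcomp Require Import ring lra.

Set Implicit Arguments.
Unset Strict Implicit.
Unset Printing Implicit Defensive.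

Import Order.TTheory GRing.Theory Num.Theory.
Import numFieldNormedType.Exports.

Local Open Scope classical_set_scope.
Local Open Scope ring_scope.

(** Write [z = Hx].  The domain of the operator consists of the [x] for which [z]
    is in [W^{N,2}], and the ports are an invertible linear image of the boundary
    values of [z] and of its derivatives of order less than [N]: [W] is
    invertible by hypothesis, and [R_0] because [Lambda] is block anti-triangular
    with [P_N] on the anti-diagonal ([R0_unit]).

    Inequality (i) with [alpha = 0] is impedance passivity.  The ports are
    surjective because there are polynomials with arbitrary boundary values at 0
    and 1 ([layer_chain_traces]).

    For the range condition take [beta = 1].  The equation [Ax - x = y] is a linear
    differential equation of order [N] for [z], with the measurable bounded
    coefficient [H^-1] in the term of order 0, and it is solvable for any initial
    values ([linear_ode], [ode_chain]).  The condition that the output vanishes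
    becomes a linear system of [Nd] equations for the [Nd] initial values.  If the
    homogeneous system had a nontrivial solution, there would be some [x <> 0] in
    the domain with [Ax = x] and vanishing output; passivity would then give
    [|x|^2 = Re <Ax, x> <= 0] ([homogeneous_traces]).  So the system is solvable
    ([range_ker_pos]).  When [N = 0] the equation is solved pointwise
    ([range_ker_zero]).

    For the last assertion, split [Re <Ax, x>] into the term of [P_0] and the
    terms of [P_1, ..., P_N].  Since [P_k] is symmetric or skew-symmetric according
    to the parity of [k], integrations by parts show that the latter terms depend
    only on the boundary values of [z] ([pH_energy_traces]).  Passivity, applied to
    functions with the same boundary values as [z] and with arbitrarily small
    [L^2] norm, shows that they are bounded by [Re <Bx, Cx>] ([pH_energy_le]).  The
    term of [P_0] is at most [-(mu/2) |z|^2 <= -(mu m/2) |x|^2] when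
    [P_0 + P_0^* + mu] is negative definite ([passive_strict]).

    The analysis rests on integration by parts for absolutely continuous functions
    ([int01_by_parts], by Fubini's theorem) and on the lemma of du Bois-Reymond
    ([weak_derivative_prim]), by which the elements of [W^{N,2}] are the initial
    functions of chains of primitives ([sobolev_chain], [chain_sobolev]).  All
    statements about operators are derived from chains. *)

(** * Integrals over the unit interval *)

Section UnitInterval.
Context {R : realType}.
Local Notation mu := (@lebesgue_measure R).
Local Notation I01 := (@I01 R).
Implicit Types f g F G : R -> R.

Definition integrable01 f : Prop := mu.-integrable I01 (EFin \o f).

Definition int01 f : R := \int[mu]_(t in I01) f t.

Lemma measurable_I01 : measurable I01.
Proof. exact: measurable_itv. Qed.
#[local] Hint Resolve measurable_I01 : core.

Lemma in_I01 t : I01 t <-> 0 <= t <= 1.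
Proof. by rewrite /Defs.I01 /= in_itv. Qed.

Lemma I01_0 : I01 0.
Proof. by apply/in_I01; rewrite lexx ler01. Qed.

Lemma I01_1 : I01 1.
Proof. by apply/in_I01; rewrite lexx ler01. Qed.

Lemma lebesgue_I01 : mu I01 = 1%E.
Proof. by rewrite lebesgue_measure_itv/= lte_fin ltr01 oppr0 adde0. Qed.

Lemma aeS (A B : R -> Prop) : (forall t, A t -> B t) ->
  {ae mu, forall t, A t} -> {ae mu, forall t, B t}.
Proof. by have := ae_filter_ringOfSetsType mu => ? AB; apply: filterS => t; exact: AB. Qed.

Lemma aeI (A B : R -> Prop) : {ae mu, forall t, A t} ->
  {ae mu, forall t, B t} -> {ae mu, forall t, A t /\ B t}.
Proof.
by have := ae_filter_ringOfSetsType mu => ? hA hB; apply: filterS2 hA hB.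
Qed.

Lemma ae_everywhere (A : R -> Prop) : (forall t, A t) -> {ae mu, forall t, A t}.
Proof. by have := ae_filter_ringOfSetsType mu => ? hA; apply: nearW. Qed.

Lemma integrable01_measurable f : integrable01 f -> measurable_fun I01 f.
Proof. by move=> /measurable_int/measurable_EFinP. Qed.

(** Domination almost everywhere suffices, but measurability has to be assumed
    separately: the measurable sets are the Borel sets, and the measure is not
    complete on them. *)
Lemma integrable01_le f g : measurable_fun I01 f -> integrable01 g ->
  {ae mu, forall t, I01 t -> `|f t| <= g t} -> integrable01 f.
Proof.
move=> mf ig fg; apply/integrableP; split; first exact/measurable_EFinP.
have /integrableP[mg fin_g] := ig.
apply: le_lt_trans fin_g; apply: ae_ge0_le_integral => //.
- by apply: measurableT_comp => //; exact/measurable_EFinP.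
- exact: measurableT_comp.
- apply: aeS fg => t h It; have {}h := h It.
  by rewrite /= lee_fin (le_trans h)// ler_norm.
Qed.

Lemma integrable01_continuous f : {within I01, continuous f} -> integrable01 f.
Proof.
by move=> cf; apply: continuous_compact_integrable cf; exact: segment_compact.
Qed.

Lemma integrable01_cst (c : R) : integrable01 (cst c).
Proof. by apply: integrable01_continuous => x; exact: cvg_cst. Qed.

Lemma integrable01_bounded f (c : R) : measurable_fun I01 f ->
  {ae mu, forall t, I01 t -> `|f t| <= c} -> integrable01 f.
Proof.
move=> mf h; apply: (@integrable01_le _ (cst c)) => //.
exact: integrable01_cst.
Qed.

Lemma integrable01D f g : integrable01 f -> integrable01 g ->
  integrable01 (fun t => f t + g t).
Proof. by move=> hf hg; apply: (@integrableD _ _ _ mu I01 _ (EFin \o f) (EFin \o g)). Qed.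

Lemma integrable01Z (c : R) f : integrable01 f -> integrable01 (fun t => c * f t).
Proof. by move=> hf; apply: (@integrableZl _ _ _ mu I01 _ c (EFin \o f)). Qed.

Lemma integrable01N f : integrable01 f -> integrable01 (fun t => - f t).
Proof.
move=> /(integrable01Z (-1)); congr integrable01.
by apply/funext => t; rewrite mulN1r.
Qed.

Lemma integrable01B f g : integrable01 f -> integrable01 g ->
  integrable01 (fun t => f t - g t).
Proof. by move=> hf hg; apply: integrable01D => //; exact: integrable01N. Qed.

Lemma integrable01_sum (I : Type) (s : seq I) (h : I -> R -> R) :
  (forall i, integrable01 (h i)) -> integrable01 (fun t => \sum_(i <- s) h i t).
Proof.
move=> hh; elim: s => [|i s IH].
  rewrite (_ : (fun _ => _) = cst 0); first exact: integrable01_cst.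
  by apply/funext => t; rewrite big_nil.
rewrite (_ : (fun _ => _) = fun t => h i t + \sum_(j <- s) h j t).
  exact: integrable01D.
by apply/funext => t; rewrite big_cons.
Qed.

Lemma integrable01_normr f : integrable01 f -> integrable01 (fun t => `|f t|).
Proof. by move=> hf; apply: (@integrable_abse _ _ _ mu I01 (EFin \o f)). Qed.

Lemma integrable01_ae f g : measurable_fun I01 g ->
  ae01 f g -> integrable01 f -> integrable01 g.
Proof.
move=> mg fg hf; apply: (integrable01_le mg (integrable01_normr hf)).
by apply: aeS fg => t h It; rewrite h.
Qed.

Lemma int01_ae f g : measurable_fun I01 f -> measurable_fun I01 g ->
  ae01 f g -> int01 f = int01 g.
Proof.
move=> mf mg fg; rewrite /int01 /Rintegral; congr fine.
apply: ae_eq_integral => //; try exact/measurable_EFinP.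
by apply: aeS fg => t /[apply] ->.
Qed.

Lemma eq_int01 f g : (forall t, I01 t -> f t = g t) -> int01 f = int01 g.
Proof. by move=> fg; apply: eq_Rintegral => t; rewrite inE => /fg. Qed.

Lemma int01D f g : integrable01 f -> integrable01 g ->
  int01 (fun t => f t + g t) = int01 f + int01 g.
Proof. exact: RintegralD. Qed.

Lemma int01Z (c : R) f : integrable01 f -> int01 (fun t => c * f t) = c * int01 f.
Proof. exact: RintegralZl. Qed.

Lemma int01N f : integrable01 f -> int01 (fun t => - f t) = - int01 f.
Proof.
move=> hf; rewrite -mulN1r -int01Z//; apply: eq_int01 => t _.
by rewrite mulN1r.
Qed.

Lemma int01B f g : integrable01 f -> integrable01 g ->
  int01 (fun t => f t - g t) = int01 f - int01 g.
Proof.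
by move=> hf hg; rewrite int01D ?int01N//; exact: integrable01N.
Qed.

Lemma int01_cst (c : R) : int01 (cst c) = c.
Proof. by rewrite /int01 Rintegral_cst//= lebesgue_I01 mulr1. Qed.

Lemma int01_sum (I : Type) (s : seq I) (h : I -> R -> R) :
  (forall i, integrable01 (h i)) ->
  int01 (fun t => \sum_(i <- s) h i t) = \sum_(i <- s) int01 (h i).
Proof.
move=> hh; elim: s => [|i s IH].
  by rewrite big_nil -[RHS](int01_cst 0); apply: eq_int01 => t _; rewrite big_nil.
rewrite big_cons -IH -int01D//; last exact: integrable01_sum.
by apply: eq_int01 => t _; rewrite big_cons.
Qed.

Lemma int01_ge0 f : {ae mu, forall t, I01 t -> 0 <= f t} -> integrable01 f ->
  0 <= int01 f.
Proof.
move=> f0 hf.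
rewrite (@int01_ae f (fun t => `|f t|)).
- by apply: Rintegral_ge0 => t _.
- exact: integrable01_measurable.
- by apply: integrable01_measurable; exact: integrable01_normr.
- by apply: aeS f0 => t /[apply] h; rewrite ger0_norm.
Qed.

Lemma int01_le f g : integrable01 f -> integrable01 g ->
  {ae mu, forall t, I01 t -> f t <= g t} -> int01 f <= int01 g.
Proof.
move=> hf hg fg; rewrite -subr_ge0 -int01B//; apply: int01_ge0.
  by apply: aeS fg => t /[apply]; rewrite subr_ge0.
exact: integrable01B.
Qed.

Lemma int01_eq0 f : integrable01 f -> {ae mu, forall t, I01 t -> 0 <= f t} ->
  int01 f <= 0 -> {ae mu, forall t, I01 t -> f t = 0}.
Proof.
move=> hf f0 le0; have mf := integrable01_measurable hf.
have /integrableP[mEf finf] := hf.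
have i0 : (\int[mu]_(t in I01) `|(EFin \o f) t|)%E = 0%E.
  have E : int01 (fun t => `|f t|) = 0.
    apply/eqP; rewrite eq_le; apply/andP; split; last first.
      by apply: Rintegral_ge0.
    apply: le_trans le0; apply: int01_le => //; first exact: integrable01_normr.
    by apply: aeS f0 => t /[apply] h; rewrite ger0_norm.
  apply/eqP; rewrite -(@fineK _ (\int[mu]_(t in I01) _)%E).
    by rewrite eqe; apply/eqP; exact: E.
  by rewrite ge0_fin_numE// integral_ge0.
have := (ae_eq_integral_abs mu measurable_I01 mEf).1 i0.
by apply: aeS => t /[apply] -[].
Qed.

(** * Square-integrable functions on the unit interval *)

Definition sqr_integrable01 f : Prop :=
  measurable_fun I01 f /\ integrable01 (fun t => f t ^+ 2).

Lemma sqr_integrable01M f g : sqr_integrable01 f -> sqr_integrable01 g ->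
  integrable01 (fun t => f t * g t).
Proof.
move=> [mf f2] [mg g2].
apply: integrable01_le (integrable01D f2 g2) _.
  exact: measurable_funM.
apply: ae_everywhere => t _; rewrite normrM -(real_normK (num_real (f t))).
rewrite -(real_normK (num_real (g t))).
by have := sqr_ge0 (`|f t| - `|g t|); have := normr_ge0 (f t);
  have := normr_ge0 (g t); nra.
Qed.

Lemma sqr_integrable01_bounded f (c : R) : measurable_fun I01 f ->
  {ae mu, forall t, I01 t -> `|f t| <= c} -> sqr_integrable01 f.
Proof.
move=> mf h; split => //; apply: (@integrable01_bounded _ (c ^+ 2)).
  exact: measurable_funX.
apply: aeS h => t /[apply] h.
by rewrite normrX lerXn2r// nnegrE (le_trans _ h).
Qed.

Lemma sqr_integrable01_cst (c : R) : sqr_integrable01 (cst c).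
Proof.
apply: (@sqr_integrable01_bounded _ `|c|); first exact: measurable_cst.
exact: ae_everywhere.
Qed.

Lemma sqr_integrable01_integrable f : sqr_integrable01 f -> integrable01 f.
Proof.
move=> /(sqr_integrable01M (sqr_integrable01_cst 1)); congr integrable01.
by apply/funext => t; rewrite mul1r.
Qed.

Lemma sqr_integrable01_continuous f : {within I01, continuous f} ->
  sqr_integrable01 f.
Proof.
move=> cf; split.
  by apply: integrable01_measurable; exact: integrable01_continuous.
by apply: integrable01_continuous => x; apply: cvgM; exact: cf.
Qed.

Lemma sqr_integrable01D f g : sqr_integrable01 f -> sqr_integrable01 g ->
  sqr_integrable01 (fun t => f t + g t).
Proof.
move=> hf hg; split; first exact: measurable_funD hf.1 hg.1.
rewrite (_ : (fun _ => _) = fun t => f t ^+ 2 + (2 * (f t * g t) + g t ^+ 2)).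
  apply: integrable01D; first exact: hf.2.
  apply: integrable01D; last exact: hg.2.
  by apply: integrable01Z; exact: sqr_integrable01M.
by apply/funext => t; ring.
Qed.

Lemma sqr_integrable01M_bounded f (a : R -> R) (c : R) : sqr_integrable01 f ->
  measurable_fun I01 a -> {ae mu, forall t, I01 t -> `|a t| <= c} ->
  sqr_integrable01 (fun t => a t * f t).
Proof.
move=> hf ma ac; split; first exact: measurable_funM ma hf.1.
apply: integrable01_le (integrable01Z (c ^+ 2) hf.2) _.
  by apply: measurable_funX; exact: measurable_funM ma hf.1.
apply: aeS ac => t /[apply] h; rewrite exprMn normrM.
rewrite (ger0_norm (sqr_ge0 (f t))) ler_wpM2r ?sqr_ge0// normrX.
by rewrite lerXn2r// nnegrE (le_trans _ h).
Qed.

Lemma sqr_integrable01Z (c : R) f : sqr_integrable01 f ->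
  sqr_integrable01 (fun t => c * f t).
Proof.
move=> hf; apply: (@sqr_integrable01M_bounded f (cst c) `|c|) => //.
exact: ae_everywhere.
Qed.

Lemma sqr_integrable01N f : sqr_integrable01 f ->
  sqr_integrable01 (fun t => - f t).
Proof.
move=> /(sqr_integrable01Z (-1)); congr sqr_integrable01.
by apply/funext => t; rewrite mulN1r.
Qed.

End UnitInterval.
#[global] Hint Resolve measurable_I01 : core.

(** * Primitives and integration by parts *)

Section Primitives.
Context {R : realType}.
Local Notation mu := (@lebesgue_measure R).
Local Notation I01 := (@I01 R).
Implicit Types f g F G : R -> R.

Definition prim f (t : R) : R := \int[mu]_(s in `[0, t]) f s.

Lemma sub_I01 t : I01 t -> `[0, t]%classic `<=` I01.
Proof.
move=> /in_I01/andP[_ t1] s; rewrite /= in_itv/= => /andP[s0 st].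
by apply/in_I01; rewrite s0 (le_trans st).
Qed.

Lemma integrable01_sub (D : set R) f : measurable D -> D `<=` I01 ->
  integrable01 f -> mu.-integrable D (EFin \o f).
Proof.
move=> mD DI hf; apply: (@integrableS _ _ _ mu I01) => //.
exact: measurable_I01.
Qed.

Lemma integrable01S f t : I01 t -> integrable01 f ->
  mu.-integrable `[0, t] (EFin \o f).
Proof.
by move=> It; apply: integrable01_sub => //; exact: sub_I01.
Qed.

Lemma prim0 f : prim f 0 = 0.
Proof. by rewrite /prim set_itv1 Rintegral_set1. Qed.

Lemma prim1 f : prim f 1 = int01 f.
Proof. by []. Qed.

Lemma primD f g t : I01 t -> integrable01 f -> integrable01 g ->
  prim (fun s => f s + g s) t = prim f t + prim g t.
Proof. by move=> It hf hg; rewrite /prim RintegralD//; exact: integrable01S. Qed.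

Lemma primZ (c : R) f t : I01 t -> integrable01 f ->
  prim (fun s => c * f s) t = c * prim f t.
Proof. by move=> It hf; rewrite /prim RintegralZl//; exact: integrable01S. Qed.

Lemma primN f t : I01 t -> integrable01 f -> prim (fun s => - f s) t = - prim f t.
Proof.
move=> It hf; rewrite -mulN1r -primZ// /prim; apply: eq_Rintegral => s _.
by rewrite mulN1r.
Qed.

Lemma eq_prim f g t : (forall s, 0 <= s <= t -> f s = g s) -> prim f t = prim g t.
Proof.
by move=> fg; apply: eq_Rintegral => s; rewrite inE/= in_itv => /fg.
Qed.

Lemma prim_le f g t : I01 t -> integrable01 f -> integrable01 g ->
  (forall s, I01 s -> f s <= g s) -> prim f t <= prim g t.
Proof.
move=> It hf hg fg; apply: le_Rintegral => //; try exact: integrable01S.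
by move=> s /(sub_I01 It); exact: fg.
Qed.

Lemma prim_normr f t : I01 t -> integrable01 f ->
  `|prim f t| <= prim (fun s => `|f s|) t.
Proof. by move=> It hf; apply: le_normr_Rintegral => //; exact: integrable01S. Qed.

Lemma prim_le_int01 f t : I01 t -> integrable01 f ->
  (forall s, I01 s -> 0 <= f s) -> prim f t <= int01 f.
Proof.
move=> It hf f0; have /in_I01/andP[t0 t1] := It.
rewrite -subr_ge0 /int01 /prim /Defs.I01 (@Rintegral_itvB _ _ (BLeft 0) (BRight 1)) ?bnd_simp//.
apply: Rintegral_ge0 => s; rewrite /= in_itv/= => /andP[ts s1].
by apply: f0; apply/in_I01; rewrite s1 (le_trans t0 (ltW ts)).
Qed.

Lemma prim_ae f g t : I01 t -> integrable01 f -> measurable_fun I01 g ->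
  ae01 f g -> prim f t = prim g t.
Proof.
move=> It hf mg fg; rewrite /prim /Rintegral; congr fine.
have hg := integrable01_ae mg fg hf.
apply: ae_eq_integral => //.
- by have /integrableP[] := integrable01S It hf.
- by have /integrableP[] := integrable01S It hg.
by apply: aeS fg => s h /(sub_I01 It)/h ->.
Qed.

Lemma prim_continuous f : integrable01 f -> {within I01, continuous (prim f)}.
Proof. by move=> hf; apply: parameterized_integral_continuous. Qed.

Lemma measurable_prim f : integrable01 f -> measurable_fun I01 (prim f).
Proof.
by move=> hf; apply: integrable01_measurable; apply: integrable01_continuous;
  exact: prim_continuous.
Qed.

Lemma integrable01M_prim f g : integrable01 f -> integrable01 g ->
  integrable01 (fun t => f t * prim g t).
Proof.
move=> hf hg.
apply: integrable01_le (integrable01Z (int01 (fun s => `|g s|)) (integrable01_normr hf)) _.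
  by apply: measurable_funM; [exact: integrable01_measurable|exact: measurable_prim].
apply: ae_everywhere => t It; rewrite normrM mulrC ler_wpM2r//.
apply: le_trans (prim_normr It hg) _; apply: prim_le_int01 => //.
exact: integrable01_normr.
Qed.

Let EFin_prim c f t : I01 t -> integrable01 f ->
  (\int[mu]_(s in `[0%R, t]) (c * f s)%R%:E)%E = (c * prim f t)%:E.
Proof.
move=> It hf; rewrite -primZ// /prim /Rintegral fineK//.
exact: integrable_fin_num (integrable01S It (integrable01Z c hf)).
Qed.

Let EFin_tail c f t : I01 t -> integrable01 f ->
  (\int[mu]_(s in `[t, 1%R]) (c * f s)%R%:E)%E = (c * (int01 f - prim f t))%:E.
Proof.
move=> It hf; have /in_I01/andP[t0 t1] := It.
have sub : `[t, 1]%classic `<=` I01.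
  move=> s; rewrite /= in_itv/= => /andP[ts s1].
  by apply/in_I01; rewrite s1 (le_trans t0).
have hcf : mu.-integrable `[t, 1] (EFin \o (fun s => c * f s)).
  by apply: integrable01_sub => //; exact: integrable01Z.
have hf' : mu.-integrable `[t, 1] (EFin \o f).
  exact: integrable01_sub.
transitivity (\int[mu]_(s in `[t, 1]) (c * f s))%:E.
  by rewrite /Rintegral fineK//; exact: (integrable_fin_num _ hcf).
rewrite RintegralZl// /int01 /prim /Defs.I01.
rewrite (@Rintegral_itvB _ _ (BLeft 0) (BRight 1)) ?bnd_simp//.
rewrite Rintegral_itv_obnd_cbnd//; apply: integrable01_sub => // s ts.
by apply: sub; apply: subset_itvr ts; rewrite bnd_simp.
Qed.

(** Both terms are integrals of [f(s) g(t)] over one half of the unit square,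
    the first one over [t <= s] and, after exchanging the order of integration,
    the second one over [s <= t]. *)
Let prim_parts f g : integrable01 f -> integrable01 g ->
  int01 (fun t => f t * prim g t) + int01 (fun t => prim f t * g t) =
  int01 f * int01 g.
Proof.
move=> hf hg.
(* Restricting [f] and [g] turns the integrals over the triangle into integrals
   over the plane. *)
pose f' := f \_ I01; pose g' := g \_ I01.
pose h (p : measurableTypeR R * measurableTypeR R) : \bar R :=
  (if p.2 <= p.1 then f' p.1 * g' p.2 else 0)%:E.
have mf' : measurable_fun setT f'.
  by apply/(measurable_restrictT f measurable_I01); exact: integrable01_measurable.
have mg' : measurable_fun setT g'.
  by apply/(measurable_restrictT g measurable_I01); exact: integrable01_measurable.
have mh : measurable_fun setT h.
  apply/measurable_EFinP; apply: measurable_fun_ifT => //.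
    by apply: measurable_fun_ler; [exact: measurable_snd|exact: measurable_fst].
  apply: measurable_funM.
    exact: (measurableT_comp mf' measurable_fst).
  exact: (measurableT_comp mg' measurable_snd).
have if' : mu.-integrable setT (EFin \o f').
  rewrite -restrict_EFin; apply/integrable_restrict => //; last by rewrite setTI.
  exact: measurable_I01.
have ig' : mu.-integrable setT (EFin \o g').
  rewrite -restrict_EFin; apply/integrable_restrict => //; last by rewrite setTI.
  exact: measurable_I01.
(* The integral of the absolute value is at most the product of those of [f] and
   [g]. *)
have ih : (mu \x mu)%E.-integrable setT h.
  apply: (@integrable12ltyP _ _ _ _ _ mu mu _ mh).2.
  have /integrableP[_ finf] := if'; have /integrableP[_ fing] := ig'.
  set Cg := (\int[mu]_x `|(EFin \o g') x|)%E in fing.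
  have Cg0 : (0 <= Cg)%E by apply: integral_ge0.
  have Cgfin : Cg \is a fin_num by rewrite ge0_fin_numE.
  have maf : measurable_fun setT (fun x => `|(EFin \o f') x|)%E.
    by apply: measurableT_comp => //; exact/measurable_EFinP.
  have mag : measurable_fun setT (fun x => `|(EFin \o g') x|)%E.
    by apply: measurableT_comp => //; exact/measurable_EFinP.
  apply: (@le_lt_trans _ _ (\int[mu]_x (`|(EFin \o f') x| * Cg))%E).
    apply: ge0_le_integral => //.
    - by move=> x _; apply: integral_ge0.
    - have mah : measurable_fun setT (abse \o h) by exact: measurableT_comp.
      by apply: (measurable_fun_fubini_tonelli_F (abse \o h)) => //=.
    - by apply: emeasurable_funM.
    move=> x _; rewrite /Cg -ge0_integralZl//.
    apply: ge0_le_integral => //.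
    - have mhx : measurable_fun setT (fun y => h (x, y)).
        exact: (measurableT_comp mh (pair1_measurable x)).
      exact: measurableT_comp mhx.
    - by apply: emeasurable_funM.
    move=> y _; rewrite /h /= -EFinM lee_fin; case: ifP => _.
      by rewrite normrM.
    by rewrite normr0 mulr_ge0.
  rewrite ge0_integralZr//; apply: lte_mul_pinfty => //.
    by apply: integral_ge0.
  by rewrite ge0_fin_numE//; apply: integral_ge0.
have E1 x : (\int[mu]_y h (x, y))%E = ((fun t => f t * prim g t) \_ I01 x)%:E.
  rewrite patchE; case: ifPn => [/set_mem Ix|nIx]; last first.
    by rewrite integral0_eq// => y _; rewrite /h /= /f' patchE (negbTE nIx) mul0r if_same.
  rewrite -EFin_prim// [RHS]integral_mkcond; apply: eq_integral => y _.
  have /in_I01/andP[x0 x1] := Ix.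
  rewrite /h /f' /g' /= !patchE (mem_set Ix); case: ifPn => yx; case: ifPn => yI.
  - case: ifPn => // /negP[]; apply/mem_set.
    by move/set_mem/in_I01 : yI => /andP[y0 _]; rewrite /= in_itv/= y0 yx.
  - rewrite mulr0; case: ifPn => // /set_mem; rewrite /= in_itv/= => /andP[y0 _].
    by move/negP : yI; case; apply/mem_set/in_I01; rewrite y0 (le_trans yx).
  - by move: yI => /set_mem; rewrite /= in_itv/= (negbTE yx) andbF.
  - by [].
have E2 y : (\int[mu]_x h (x, y))%E =
    ((fun t => g t * (int01 f - prim f t)) \_ I01 y)%:E.
  rewrite patchE; case: ifPn => [/set_mem Iy|nIy]; last first.
    by rewrite integral0_eq// => x _; rewrite /h /= /g' patchE (negbTE nIy) mulr0 if_same.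
  rewrite -EFin_tail// [RHS]integral_mkcond; apply: eq_integral => x _.
  have /in_I01/andP[y0 y1] := Iy.
  rewrite /h /f' /g' /= !patchE (mem_set Iy); case: ifPn => yx; case: ifPn => xI.
  - case: ifPn => [_|/negP[]]; first by rewrite mulrC.
    apply/mem_set.
    by move/set_mem/in_I01 : xI => /andP[_ x1]; rewrite /= in_itv/= x1 yx.
  - rewrite mul0r; case: ifPn => // /set_mem; rewrite /= in_itv/= => /andP[_ x1].
    by move/negP : xI; case; apply/mem_set/in_I01; rewrite x1 (le_trans _ yx).
  - by move: xI => /set_mem; rewrite /= in_itv/= (negbTE yx).
  - by [].
have := Fubini ih.
under eq_integral do rewrite E1.
under [in RHS]eq_integral do rewrite E2.
move=> /(congr1 fine).
have -> : fine (\int[mu]_x ((fun t => f t * prim g t) \_ I01 x)%:E) =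
    int01 (fun t => f t * prim g t).
  by rewrite /int01 Rintegral_mkcond.
have -> : fine (\int[mu]_x ((fun t => g t * (int01 f - prim f t)) \_ I01 x)%:E) =
    int01 (fun t => g t * (int01 f - prim f t)).
  by rewrite /int01 [RHS]Rintegral_mkcond.
move=> ->.
have -> : int01 (fun t => g t * (int01 f - prim f t)) =
    int01 (fun t => int01 f * g t - g t * prim f t).
  by apply: eq_int01 => t _; ring.
rewrite int01B; [|exact: integrable01Z|exact: integrable01M_prim].
rewrite int01Z// -addrA (_ : int01 (fun t => prim f t * g t) = int01 (fun t => g t * prim f t)).
  by rewrite addNr addr0.
by apply: eq_int01 => t _; rewrite mulrC.
Qed.

(** [F] is absolutely continuous with density [f]; this is the notion of
    derivative for which integration by parts holds without continuity of the
    derivatives. *)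
Definition primitive01 F f : Prop :=
  integrable01 f /\ forall t, I01 t -> F t = F 0 + prim f t.

Lemma primitive01_prim f (c : R) : integrable01 f ->
  primitive01 (fun t => c + prim f t) f.
Proof. by move=> hf; split => // t _; rewrite prim0 addr0. Qed.

Lemma primitive01_continuous F f : primitive01 F f -> {within I01, continuous F}.
Proof.
move=> [hf FE]; apply: (@subspace_eq_continuous _ _ _ (fun t => F 0 + prim f t)).
  by move=> t; rewrite inE => /FE.
by move=> x; apply: cvgD; [exact: cvg_cst|exact: prim_continuous].
Qed.

Lemma primitive01D F f G g : primitive01 F f -> primitive01 G g ->
  primitive01 (fun t => F t + G t) (fun t => f t + g t).
Proof.
move=> [hf FE] [hg GE]; split; first exact: integrable01D.
by move=> t It; rewrite FE// GE// primD//; ring.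
Qed.

Lemma primitive01Z (c : R) F f : primitive01 F f ->
  primitive01 (fun t => c * F t) (fun t => c * f t).
Proof.
move=> [hf FE]; split; first exact: integrable01Z.
by move=> t It; rewrite FE// primZ//; ring.
Qed.

Lemma primitive01N F f : primitive01 F f ->
  primitive01 (fun t => - F t) (fun t => - f t).
Proof.
move=> [hf FE]; split; first exact: integrable01N.
by move=> t It; rewrite FE// primN//; ring.
Qed.

Lemma primitive01_cst (c : R) : primitive01 (cst c) (cst 0).
Proof.
split; first exact: integrable01_cst.
by move=> t It; rewrite /prim Rintegral_cst//= mul0r addr0.
Qed.

Lemma int01_by_parts F f G g : primitive01 F f -> primitive01 G g ->
  int01 (fun t => f t * G t) + int01 (fun t => F t * g t) =
  F 1 * G 1 - F 0 * G 0.
Proof.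
move=> [hf FE] [hg GE].
have -> : int01 (fun t => f t * G t) = int01 (fun t => G 0 * f t + f t * prim g t).
  by apply: eq_int01 => t It; rewrite (GE t)//; ring.
have -> : int01 (fun t => F t * g t) = int01 (fun t => F 0 * g t + g t * prim f t).
  by apply: eq_int01 => t It; rewrite (FE t)//; ring.
rewrite !int01D ?int01Z//; try exact: integrable01Z; try exact: integrable01M_prim.
have := prim_parts hf hg.
have -> : int01 (fun t => prim f t * g t) = int01 (fun t => g t * prim f t).
  by apply: eq_int01 => t It; rewrite mulrC.
rewrite (FE 1 I01_1) (GE 1 I01_1) !prim1 => E.
transitivity (G 0 * int01 f + F 0 * int01 g +
  (int01 (fun t => f t * prim g t) + int01 (fun t => g t * prim f t))); first by ring.
by rewrite E; ring.
Qed.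

Lemma primitive01_C1 F : (forall x, derivable F x 1) -> continuous (derive1 F) ->
  primitive01 F (derive1 F).
Proof.
move=> dF cF; have cF' (A : set R) : {within A, continuous (derive1 F)}.
  exact: continuous_subspaceT.
split; first exact: (integrable01_continuous (cF' _)).
move=> t /in_I01/andP[]; rewrite le_eqVlt => /predU1P[<- _|t0 t1].
  by rewrite prim0 addr0.
have ctF : continuous F.
  by move=> x; apply: differentiable_continuous; apply/derivable1_diffP.
have dF' : derivable_oo_LRcontinuous F 0 t.
  split; first by move=> x _; exact: dF.
  - by apply: cvg_at_right_filter; exact: ctF.
  - by apply: cvg_at_left_filter; exact: ctF.
rewrite /prim /Rintegral (continuous_FTC2 t0 (cF' _) dF' (fun=> fun=> erefl)).
by rewrite -EFinB /= subrKC.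
Qed.

Lemma ae_neq (a : R) : {ae mu, forall t, t != a}.
Proof.
exists [set a]; split; [exact: measurable_set1|exact: lebesgue_measure_set1|].
by move=> t /= /negP; rewrite negbK => /eqP.
Qed.

Lemma near_itvoo (a b x : R) : a < x -> x < b -> \forall y \near x, a < y /\ y < b.
Proof.
by move=> ax xb; near=> y; split; near: y; [exact: lt_nbhsr|exact: lt_nbhsl].
Unshelve. all: by end_near. Qed.

Let derive1_near0 F x : 0 < x -> x < 1 -> (forall t, I01 t -> F t = 0) ->
  derive1 F x = 0.
Proof.
move=> x0 x1 F0; rewrite derive1E (@near_eq_derive _ _ _ _ (cst 0)) ?derive_cst//.
near=> y; apply: F0; apply/in_I01.
have : 0 < y /\ y < 1 by near: y; exact: near_itvoo.
by move=> [y0 y1]; rewrite !ltW.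
Unshelve. all: by end_near. Qed.

(** By Lebesgue's differentiation theorem, [f t] is almost everywhere the
    derivative of its primitive, which is constant near an interior point. *)
Lemma prim_eq0 f : integrable01 f -> (forall t, I01 t -> prim f t = 0) ->
  ae01 f (cst 0).
Proof.
move=> hf f0; pose f' := f \_ I01.
have loc : locally_integrable setT f'.
  by apply: integrable_locally_restrict => //; exact: measurable_I01.
have if' y : mu.-integrable `[0, y] (EFin \o f').
  rewrite /f' -restrict_EFin; apply/integrable_restrict => //.
    exact: measurable_I01.
  by apply: integrable01_sub => //; apply: measurableI => //; exact: measurable_I01.
have F0 t : I01 t -> prim f' t = 0.
  move=> It; rewrite -[RHS](f0 t It); apply: eq_prim => s /andP[s0 st].
  rewrite /f' patchE mem_set//; apply/in_I01; rewrite s0.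
  by move/in_I01 : It => /andP[_ /(le_trans st)].
have [n0 n1] := (ae_neq 0, ae_neq 1).
have := @FTC1 _ f' (BLeft 0) if' loc.
move=> /(aeI n0)/(aeI n1); apply: aeS => t [t1 [t0 H]] It.
have /in_I01/andP[ge0 le1] := It.
have t_gt0 : 0 < t by rewrite lt_neqAle eq_sym t0.
have [_] := H t_gt0; rewrite derive1_near0//; last by rewrite lt_neqAle t1.
by rewrite /f' patchE mem_set// => <-.
Qed.

(** The primitive of the difference vanishes; at an interior point its derivative
    is the difference, by continuity, and the endpoints follow by taking
    limits. *)
Lemma continuous_ae01_eq f g : {within I01, continuous f} ->
  {within I01, continuous g} -> ae01 f g -> forall t, I01 t -> f t = g t.
Proof.
move=> cf cg fg; pose h t := f t - g t.
have ch : {within I01, continuous h} by move=> x; apply: cvgB; [exact: cf|exact: cg].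
have ih := integrable01_continuous ch.
have h0 t : I01 t -> prim h t = 0.
  move=> It; transitivity (prim (cst 0) t).
    by apply: prim_ae => //; apply: aeS fg => s h' /h' E; rewrite /h E subrr.
  by rewrite /prim Rintegral_cst// mul0r.
move/(continuous_within_itvP _ ltr01) : ch => [chi ch0 ch1].
have hi t : 0 < t -> t < 1 -> h t = 0.
  move=> t0 t1; have cht : {for t, continuous h} by apply: chi; rewrite in_itv/= t0.
  have [_ <-] := continuous_FTC1_closed t1 ih t0 cht.
  exact: derive1_near0.
suff hE t : I01 t -> h t = 0 by move=> t /hE/eqP; rewrite subr_eq0 => /eqP.
move=> /in_I01/andP[]; rewrite le_eqVlt => /predU1P[<- _|t0].
  suff c0 : h x @[x --> 0^'+] --> (0 : R).
    by apply: (cvg_unique _ ch0 c0); exact: Rhausdorff.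
  by apply: cvg_near_cst; near=> s; apply: hi => //; near: s; exact: nbhs_right_lt.
rewrite le_eqVlt => /predU1P[->|t1]; last exact: hi.
suff c1 : h x @[x --> 1^'-] --> (0 : R).
  by apply: (cvg_unique _ ch1 c1); exact: Rhausdorff.
by apply: cvg_near_cst; near=> s; apply: hi => //; near: s; exact: nbhs_left_gt.
Unshelve. all: by end_near. Qed.

End Primitives.

(** * Test functions and weak derivatives *)

Section TestFunctions.
Context {R : realType}.
Local Notation mu := (@lebesgue_measure R).
Local Notation I01 := (@I01 R).
Implicit Types f g : R -> R.

Definition smooth f : Prop := forall n t, derivable (derive1n n f) t 1.

Lemma is_derive_derive1 f (df : R -> R) :
  (forall t, is_derive (t : R) (1 : R) f (df t)) -> derive1 f = df.
Proof.
by move=> h; apply/funext => t; rewrite derive1E; have [_ ->] := h t.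
Qed.

Lemma derivableP1 f t : derivable f t 1 -> is_derive (t : R) (1 : R) f (derive1 f t).
Proof. by move=> h; rewrite derive1E; exact: derivableP. Qed.

Lemma smooth_derivable f t : smooth f -> derivable f t 1.
Proof. by move=> /(_ 0%N t). Qed.

Lemma smooth_derive1 f : smooth f -> smooth (derive1 f).
Proof. by move=> h n t; rewrite -derive1Sn; exact: h. Qed.

Lemma smooth_derive1n n f : smooth f -> smooth (derive1n n f).
Proof. by elim: n f => [f|n IH f] sf; [exact: sf|exact: smooth_derive1 (IH _ sf)]. Qed.

Lemma smooth_continuous f : smooth f -> continuous f.
Proof.
move=> sf x; apply: differentiable_continuous; apply/derivable1_diffP.
exact: smooth_derivable.
Qed.

(** If the members of a class are derivable with derivatives in the linear span
    of the class, then they are smooth.  This way of proving smoothness needs no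
    closed formula for the higher derivatives. *)
Inductive lin_span (B : (R -> R) -> Prop) : (R -> R) -> Prop :=
| span_base f of B f : lin_span B f
| span_add f g of lin_span B f & lin_span B g : lin_span B (fun t => f t + g t)
| span_scale (c : R) f of lin_span B f : lin_span B (fun t => c * f t).

Lemma smooth_span (B : (R -> R) -> Prop) :
  (forall f, B f -> (forall t, derivable f t 1) /\ lin_span B (derive1 f)) ->
  forall f, lin_span B f -> smooth f.
Proof.
move=> HB.
have step f : lin_span B f -> (forall t, derivable f t 1) /\ lin_span B (derive1 f).
  elim=> {}f; first exact: HB.
  - move=> g _ [df sf] _ [dg sg].
    have H t : is_derive (t : R) (1 : R) (fun t => f t + g t) (derive1 f t + derive1 g t).
      by apply: is_deriveD; apply: derivableP1.
    split; first by move=> t; have [] := H t.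
    by rewrite (is_derive_derive1 H); exact: span_add.
  - move=> g _ [df sf].
    have H t : is_derive (t : R) (1 : R) (fun t => f * g t) (f * derive1 g t).
      by apply: is_deriveZ; apply: derivableP1.
    split; first by move=> t; have [] := H t.
    by rewrite (is_derive_derive1 H); exact: span_scale.
move=> f sf n t; have : lin_span B (derive1n n f).
  by elim: n => [//|n IH]; rewrite derive1nS; have [] := step _ IH.
by move=> /step[].
Qed.

(** The class of the products of two smooth functions satisfies the criterion, by
    the Leibniz rule. *)
Lemma smoothM f g : smooth f -> smooth g -> smooth (fun t => f t * g t).
Proof.
move=> sf sg.
apply: (@smooth_span (fun h => exists u v, [/\ smooth u, smooth v &
    h = fun t => u t * v t])); last by apply: span_base; exists f, g.
move=> _ [u [v [su sv ->]]].
have H t : is_derive (t : R) (1 : R) (fun t => u t * v t) (u t * derive1 v t + v t * derive1 u t).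
  by apply: is_deriveM; apply: derivableP1; exact: smooth_derivable.
split; first by move=> t; have [] := H t.
rewrite (is_derive_derive1 H); apply: span_add; apply: span_base.
  by exists u, (derive1 v); split; [exact: su|exact: smooth_derive1|by []].
by exists v, (derive1 u); split; [exact: sv|exact: smooth_derive1|by []].
Qed.

Lemma smooth_affine f (a b : R) : smooth f -> smooth (fun t => f (a * t + b)).
Proof.
move=> sf.
apply: (@smooth_span (fun h => exists2 u, smooth u & h = fun t => u (a * t + b)));
  last by apply: span_base; exists f.
move=> _ [u su ->].
have H t : is_derive (t : R) (1 : R) (fun t => u (a * t + b)) (a * derive1 u (a * t + b)).
  rewrite mulrC; apply: (@is_derive1_comp _ u (fun t => a * t + b)).
    by apply: derivableP1; exact: smooth_derivable.
  rewrite -[X in is_derive _ _ _ X]addr0; apply: is_deriveD.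
  by rewrite -[X in is_derive _ _ _ X]mulr1; apply: is_deriveZ.
split; first by move=> t; have [] := H t.
rewrite (is_derive_derive1 H); apply: span_scale; apply: span_base.
by exists (derive1 u); [exact: smooth_derive1|by []].
Qed.

Lemma smoothD f g : smooth f -> smooth g -> smooth (fun t => f t + g t).
Proof.
move=> sf sg; apply: (@smooth_span smooth).
  move=> h sh; split; first by move=> t; exact: smooth_derivable.
  by apply: span_base; exact: smooth_derive1.
by apply: span_add; exact: span_base.
Qed.

Lemma smoothZ (c : R) f : smooth f -> smooth (fun t => c * f t).
Proof.
move=> sf; apply: (@smooth_span smooth).
  move=> h sh; split; first by move=> t; exact: smooth_derivable.
  by apply: span_base; exact: smooth_derive1.
by apply: span_scale; exact: span_base.
Qed.

(** The functions [t^-k exp(-1/t)], extended by 0 to the left of 0; they are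
    flat at 0, and their span is stable under derivation. *)
Definition flat (k : nat) (t : R) : R :=
  if 0 < t then t^-1 ^+ k * expR (- t^-1) else 0.

Lemma flat_ge0 k t : 0 <= flat k t.
Proof.
rewrite /flat; case: ifPn => // t0.
by rewrite mulr_ge0// ?expR_ge0// exprn_ge0// invr_ge0 ltW.
Qed.

(** With [s = 1/t], this is the bound [s^(k+2) <= (k+2)! exp(s)]; it gives the
    flatness at 0. *)
Lemma flat_le k t : flat k t <= (k.+2)`!%:R * t ^+ 2.
Proof.
rewrite /flat; case: ifPn => t0; last by rewrite mulr_ge0// sqr_ge0.
have ti0 : 0 <= t^-1 by rewrite invr_ge0 ltW.
have := expR_ge1Dxn k.+1 ti0; set F := _`!%:R => le.
have F0 : 0 < F by rewrite ltr0n fact_gt0.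
have E0 := expR_gt0 t^-1.
have {}le : t^-1 ^+ k.+2 <= F * expR t^-1.
  rewrite mulrC -ler_pdivrMr//; apply: le_trans le.
  by rewrite lerDr.
rewrite expRN ler_pdivrMr//.
have -> : t^-1 ^+ k = t^-1 ^+ k.+2 * t ^+ 2.
  by rewrite -addn2 exprD -mulrA -exprMn mulVf ?gt_eqF// expr1n mulr1.
have -> : F * t ^+ 2 * expR t^-1 = F * expR t^-1 * t ^+ 2 by ring.
by rewrite ler_wpM2r// sqr_ge0.
Qed.

(** At 0 the difference quotient is at most a multiple of [|t|], by the quadratic
    bound. *)
Lemma is_derive_flat k (t : R) :
  is_derive (t : R) (1 : R) (flat k) (flat k.+2 t - k%:R * flat k.+1 t).
Proof.
have [t0|t0|->] := ltgtP t 0.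
- rewrite {2 3}/flat !ltNge (ltW t0) /= mulr0 subr0.
  apply: (@near_eq_is_derive _ _ _ (cst 0)).
  near=> s; rewrite /flat ltNge.
  have -> // : s <= 0.
  by apply: ltW; near: s; exact: lt_nbhsl.
- rewrite {2 3}/flat t0.
  suff : is_derive (t : R) (1 : R) (fun s : R => s^-1 ^+ k * expR (- s^-1))
      (t^-1 ^+ k.+2 * expR (- t^-1) - k%:R * (t^-1 ^+ k.+1 * expR (- t^-1))).
    apply: near_eq_is_derive; near=> s; rewrite /flat; have -> // : 0 < s.
    by near: s; exact: lt_nbhsr.
  have tn0 : t != 0 by rewrite gt_eqF.
  have dV : is_derive (t : R) (1 : R) (fun s : R => s^-1) (- t^-1 ^+ 2).
    have := @is_deriveV R id t 1 1 tn0 (is_derive_id _ _).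
    by rewrite exprVn /GRing.scale /= mulr1.
  have dX : is_derive (t : R) (1 : R) (fun s : R => s^-1 ^+ k) (- (k%:R * t^-1 ^+ k.+1)).
    case: k => [|k]; first by rewrite mul0r oppr0; exact: is_derive_cst.
    have -> : (fun s : R => s^-1 ^+ k.+1) = (fun s : R => s^-1) ^+ k.+1.
      by apply/funext => s; rewrite exprfctE.
    have := @is_deriveX R R (fun s : R => s^-1) k.+1 t 1 _ dV.
    congr is_derive; rewrite /GRing.scale /= !exprS expr0; ring.
  have dE : is_derive (t : R) (1 : R) (fun s : R => expR (- s^-1)) (t^-1 ^+ 2 * expR (- t^-1)).
    rewrite mulrC; apply: (@is_derive1_comp _ expR (fun s => - s^-1)).
    by rewrite -[X in is_derive _ _ _ X]opprK; apply: is_deriveN.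
  have := is_deriveM dX dE; congr is_derive; rewrite /GRing.scale /= !exprS expr0; ring.
- rewrite {2 3}/flat ltxx mulr0 subr0.
  have c0 : h^-1 *: ((flat k \o shift 0) (h *: (1 : R)) - flat k 0) @[h --> 0^'] --> (0 : R).
    apply: (@squeeze_cvgr _ _ _ _ (fun h : R => - ((k.+2)`!%:R * `|h|)) (fun h : R => (k.+2)`!%:R * `|h|)).
    - near=> h; have h0 : h != 0 by near: h; exact: nbhs_dnbhs_neq.
      rewrite -ler_norml /= /shift /= addr0 {2}/flat ltxx subr0 /GRing.scale /= mulr1.
      rewrite normrM (ger0_norm (flat_ge0 _ _)) normfV ler_pdivrMl ?normr_gt0//.
      apply: (le_trans (flat_le _ _)).
      by rewrite -(real_normK (num_real h)) expr2 [leRHS]mulrCA.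
    - rewrite -[X in _ --> X]oppr0; apply: cvgN.
      rewrite -[X in _ --> X](mulr0 (k.+2)`!%:R); apply: cvgMr.
      rewrite -[X in _ --> X](@normr0 R R); apply: cvg_norm; exact: nbhs_dnbhs.
    - rewrite -[X in _ --> X](mulr0 (k.+2)`!%:R); apply: cvgMr.
      rewrite -[X in _ --> X](@normr0 R R); apply: cvg_norm; exact: nbhs_dnbhs.
  split; first by apply/cvg_ex; exists 0.
  by apply: cvg_lim c0; exact: Rhausdorff.
Unshelve. all: by end_near. Qed.

Lemma smooth_flat k : smooth (flat k).
Proof.
apply: (@smooth_span (fun h => exists j, h = flat j)); last by apply: span_base; exists k.
move=> _ [j ->]; have H := is_derive_flat j.
split; first by move=> t; have [] := H t.
have -> : derive1 (flat j) = fun t => flat j.+2 t + (- j%:R) * flat j.+1 t.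
  by rewrite (is_derive_derive1 H); apply/funext => t; rewrite mulNr.
apply: span_add; [|apply: span_scale]; apply: span_base; [by exists j.+2|by exists j.+1].
Qed.

Lemma flat0_le1 t : flat 0 t <= 1.
Proof.
rewrite /flat; case: ifPn => t0; last exact: ler01.
by rewrite expr0 mul1r -[leRHS]expR0 ler_expR oppr_le0 invr_ge0 ltW.
Qed.

Lemma flat0_ge t : 0 < t -> 1 - t^-1 <= flat 0 t.
Proof. by move=> t0; rewrite /flat t0 expr0 mul1r; exact: expR_ge1Dx. Qed.

Lemma flat_eq0 k t : t <= 0 -> flat k t = 0.
Proof. by move=> t0; rewrite /flat ltNge t0. Qed.

(** Smooth functions supported in [[1/(n+1), b - 1/(n+1)]] that converge
    boundedly to the indicator function of the open interval from 0 to [b]. *)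
Definition cutoff (b : R) (n : nat) (t : R) : R :=
  flat 0 (n.+1%:R * t - 1) * flat 0 (n.+1%:R * (b - t) - 1).

Lemma smooth_cutoff b n : smooth (cutoff b n).
Proof.
apply: (@smoothM (fun t => flat 0 (n.+1%:R * t - 1)) (fun t => flat 0 (n.+1%:R * (b - t) - 1))).
  exact: (@smooth_affine _ n.+1%:R (-1) (@smooth_flat 0)).
have := @smooth_affine _ (- n.+1%:R) (n.+1%:R * b - 1) (@smooth_flat 0).
by congr smooth; apply/funext => t; congr flat; ring.
Qed.

Lemma cutoff_norm b n t : `|cutoff b n t| <= 1.
Proof.
by rewrite ger0_norm ?mulr_ge0 ?flat_ge0// mulr_ile1 ?flat_ge0 ?flat0_le1.
Qed.

Lemma test_cutoff b n : b <= 1 -> test_function (cutoff b n).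
Proof.
move=> b1; split; first exact: smooth_cutoff.
have n0 : 0 < n.+1%:R :> R by rewrite ltr0n.
exists (n.+1%:R^-1), (b - n.+1%:R^-1); split.
- by rewrite invr_gt0.
- by rewrite ltrBlDr (le_lt_trans b1)// ltrDl invr_gt0.
- move=> t; apply: contra_neqT; rewrite negb_and -!ltNge => /orP[h|h].
  + rewrite /cutoff (@flat_eq0 0 (_ * t - 1)) ?mul0r// subr_le0.
    by rewrite -ler_pdivlMl// mulr1 ltW.
  + rewrite /cutoff (@flat_eq0 0 (_ * (b - t) - 1)) ?mulr0// subr_le0.
    by rewrite -ler_pdivlMl// mulr1 lerBlDr -lerBlDl ltW.
Qed.

Lemma cutoff_eq0 b n t : ~~ ((0 < t) && (t < b)) -> cutoff b n t = 0.
Proof.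
have n0 : 0 <= n.+1%:R :> R by rewrite ler0n.
rewrite negb_and -!leNgt => /orP[h|h]; rewrite /cutoff.
  rewrite (@flat_eq0 0 (_ * t - 1)) ?mul0r// subr_le0 (le_trans _ ler01)//.
  by rewrite mulr_ge0_le0.
rewrite (@flat_eq0 0 (_ * (b - t) - 1)) ?mulr0// subr_le0 (le_trans _ ler01)//.
by rewrite mulr_ge0_le0// subr_le0.
Qed.

Lemma flat0_cvg (t : R) : 0 < t -> flat 0 (n.+1%:R * t - 1) @[n --> \oo] --> (1 : R).
Proof.
move=> t0.
apply: (@squeeze_cvgr _ _ _ _ (fun n : nat => 1 - 2 / t * n.+1%:R^-1) (cst 1)).
- near=> n; rewrite flat0_le1 andbT.
  have n2 : 2 / t <= n.+1%:R by rewrite (@le_trans _ _ n%:R) ?ler_nat//; near: n; exact: nbhs_infty_ger.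
  have n0 : 0 < n.+1%:R :> R by rewrite ltr0n.
  have s1 : 2 <= n.+1%:R * t by rewrite -ler_pdivrMr.
  apply: le_trans (flat0_ge _); last by rewrite subr_gt0 (lt_le_trans _ s1)// ltr1n.
  rewrite lerD2l lerN2.
  have -> : 2 / t / n.+1%:R = 2 / (n.+1%:R * t).
    by rewrite invfM -mulrA [t^-1 / _]mulrC.
  have u1 : 0 < n.+1%:R * t - 1 by rewrite subr_gt0 (lt_le_trans _ s1)// ltr1n.
  rewrite ler_pdivlMr ?mulr_gt0// mulrC ler_pdivrMr//; lra.
- rewrite -[X in _ --> X]subr0; apply: cvgB; first exact: cvg_cst.
  rewrite -[X in _ --> X](mulr0 (2 / t)); apply: cvgMr; exact: cvg_harmonic.
- exact: cvg_cst.
Unshelve. all: by end_near. Qed.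

Lemma cutoff_cvg b t :
  cutoff b n t @[n --> \oo] --> (if (0 < t) && (t < b) then 1 else 0 : R).
Proof.
case: ifPn => [/andP[t0 tb]|h].
  rewrite -[X in _ --> X]mulr1; apply: cvgM; apply: flat0_cvg => //.
  by rewrite subr_gt0.
by under eq_fun do rewrite cutoff_eq0//; exact: cvg_cst.
Qed.

Lemma Rintegral_dominated (D : set R) (f_ : nat -> R -> R) f g : measurable D ->
  (forall n, measurable_fun D (f_ n)) ->
  (forall t, D t -> f_ n t @[n --> \oo] --> f t) ->
  mu.-integrable D (EFin \o g) -> (forall n t, D t -> `|f_ n t| <= g t) ->
  mu.-integrable D (EFin \o f) /\
  \int[mu]_(t in D) f_ n t @[n --> \oo] --> \int[mu]_(t in D) f t.
Proof.
move=> mD mf cf ig fg.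
have mlim : measurable_fun D f by apply: measurable_fun_cvg cf.
have [] := @dominated_convergence _ _ _ mu D mD
  (fun n => EFin \o f_ n) (EFin \o f) (EFin \o g).
- by move=> n; apply/measurable_EFinP; exact: mf.
- by apply/measurable_EFinP; exact: mlim.
- apply: ae_everywhere => t It; apply: cvg_EFin; last exact: cf.
  by apply: nearW => n.
- exact: ig.
- by apply: ae_everywhere => t n It; rewrite /= lee_fin fg.
move=> if_ _ c; split; first exact: if_.
apply: (@fine_cvg _ _ _ _ _ (\int[mu]_(t in D) f t)).
rewrite /Rintegral fineK; first exact: c.
by apply: integrable_fin_num if_.
Qed.

Lemma int01_dominated (f_ : nat -> R -> R) f g :
  (forall n, measurable_fun I01 (f_ n)) ->
  (forall t, I01 t -> f_ n t @[n --> \oo] --> f t) ->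
  integrable01 g -> (forall n t, I01 t -> `|f_ n t| <= g t) ->
  integrable01 f /\ int01 (f_ n) @[n --> \oo] --> int01 f.
Proof. exact: Rintegral_dominated measurable_I01. Qed.

Lemma prim_dominated (f_ : nat -> R -> R) f g t : I01 t ->
  (forall n, measurable_fun I01 (f_ n)) ->
  (forall s, I01 s -> f_ n s @[n --> \oo] --> f s) ->
  integrable01 g -> (forall n s, I01 s -> `|f_ n s| <= g s) ->
  prim (f_ n) t @[n --> \oo] --> prim f t.
Proof.
move=> It mf cf ig fg; apply: (@Rintegral_dominated _ _ _ g _ _ _ _ _).2 => //.
- by move=> n; apply: measurable_funS (mf n); [exact: measurable_I01|exact: sub_I01].
- by move=> s /(sub_I01 It); exact: cf.
- exact: integrable01S.
- by move=> n s /(sub_I01 It); exact: fg.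
Qed.

(** Dominated convergence; the limit of the cutoff functions and the indicator
    function of [[0, b]] differ only at the endpoints. *)
Lemma int01_cutoff_cvg b f : 0 < b -> b <= 1 -> integrable01 f ->
  int01 (fun t => cutoff b n t * f t) @[n --> \oo] --> prim f b.
Proof.
move=> b0 b1 hf.
have mf := integrable01_measurable hf.
have mcut n : measurable_fun I01 (cutoff b n).
  apply: integrable01_measurable; apply: integrable01_continuous.
  by apply: continuous_subspaceT; apply: smooth_continuous; exact: smooth_cutoff.
pose h t := (if (0 < t) && (t < b) then 1 else 0) * f t.
have [ih] : integrable01 h /\
    int01 (fun t => cutoff b n t * f t) @[n --> \oo] --> int01 h.
  apply: (@int01_dominated _ _ (fun t => `|f t|)).
  - by move=> n; apply: measurable_funM.
  - by move=> t _; apply: cvgMl; exact: cutoff_cvg.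
  - exact: integrable01_normr.
  - by move=> n t _; rewrite normrM ler_piMl// cutoff_norm.
suff -> : int01 h = prim f b by [].
have Ib : I01 b by apply/in_I01; rewrite ltW.
have bI : I01 `&` `[0, b]%classic = `[0, b]%classic.
  by rewrite setIC; apply/setIidPl; exact: sub_I01.
transitivity (int01 (f \_ `[0, b])); last first.
  by rewrite /int01 -Rintegral_mkcondr bI.
apply: int01_ae; first exact: integrable01_measurable.
  apply/measurable_restrict => //; first exact: measurable_I01.
  by rewrite bI; apply: (measurable_funS measurable_I01) => //; exact: sub_I01.
apply: aeS (aeI (ae_neq 0) (ae_neq b)) => t [t0 tb] It.
have /in_I01/andP[t_ge0 t_le1] := It.
rewrite /h patchE lt_neqAle eq_sym t0 t_ge0 /= lt_neqAle tb /=.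
case: ifPn => [tlb|/negP tlb]; first by rewrite mem_set ?mul1r//= in_itv/= t_ge0.
rewrite mul0r memNset// => /=; rewrite in_itv/= => /andP[_].
exact: tlb.
Qed.

Lemma test_functionP (phi : R -> R) : test_function phi ->
  [/\ smooth phi, phi 0 = 0 & phi 1 = 0].
Proof.
move=> [sphi [a [b [a0 b1 supp]]]]; split; first exact: sphi.
  by apply: contrapT => /eqP/supp; rewrite leNgt a0.
by apply: contrapT => /eqP/supp; rewrite (leNgt 1) b1 andbF.
Qed.

Lemma primitive01_smooth f : smooth f -> primitive01 f (derive1 f).
Proof.
move=> sf; apply: primitive01_C1; first by move=> x; exact: smooth_derivable.
by apply: smooth_continuous; exact: smooth_derive1.
Qed.

Lemma sqr_integrable01_smooth f : smooth f -> sqr_integrable01 f.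
Proof.
move=> sf; apply: sqr_integrable01_continuous; apply: continuous_subspaceT.
exact: smooth_continuous.
Qed.

Lemma continuous01_bounded f : {within I01, continuous f} ->
  exists M : R, forall t, I01 t -> `|f t| <= M.
Proof.
move=> cf.
have [M [_ /(_ (M + 1))]] := compact_bounded (continuous_compact cf (@segment_compact R 0 1)).
rewrite ltrDl ltr01 => /(_ isT) MP; exists (M + 1) => t It; apply: MP.
by exists t.
Qed.

Lemma integrable01M_continuous f g : {within I01, continuous f} ->
  integrable01 g -> integrable01 (fun t => f t * g t).
Proof.
move=> cf ig; have [M MP] := continuous01_bounded cf.
apply: integrable01_le (integrable01Z M (integrable01_normr ig)) _.
  by apply: measurable_funM; apply: integrable01_measurable => //;
    exact: integrable01_continuous.
by apply: ae_everywhere => t It; rewrite normrM ler_wpM2r// MP.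
Qed.

Lemma integrable01M_smooth f g : smooth f -> integrable01 g ->
  integrable01 (fun t => f t * g t).
Proof.
move=> sf; apply: integrable01M_continuous; apply: continuous_subspaceT.
exact: smooth_continuous.
Qed.

(** The fundamental lemma of the calculus of variations: by testing with cutoff
    functions one obtains the integral of [f] over every [[0, b]]. *)
Lemma ae01_eq0_test f : integrable01 f ->
  (forall phi, test_function phi -> int01 (fun t => phi t * f t) = 0) ->
  ae01 f (cst 0).
Proof.
move=> hf H; apply: prim_eq0 => // b /in_I01/andP[].
rewrite le_eqVlt => /predU1P[<- _|b0 b1]; first exact: prim0.
have := int01_cutoff_cvg b0 b1 hf.
have -> : (fun n => int01 (fun t => cutoff b n t * f t)) = cst 0.
  by apply/funext => n; apply: H; exact: test_cutoff.
by move=> c; apply: (cvg_unique _ c (cvg_cst _)); exact: Rhausdorff.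
Qed.

Lemma test_normalized : exists2 eta : R -> R, test_function eta & int01 eta = 1.
Proof.
have [n n0] : exists n, int01 (cutoff 1 n) != 0.
  apply: contrapT => /forallNP H.
  have := int01_cutoff_cvg ltr01 (lexx 1) (integrable01_cst 1).
  rewrite prim1 int01_cst.
  have -> : (fun n => int01 (fun t => cutoff 1 n t * cst 1 t)) = cst 0.
    apply/funext => n; transitivity (int01 (cutoff 1 n)).
      by apply: eq_int01 => t _; rewrite mulr1.
    by apply/eqP; apply: contrapT => /negP; exact: H.
  move=> c; have /eqP : (1 : R) = 0.
    by apply: (cvg_unique _ c (cvg_cst _)); exact: Rhausdorff.
  by rewrite oner_eq0.
exists (fun t => (int01 (cutoff 1 n))^-1 * cutoff 1 n t).
  have [sc [a [b [a0 b1 supp]]]] := @test_cutoff 1 n (lexx 1).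
  split; first exact: smoothZ.
  by exists a, b; split => // t; rewrite mulf_eq0 negb_or => /andP[_ /supp].
rewrite int01Z ?mulVf//; apply: sqr_integrable01_integrable.
by apply: sqr_integrable01_smooth; exact: smooth_cutoff.
Qed.

(** The primitive vanishes before the support of [g], and after it because the
    integral of [g] is 0. *)
Lemma test_primitive g : test_function g -> int01 g = 0 ->
  exists2 psi, test_function psi & derive1 psi = g.
Proof.
move=> [sg [a [b [a0 b1 supp]]]] g0.
have cg : continuous g by exact: smooth_continuous.
have g_eq0 t : ~~ (a <= t <= b) -> g t = 0 by move=> h; apply: contra_notP (negP h) => /eqP/supp.
have prim_lt t : t < a -> prim g t = 0.
  move=> ta; rewrite (@eq_prim _ g (cst 0)).
    by rewrite /prim /Rintegral integral0.
  by move=> s /andP[s0 st]; rewrite g_eq0// negb_and -ltNge (le_lt_trans st).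
have H t : is_derive (t : R) (1 : R) (prim g) (g t).
  have [ta|ta] := ltP t a.
    rewrite g_eq0 ?negb_and -?ltNge ?ta//; apply: (@near_eq_is_derive _ _ _ (cst 0)).
    by near=> s; rewrite prim_lt//; near: s; exact: lt_nbhsl.
  have ig : mu.-integrable `[0, t + 1] (EFin \o g).
    apply: continuous_compact_integrable; first exact: segment_compact.
    exact: continuous_subspaceT.
  have [] := continuous_FTC1_closed _ ig (lt_le_trans a0 ta) (cg t).
    by rewrite ltrDl.
  by move=> d <-; exact: derivableP1.
have E := is_derive_derive1 H.
exists (prim g); last exact: E.
split.
  move=> [|n] t; first by have [] := H t.
  by rewrite derive1Sn E; exact: sg.
exists a, b; split => // t; apply: contra_neqT.
rewrite negb_and -!ltNge => /orP[/prim_lt//|bt].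
rewrite -g0 -prim1 /prim Rintegral_mkcond [RHS]Rintegral_mkcond.
congr Rintegral; apply/funext => s; rewrite !patchE.
have [sb|bs] := ltP b s.
  by rewrite g_eq0 ?negb_and -?ltNge ?sb ?orbT// !if_same.
congr (if _ then _ else _); apply/idP/idP => /set_mem; rewrite /= in_itv/= => /andP[s0 _];
  by apply/mem_set; rewrite /= in_itv/= s0 ?(le_trans bs (ltW b1)) ?(le_trans bs (ltW bt)).
Unshelve. all: by end_near. Qed.

(** The lemma of du Bois-Reymond.  The difference [F] of [f] and the primitive of
    [g] has weak derivative 0, that is, it is orthogonal to the derivatives of
    test functions.  These are the test functions of integral 0; so, if [eta] is
    a test function of integral 1, then subtracting from [F] its integral against
    [eta] makes it orthogonal to all test functions. *)
Lemma weak_derivative_prim f g : integrable01 f -> integrable01 g ->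
  (forall phi, test_function phi ->
     int01 (fun t => derive1 phi t * f t) = - int01 (fun t => phi t * g t)) ->
  exists c, ae01 f (fun t => c + prim g t).
Proof.
move=> hf hg H.
pose F t := f t - prim g t.
have ip : integrable01 (prim g) by apply: integrable01_continuous; exact: prim_continuous.
have hF : integrable01 F by exact: integrable01B.
have F0 phi : test_function phi -> int01 (fun t => derive1 phi t * F t) = 0.
  move=> tphi; have [sphi p0 p1] := test_functionP tphi.
  have -> : int01 (fun t => derive1 phi t * F t) =
     int01 (fun t => derive1 phi t * f t - derive1 phi t * prim g t).
    by apply: eq_int01 => t _; rewrite /F mulrBr.
  have sd := smooth_derive1 sphi.
  rewrite int01B; [|exact: integrable01M_smooth|exact: integrable01M_smooth].
  rewrite H//.
  have := int01_by_parts (primitive01_smooth sphi) (primitive01_prim 0 hg).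
  rewrite p0 p1 !mul0r subrr.
  under eq_int01 do rewrite add0r.
  by move=> /eqP; rewrite addr_eq0 => /eqP->; rewrite opprK addNr.
have [eta teta ieta] := test_normalized.
have [seta e0 e1] := test_functionP teta.
pose c := int01 (fun t => eta t * F t); exists c.
have : ae01 (fun t => F t - c) (cst 0).
  apply: ae01_eq0_test; first by apply: integrable01B => //; exact: integrable01_cst.
  move=> phi tphi; have [sphi p0 p1] := test_functionP tphi.
  pose k := int01 phi.
  have isphi := sqr_integrable01_integrable (sqr_integrable01_smooth sphi).
  have iseta := sqr_integrable01_integrable (sqr_integrable01_smooth seta).
  have [||psi tpsi dpsi] := @test_primitive (fun t => phi t + (- k) * eta t).
  - split; first exact: (smoothD sphi (@smoothZ _ _ seta)).
    have [_ [a [b [a0 b1 supp]]]] := tphi; have [_ [a' [b' [a'0 b'1 supp']]]] := teta.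
    exists (Num.min a a'), (Num.max b b'); split.
    + by rewrite lt_min a0.
    + by rewrite gt_max b1.
    move=> t; rewrite ge_min le_max; have [->|/supp/andP[-> ->]//] := eqVneq (phi t) 0.
    have [->|/supp'/andP[-> ->]] := eqVneq (eta t) 0; last by rewrite !orbT.
    by rewrite mulr0 addr0 eqxx.
  - rewrite int01D ?int01Z ?ieta//; first by rewrite mulr1 subrr.
    exact: integrable01Z.
  have := F0 _ tpsi; rewrite dpsi.
  have -> : int01 (fun t => (phi t + (- k) * eta t) * F t) =
      int01 (fun t => phi t * F t + (- k) * (eta t * F t)).
    by apply: eq_int01 => t _; ring.
  have -> : int01 (fun t => phi t * (F t - c)) =
      int01 (fun t => phi t * F t + (- c) * phi t).
    by apply: eq_int01 => t _; ring.
  have iphF := integrable01M_smooth sphi hF.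
  have ietF := integrable01M_smooth seta hF.
  rewrite (int01D iphF (integrable01Z _ ietF)) (int01D iphF (integrable01Z _ isphi)).
  rewrite (int01Z _ ietF) (int01Z _ isphi) => <-; rewrite -/k -/c; ring.
by apply: aeS => t /[apply]/eqP; rewrite subr_eq0 /F subr_eq => /eqP.
Qed.

End TestFunctions.

(** * The scalar field and its scalar products *)

Section ScalarTheory.
Context {R : realType} {k : scalar_kind}.
Local Notation K := (Kfield R k).
Implicit Types (x y z : K) (a b : R).

Lemma K_ext x y : reK x = reK y -> imK x = imK y -> x = y.
Proof.
case: k x y => [|] x y; first by [].
by case: x => a b; case: y => c d /= -> ->.
Qed.

Lemma reK_mk a b : reK (mkK a b : K) = a.
Proof. by case: k. Qed.

Lemma mkKE z : mkK (reK z) (imK z) = z.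
Proof. by case: k z => [|] // [a b]. Qed.

Lemma reK_ofR a : reK (ofR a : K) = a.
Proof. exact: reK_mk. Qed.

Lemma imK_ofR a : imK (ofR a : K) = 0.
Proof. by rewrite /ofR; case: k. Qed.

Lemma reK_zmod_morphism : zmod_morphism (reK : K -> R).
Proof. by case: k => [|] x y; first by []; case: x => a b; case: y. Qed.
HB.instance Definition _ := GRing.isZmodMorphism.Build K R reK reK_zmod_morphism.

Lemma imK_zmod_morphism : zmod_morphism (imK : K -> R).
Proof.
by case: k => [|] x y; [rewrite /= subrr|case: x => a b; case: y].
Qed.
HB.instance Definition _ := GRing.isZmodMorphism.Build K R imK imK_zmod_morphism.

Lemma reKM x y : reK (x * y) = reK x * reK y - imK x * imK y.
Proof.
by case: k x y => [|] x y; [rewrite /= mulr0 subr0|case: x => a b; case: y].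
Qed.

Lemma imKM x y : imK (x * y) = reK x * imK y + imK x * reK y.
Proof.
by case: k x y => [|] x y; [rewrite /= mulr0 mul0r addr0|case: x => a b; case: y].
Qed.

Lemma reK1 : reK (1 : K) = 1. Proof. by case: k. Qed.
Lemma imK1 : imK (1 : K) = 0. Proof. by case: k. Qed.

Lemma ofR_zmod_morphism : zmod_morphism (ofR : R -> K).
Proof.
by move=> a b; apply: K_ext; rewrite raddfB /= ?reK_ofR ?imK_ofR ?subrr.
Qed.
HB.instance Definition _ := GRing.isZmodMorphism.Build R K ofR ofR_zmod_morphism.

Lemma ofR_monoid_morphism : monoid_morphism (ofR : R -> K).
Proof.
split; first by apply: K_ext; rewrite ?reK_ofR ?imK_ofR ?reK1 ?imK1.
by move=> a b; apply: K_ext; rewrite ?reKM ?imKM ?reK_ofR ?imK_ofR ?mulr0 ?mul0r ?subr0 ?addr0.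
Qed.
HB.instance Definition _ := GRing.isMonoidMorphism.Build R K ofR ofR_monoid_morphism.

Lemma reK_conj z : reK (conjF z) = reK z.
Proof. by rewrite /conjF reK_mk. Qed.

Lemma imK_conj z : imK (conjF z) = - imK z.
Proof. by rewrite /conjF; case: k z => [|] z; rewrite /= ?oppr0. Qed.

Lemma conjF_zmod_morphism : zmod_morphism (conjF : K -> K).
Proof.
by move=> x y; apply: K_ext; rewrite raddfB /= ?reK_conj ?imK_conj ?raddfB//= opprB opprK addrC.
Qed.
HB.instance Definition _ := GRing.isZmodMorphism.Build K K conjF conjF_zmod_morphism.

Lemma conjF_monoid_morphism : monoid_morphism (conjF : K -> K).
Proof.
split; first by apply: K_ext; rewrite ?reK_conj ?imK_conj ?reK1 ?imK1 ?oppr0.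
move=> x y; apply: K_ext; rewrite ?(reKM, imKM, reK_conj, imK_conj); ring.
Qed.
HB.instance Definition _ := GRing.isMonoidMorphism.Build K K conjF conjF_monoid_morphism.

Lemma conjFK : involutive (conjF : K -> K).
Proof.
by move=> x; apply: K_ext; rewrite ?(reK_conj, imK_conj) ?opprK.
Qed.

Lemma conjF_ofR a : conjF (ofR a) = ofR a :> K.
Proof. by apply: K_ext; rewrite ?(reK_conj, imK_conj, reK_ofR, imK_ofR) ?oppr0. Qed.

(** For both fields, since complex numbers are comparable only when their
    imaginary parts agree. *)
Lemma leKP x y : reflect (imK x = imK y /\ reK x <= reK y) (x <= y).
Proof.
apply: (iffP idP); case: k x y => [|] x y //=.
- by case: x => a b; case: y => c d; rewrite lecE /= => /andP[/eqP -> ->].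
- by case.
- by case: x => a b; case: y => c d /= [-> h]; rewrite lecE /= eqxx.
Qed.

Lemma ltKW x y : x < y -> reK x < reK y.
Proof.
case: k x y => [|] x y //=.
by case: x => a b; case: y => c d; rewrite ltcE /= => /andP[].
Qed.

Lemma normK_le x a : `|x| <= ofR a -> `|reK x| <= a /\ `|imK x| <= a.
Proof.
case: k x => [|] x /=.
  by rewrite /ofR /= => h; split => //; rewrite normr0 (le_trans _ h).
case: x => u v; rewrite normc_def /ofR /= lecR => h.
have h0 := le_trans (sqrtr_ge0 _) h.
split; rewrite -ler_sqr ?nnegrE// real_normK ?num_real//;
  apply: (@le_trans _ _ (Num.sqrt (u ^+ 2 + v ^+ 2) ^+ 2)).
- by rewrite sqr_sqrtr ?addr_ge0 ?sqr_ge0// lerDl sqr_ge0.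
- by rewrite ler_sqr ?nnegrE ?sqrtr_ge0.
- by rewrite sqr_sqrtr ?addr_ge0 ?sqr_ge0// lerDr sqr_ge0.
- by rewrite ler_sqr ?nnegrE ?sqrtr_ge0.
Qed.

Definition normKsq z : R := reK z ^+ 2 + imK z ^+ 2.

Lemma reK_conjM x y : reK (conjF x * y) = reK x * reK y + imK x * imK y.
Proof. by rewrite reKM reK_conj imK_conj mulNr opprK. Qed.

(** * Conjugate transposes and the scalar product *)

Lemma ctmxE m n (A : 'M[K]_(m, n)) i j : ctmx A i j = conjF (A j i).
Proof. by rewrite /ctmx !mxE. Qed.

Lemma ctmxM m n p (A : 'M[K]_(m, n)) (B : 'M[K]_(n, p)) :
  ctmx (A *m B) = ctmx B *m ctmx A.
Proof. by rewrite /ctmx map_mxM trmx_mul. Qed.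

Lemma ctmxK m n (A : 'M[K]_(m, n)) : ctmx (ctmx A) = A.
Proof. by apply/matrixP => i j; rewrite !ctmxE conjFK. Qed.

Lemma ctmxD m n (A B : 'M[K]_(m, n)) : ctmx (A + B) = ctmx A + ctmx B.
Proof. by apply/matrixP => i j; rewrite !(ctmxE, mxE) rmorphD. Qed.

Lemma ctmxZ m n (c : K) (A : 'M[K]_(m, n)) : ctmx (c *: A) = conjF c *: ctmx A.
Proof. by apply/matrixP => i j; rewrite !(ctmxE, mxE) rmorphM. Qed.

Lemma dotvE n (u v : 'cV[K]_n) : dotv u v = \sum_i conjF (u i 0) * v i 0.
Proof. by rewrite /dotv mxE; apply: eq_bigr => i _; rewrite ctmxE. Qed.

Lemma dotv_adj m n (A : 'M[K]_(m, n)) u v : dotv (A *m u) v = dotv u (ctmx A *m v).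
Proof. by rewrite /dotv ctmxM mulmxA. Qed.

Lemma conj_dotv n (u v : 'cV[K]_n) : conjF (dotv u v) = dotv v u.
Proof.
rewrite !dotvE rmorph_sum; apply: eq_bigr => i _.
by rewrite rmorphM /= conjFK mulrC.
Qed.

Lemma dotvDl n (u v w : 'cV[K]_n) : dotv (u + v) w = dotv u w + dotv v w.
Proof. by rewrite /dotv ctmxD mulmxDl mxE. Qed.

Lemma dotvDr n (u v w : 'cV[K]_n) : dotv w (u + v) = dotv w u + dotv w v.
Proof. by rewrite /dotv mulmxDr mxE. Qed.

Lemma dotvZl n (c : K) (u v : 'cV[K]_n) : dotv (c *: u) v = conjF c * dotv u v.
Proof. by rewrite /dotv ctmxZ -scalemxAl mxE. Qed.

Lemma dotvZr n (c : K) (u v : 'cV[K]_n) : dotv u (c *: v) = c * dotv u v.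
Proof. by rewrite /dotv -scalemxAr mxE. Qed.

Lemma dotv0l n (v : 'cV[K]_n) : dotv 0 v = 0.
Proof. by rewrite -(scale0r 0) dotvZl rmorph0 mul0r. Qed.

Lemma dotv0r n (v : 'cV[K]_n) : dotv v 0 = 0.
Proof. by rewrite -(scale0r 0) dotvZr mul0r. Qed.

Lemma dotv_suml n (I : Type) (s : seq I) (u : I -> 'cV[K]_n) v :
  dotv (\sum_(i <- s) u i) v = \sum_(i <- s) dotv (u i) v.
Proof.
by elim: s => [|i s IH]; rewrite !(big_nil, big_cons) ?dotv0l// dotvDl IH.
Qed.

Lemma dotv_sumr n (I : Type) (s : seq I) (u : I -> 'cV[K]_n) v :
  dotv v (\sum_(i <- s) u i) = \sum_(i <- s) dotv v (u i).
Proof.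
by elim: s => [|i s IH]; rewrite !(big_nil, big_cons) ?dotv0r// dotvDr IH.
Qed.

Lemma reK_dotvv n (u : 'cV[K]_n) : reK (dotv u u) = \sum_i normKsq (u i 0).
Proof.
rewrite dotvE raddf_sum; apply: eq_bigr => i _.
by rewrite /= reK_conjM /normKsq !expr2.
Qed.

Lemma normKsq_ge0 z : 0 <= normKsq z.
Proof. by rewrite addr_ge0 ?sqr_ge0. Qed.

Lemma dotvv_ge0 n (u : 'cV[K]_n) : 0 <= reK (dotv u u).
Proof. by rewrite reK_dotvv sumr_ge0// => i _; exact: normKsq_ge0. Qed.

Lemma dotvv_eq0 n (u : 'cV[K]_n) : reK (dotv u u) = 0 -> u = 0.
Proof.
rewrite reK_dotvv => /eqP; rewrite psumr_eq0; last by move=> i _; exact: normKsq_ge0.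
move=> /allP h; apply/colP => i; rewrite mxE.
have /eqP := h i (mem_index_enum i); rewrite /normKsq => /eqP.
rewrite paddr_eq0 ?sqr_ge0// !sqrf_eq0 => /andP[/eqP r0 /eqP i0].
by apply: K_ext; rewrite ?r0 ?i0 raddf0.
Qed.

End ScalarTheory.

(** * Integrals with scalar values *)

Section ScalarIntegrals.
Context {R : realType} {k : scalar_kind}.
Local Notation K := (Kfield R k).
Local Notation mu := (@lebesgue_measure R).
Local Notation I01 := (@I01 R).
Implicit Types (f g F G : R -> K) (c : K).

Definition reim (Q : (R -> R) -> Prop) f : Prop :=
  Q (fun t => reK (f t)) /\ Q (fun t => imK (f t)).

Definition measurableK := reim (measurable_fun I01).
Definition integrableK := reim integrable01.
Definition L2K := reim sqr_integrable01.

Lemma reK_integral f : reK (integralK f) = int01 (fun t => reK (f t)).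
Proof. by rewrite /integralK reK_mk. Qed.

Lemma imK_integral f : imK (integralK f) = int01 (fun t => imK (f t)).
Proof.
rewrite /integralK; case: k f => [|] f //=.
by rewrite -[LHS]int01_cst.
Qed.

Lemma eq_integralK f g : (forall t, I01 t -> f t = g t) -> integralK f = integralK g.
Proof.
by move=> fg; apply: K_ext; rewrite ?reK_integral ?imK_integral;
  apply: eq_int01 => t /fg ->.
Qed.

Lemma integralK_ae f g : measurableK f -> measurableK g -> ae01 f g ->
  integralK f = integralK g.
Proof.
move=> [mf1 mf2] [mg1 mg2] fg.
by apply: K_ext; rewrite ?reK_integral ?imK_integral; apply: int01_ae => //;
  apply: aeS fg => t /[apply] ->.
Qed.

Lemma integrableKD f g : integrableK f -> integrableK g ->
  integrableK (fun t => f t + g t).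
Proof.
move=> [f1 f2] [g1 g2]; split.
- have := integrable01D f1 g1; congr integrable01; apply/funext => t.
  by rewrite raddfD.
- have := integrable01D f2 g2; congr integrable01; apply/funext => t.
  by rewrite raddfD.
Qed.

Lemma integralKD f g : integrableK f -> integrableK g ->
  integralK (fun t => f t + g t) = integralK f + integralK g.
Proof.
move=> [f1 f2] [g1 g2]; apply: K_ext; rewrite raddfD /= ?reK_integral ?imK_integral.
- by rewrite -int01D//; apply: eq_int01 => t _; rewrite raddfD.
- by rewrite -int01D//; apply: eq_int01 => t _; rewrite raddfD.
Qed.

Lemma integrableKZ c f : integrableK f -> integrableK (fun t => c * f t).
Proof.
move=> [f1 f2]; split.
- have := integrable01B (integrable01Z (reK c) f1) (integrable01Z (imK c) f2).
  by congr integrable01; apply/funext => t; rewrite reKM.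
- have := integrable01D (integrable01Z (reK c) f2) (integrable01Z (imK c) f1).
  by congr integrable01; apply/funext => t; rewrite imKM.
Qed.

Lemma integralKZ c f : integrableK f ->
  integralK (fun t => c * f t) = c * integralK f.
Proof.
move=> [f1 f2]; have [h1 h2] := (integrable01Z (reK c) f1, integrable01Z (imK c) f2).
have [h3 h4] := (integrable01Z (reK c) f2, integrable01Z (imK c) f1).
apply: K_ext; rewrite ?reKM ?imKM ?reK_integral ?imK_integral.
- rewrite -!int01Z// -int01B//; apply: eq_int01 => t _; exact: reKM.
- rewrite -!int01Z// -int01D//; apply: eq_int01 => t _; exact: imKM.
Qed.

Lemma integralK0 : integralK (fun=> 0 : K) = 0.
Proof.
by apply: K_ext; rewrite ?reK_integral ?imK_integral !raddf0; exact: int01_cst.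
Qed.

Lemma integrableK0 : integrableK (fun=> 0 : K).
Proof. by rewrite /integrableK /reim !raddf0; split; exact: integrable01_cst. Qed.

Lemma integrableK_sum (I : Type) (s : seq I) (h : I -> R -> K) :
  (forall i, integrableK (h i)) -> integrableK (fun t => \sum_(i <- s) h i t).
Proof.
move=> hh; elim: s => [|i s IH].
  by rewrite (_ : (fun _ => _) = fun=> 0); [exact: integrableK0|
    apply/funext => t; rewrite big_nil].
rewrite (_ : (fun _ => _) = fun t => h i t + \sum_(j <- s) h j t).
  exact: integrableKD.
by apply/funext => t; rewrite big_cons.
Qed.

Lemma integralK_sum (I : Type) (s : seq I) (h : I -> R -> K) :
  (forall i, integrableK (h i)) ->
  integralK (fun t => \sum_(i <- s) h i t) = \sum_(i <- s) integralK (h i).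
Proof.
move=> hh; elim: s => [|i s IH].
  by rewrite big_nil -[RHS]integralK0; apply: eq_integralK => t _; rewrite big_nil.
rewrite big_cons -IH -integralKD//; last exact: integrableK_sum.
by apply: eq_integralK => t _; rewrite big_cons.
Qed.

Lemma integralK_conj f : integrableK f ->
  integralK (fun t => conjF (f t)) = conjF (integralK f).
Proof.
move=> [f1 f2]; apply: K_ext; rewrite ?reK_conj ?imK_conj ?reK_integral ?imK_integral.
- by apply: eq_int01 => t _; rewrite reK_conj.
- by rewrite -int01N//; apply: eq_int01 => t _; rewrite imK_conj.
Qed.

Lemma L2K_integrable f : L2K f -> integrableK f.
Proof. by move=> [f1 f2]; split; exact: sqr_integrable01_integrable. Qed.

Lemma L2K_measurable f : L2K f -> measurableK f.
Proof. by move=> [[f1 _] [f2 _]]. Qed.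

Lemma integrableK_measurable f : integrableK f -> measurableK f.
Proof. by move=> [f1 f2]; split; exact: integrable01_measurable. Qed.

Lemma measurableKD f g : measurableK f -> measurableK g ->
  measurableK (fun t => f t + g t).
Proof.
move=> [f1 f2] [g1 g2]; split.
- have := measurable_funD f1 g1; congr measurable_fun; apply/funext => t.
  by rewrite raddfD.
- have := measurable_funD f2 g2; congr measurable_fun; apply/funext => t.
  by rewrite raddfD.
Qed.

Lemma measurableKM f g : measurableK f -> measurableK g ->
  measurableK (fun t => f t * g t).
Proof.
move=> [f1 f2] [g1 g2]; split.
- have := measurable_funB (measurable_funM f1 g1) (measurable_funM f2 g2).
  by congr measurable_fun; apply/funext => t; rewrite reKM.
- have := measurable_funD (measurable_funM f1 g2) (measurable_funM f2 g1).
  by congr measurable_fun; apply/funext => t; rewrite imKM.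
Qed.

Lemma measurableK_cst c : measurableK (fun=> c).
Proof. by split; exact: measurable_cst. Qed.

Lemma measurableK_sum (I : Type) (s : seq I) (h : I -> R -> K) :
  (forall i, measurableK (h i)) -> measurableK (fun t => \sum_(i <- s) h i t).
Proof.
move=> hh; elim: s => [|i s IH].
  by rewrite (_ : (fun _ => _) = fun=> 0); [exact: measurableK_cst|
    apply/funext => t; rewrite big_nil].
rewrite (_ : (fun _ => _) = fun t => h i t + \sum_(j <- s) h j t).
  exact: measurableKD.
by apply/funext => t; rewrite big_cons.
Qed.

Lemma measurableK_prod (I : Type) (s : seq I) (h : I -> R -> K) :
  (forall i, measurableK (h i)) -> measurableK (fun t => \prod_(i <- s) h i t).
Proof.
move=> hh; elim: s => [|i s IH].
  by rewrite (_ : (fun _ => _) = fun=> 1); [exact: measurableK_cst|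
    apply/funext => t; rewrite big_nil].
rewrite (_ : (fun _ => _) = fun t => h i t * \prod_(j <- s) h j t).
  exact: measurableKM.
by apply/funext => t; rewrite big_cons.
Qed.

Lemma L2KM f g : L2K f -> L2K g -> integrableK (fun t => f t * g t).
Proof.
move=> [f1 f2] [g1 g2]; split.
- have := integrable01B (sqr_integrable01M f1 g1) (sqr_integrable01M f2 g2).
  by congr integrable01; apply/funext => t; rewrite reKM.
- have := integrable01D (sqr_integrable01M f1 g2) (sqr_integrable01M f2 g1).
  by congr integrable01; apply/funext => t; rewrite imKM.
Qed.

Lemma L2KD f g : L2K f -> L2K g -> L2K (fun t => f t + g t).
Proof.
move=> [f1 f2] [g1 g2]; split.
- have := sqr_integrable01D f1 g1; congr sqr_integrable01; apply/funext => t.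
  by rewrite raddfD.
- have := sqr_integrable01D f2 g2; congr sqr_integrable01; apply/funext => t.
  by rewrite raddfD.
Qed.

Lemma L2KM_bounded f a (C : R) : L2K f -> measurableK a ->
  {ae mu, forall t, I01 t -> `|reK (a t)| <= C /\ `|imK (a t)| <= C} ->
  L2K (fun t => a t * f t).
Proof.
move=> [f1 f2] [a1 a2] aC.
have aC1 : {ae mu, forall t, I01 t -> `|reK (a t)| <= C} by apply: aeS aC => t /[apply] -[].
have aC2 : {ae mu, forall t, I01 t -> `|imK (a t)| <= C} by apply: aeS aC => t /[apply] -[].
split.
- have := sqr_integrable01D (sqr_integrable01M_bounded f1 a1 aC1)
    (sqr_integrable01N (sqr_integrable01M_bounded f2 a2 aC2)).
  by congr sqr_integrable01; apply/funext => t; rewrite reKM.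
- have := sqr_integrable01D (sqr_integrable01M_bounded f2 a1 aC1)
    (sqr_integrable01M_bounded f1 a2 aC2).
  by congr sqr_integrable01; apply/funext => t; rewrite imKM.
Qed.

Lemma L2K_conj f : L2K f -> L2K (fun t => conjF (f t)).
Proof.
move=> [f1 f2]; split.
- by move: f1; congr sqr_integrable01; apply/funext => t; rewrite reK_conj.
- have := sqr_integrable01N f2; congr sqr_integrable01; apply/funext => t.
  by rewrite imK_conj.
Qed.

Lemma L2K0 : L2K (fun=> 0 : K).
Proof. by rewrite /L2K /reim !raddf0; split; exact: sqr_integrable01_cst. Qed.

Lemma L2K_sum (I : Type) (s : seq I) (h : I -> R -> K) :
  (forall i, L2K (h i)) -> L2K (fun t => \sum_(i <- s) h i t).
Proof.
move=> hh; elim: s => [|i s IH].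
  by rewrite (_ : (fun _ => _) = fun=> 0); [exact: L2K0|
    apply/funext => t; rewrite big_nil].
rewrite (_ : (fun _ => _) = fun t => h i t + \sum_(j <- s) h j t).
  exact: L2KD.
by apply/funext => t; rewrite big_cons.
Qed.

(** * Primitives with scalar values *)

Definition primitiveK F f : Prop :=
  primitive01 (fun t => reK (F t)) (fun t => reK (f t)) /\
  primitive01 (fun t => imK (F t)) (fun t => imK (f t)).

Definition continuousK := reim (fun g : R -> R => {within I01, continuous g}).

Lemma continuousK_L2K f : continuousK f -> L2K f.
Proof. by move=> [f1 f2]; split; exact: sqr_integrable01_continuous. Qed.

Lemma primitiveK_continuous F f : primitiveK F f -> continuousK F.
Proof. by move=> [h1 h2]; split; [exact: primitive01_continuous h1|exact: primitive01_continuous h2]. Qed.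

Lemma primitiveKD F f G g : primitiveK F f -> primitiveK G g ->
  primitiveK (fun t => F t + G t) (fun t => f t + g t).
Proof.
move=> [h1 h2] [h3 h4]; split.
- by have := primitive01D h1 h3; congr primitive01; apply/funext => t; rewrite raddfD.
- by have := primitive01D h2 h4; congr primitive01; apply/funext => t; rewrite raddfD.
Qed.

Lemma primitiveKZ c F f : primitiveK F f ->
  primitiveK (fun t => c * F t) (fun t => c * f t).
Proof.
move=> [h1 h2]; split.
- have := primitive01D (primitive01Z (reK c) h1) (primitive01N (primitive01Z (imK c) h2)).
  by congr primitive01; apply/funext => t; rewrite reKM.
- have := primitive01D (primitive01Z (reK c) h2) (primitive01Z (imK c) h1).
  by congr primitive01; apply/funext => t; rewrite imKM.
Qed.

Lemma primitiveK0 : primitiveK (fun=> 0) (fun=> 0).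
Proof. by rewrite /primitiveK !raddf0; split; exact: primitive01_cst. Qed.

Lemma primitiveK_sum (I : Type) (s : seq I) (F f : I -> R -> K) :
  (forall i, primitiveK (F i) (f i)) ->
  primitiveK (fun t => \sum_(i <- s) F i t) (fun t => \sum_(i <- s) f i t).
Proof.
move=> hh; elim: s => [|i s IH].
  have := primitiveK0.
  by congr primitiveK; apply/funext => t; rewrite big_nil.
have := primitiveKD (hh i) IH.
by congr primitiveK; apply/funext => t; rewrite big_cons.
Qed.

Lemma primitiveK_conj F f : primitiveK F f ->
  primitiveK (fun t => conjF (F t)) (fun t => conjF (f t)).
Proof.
move=> [h1 h2]; split.
- by move: h1; congr primitive01; apply/funext => t; rewrite reK_conj.
- by have := primitive01N h2; congr primitive01; apply/funext => t; rewrite imK_conj.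
Qed.

Lemma primitiveK_ofR (u v : R -> R) : primitive01 u v ->
  primitiveK (fun t => ofR (u t)) (fun t => ofR (v t)).
Proof.
move=> h; split.
- by move: h; congr primitive01; apply/funext => t; rewrite reK_ofR.
- by have := primitive01_cst (0 : R); congr primitive01; apply/funext => t; rewrite imK_ofR.
Qed.

(** The product of two scalars is bilinear in the real and imaginary parts, so
    four integrations by parts of real functions are combined. *)
Lemma integralK_by_parts F f G g : L2K F -> L2K f -> L2K G -> L2K g ->
  primitiveK F f -> primitiveK G g ->
  integralK (fun t => f t * G t) + integralK (fun t => F t * g t) =
  F 1 * G 1 - F 0 * G 0.
Proof.
move=> [F1 F2] [f1 f2] [G1 G2] [g1 g2] [hF1 hF2] [hG1 hG2].
have i11 := int01_by_parts hF1 hG1; have i12 := int01_by_parts hF1 hG2.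
have i21 := int01_by_parts hF2 hG1; have i22 := int01_by_parts hF2 hG2.
apply: K_ext; rewrite raddfD raddfB /= ?reK_integral ?imK_integral ?reKM ?imKM.
- have -> : int01 (fun t => reK (f t * G t)) =
      int01 (fun t => reK (f t) * reK (G t) - imK (f t) * imK (G t)).
    by apply: eq_int01 => t _; rewrite reKM.
  have -> : int01 (fun t => reK (F t * g t)) =
      int01 (fun t => reK (F t) * reK (g t) - imK (F t) * imK (g t)).
    by apply: eq_int01 => t _; rewrite reKM.
  rewrite !int01B; try exact: sqr_integrable01M.
  lra.
- have -> : int01 (fun t => imK (f t * G t)) =
      int01 (fun t => reK (f t) * imK (G t) + imK (f t) * reK (G t)).
    by apply: eq_int01 => t _; rewrite imKM.
  have -> : int01 (fun t => imK (F t * g t)) =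
      int01 (fun t => reK (F t) * imK (g t) + imK (F t) * reK (g t)).
    by apply: eq_int01 => t _; rewrite imKM.
  rewrite !int01D; try exact: sqr_integrable01M.
  lra.
Qed.

Lemma L2P d (x : R -> 'cV[K]_d) : L2 x <-> forall i, L2K (fun t => x t i 0).
Proof.
split=> [[mx fin] i|H].
  have [mr mi] := mx i 0.
  have [mxi intx] : measurable_fun I01 (fun t => reK (dotv (x t) (x t))) /\
      integrable01 (fun t => reK (dotv (x t) (x t))).
    have m : measurable_fun I01 (fun t => reK (dotv (x t) (x t))).
      rewrite (_ : (fun t => _) = fun t => \sum_j normKsq (x t j 0)).
        apply: measurable_sum => j; have [m1 m2] := mx j 0.
        by apply: measurable_funD; exact: measurable_funX.
      by apply/funext => t; rewrite reK_dotvv.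
    split => //; apply/integrableP; split; first exact/measurable_EFinP.
    move: fin; congr (_ < _)%E; apply: eq_integral => t _.
    by rewrite /= ger0_norm// dotvv_ge0.
  have le t : reK (x t i 0) ^+ 2 <= reK (dotv (x t) (x t)) /\
      imK (x t i 0) ^+ 2 <= reK (dotv (x t) (x t)).
    have : normKsq (x t i 0) <= reK (dotv (x t) (x t)).
      rewrite reK_dotvv (bigD1 i)//= lerDl sumr_ge0// => j _; exact: normKsq_ge0.
    rewrite /normKsq => h; split; apply: le_trans h; [rewrite lerDl|rewrite lerDr];
      exact: sqr_ge0.
  split; split => //.
  - apply: integrable01_le intx _; first exact: measurable_funX.
    by apply: ae_everywhere => t _; rewrite ger0_norm ?sqr_ge0//; have [] := le t.
  - apply: integrable01_le intx _; first exact: measurable_funX.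
    by apply: ae_everywhere => t _; rewrite ger0_norm ?sqr_ge0//; have [] := le t.
split.
  by move=> i j; rewrite (ord1 j); have [[m1 _] [m2 _]] := H i.
have : integrable01 (fun t => reK (dotv (x t) (x t))).
  rewrite (_ : (fun t => _) = fun t => \sum_j normKsq (x t j 0)).
    apply: integrable01_sum => i; have [[_ h1] [_ h2]] := H i.
    exact: integrable01D.
  by apply/funext => t; rewrite reK_dotvv.
move=> /integrableP[_]; congr (_ < _)%E; apply: eq_integral => t _.
by rewrite /= ger0_norm// dotvv_ge0.
Qed.

End ScalarIntegrals.

(** * Sobolev functions as chains of derivatives *)

Section SobolevChains.
Context {R : realType} {k : scalar_kind} {d : nat}.
Local Notation K := (Kfield R k).
Local Notation mu := (@lebesgue_measure R).
Local Notation I01 := (@I01 R).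
Implicit Types (u g : R -> 'cV[K]_d) (Z : nat -> R -> 'cV[K]_d).

(** The successive derivatives of a function of [W^{N,2}], each represented by
    the absolutely continuous function that is the primitive of the next one;
    only the last one is merely square-integrable.  Chains carry no choice of a
    weak derivative or of a representative. *)
Definition chain (N : nat) Z : Prop :=
  (forall n, (n <= N)%N -> L2 (Z n)) /\
  (forall n, (n < N)%N -> forall i,
     primitiveK (fun t => Z n t i 0) (fun t => Z n.+1 t i 0)).

Lemma ae01_colP u g :
  ae01 u g <-> forall i, ae01 (fun t => reK (u t i 0)) (fun t => reK (g t i 0)) /\
                         ae01 (fun t => imK (u t i 0)) (fun t => imK (g t i 0)).
Proof.
split=> [ug i|H]; first by split; apply: aeS ug => t /[apply] ->.
have FF := ae_filter_ringOfSetsType mu.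
have : {ae mu, forall t, forall i, I01 t -> u t i 0 = g t i 0}.
  apply: filter_forall => i; have [h1 h2] := H i.
  by apply: aeS (aeI h1 h2) => t [r m] It; apply: K_ext; [exact: r|exact: m].
by apply: aeS => t h It; apply/colP => i; exact: h.
Qed.

Lemma ae01_sym (T : Type) (f g : R -> T) : ae01 f g -> ae01 g f.
Proof. by apply: aeS => t /[apply]. Qed.

Lemma ae01_trans (T : Type) (f g h : R -> T) : ae01 f g -> ae01 g h -> ae01 f h.
Proof.
move=> fg gh; apply: aeS (aeI fg gh) => t [e1 e2] It.
by rewrite (e1 It) (e2 It).
Qed.

Lemma is_weak_derivativeP n u g : is_weak_derivative n u g <->
  forall phi, test_function phi -> forall i,
    integralK (fun t => ofR (derive1n n phi t) * u t i 0) =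
    (-1) ^+ n * integralK (fun t => ofR (phi t) * g t i 0).
Proof.
split=> H phi tphi.
  move=> i; have /colP/(_ i) := H _ tphi; rewrite !mxE => E.
  transitivity (integralK (fun t => (ofR (derive1n n phi t) *: u t) i 0)).
    by apply: eq_integralK => t _; rewrite mxE.
  by rewrite E; congr (_ * _); apply: eq_integralK => t _; rewrite mxE.
apply/colP => i; rewrite !mxE.
transitivity (integralK (fun t => ofR (derive1n n phi t) * u t i 0)).
  by apply: eq_integralK => t _; rewrite mxE.
by rewrite H//; congr (_ * _); apply: eq_integralK => t _; rewrite mxE.
Qed.

Lemma test_function_derive1 (phi : R -> R) : test_function phi ->
  test_function (derive1 phi).
Proof.
move=> [sphi [a [b [a0 b1 supp]]]]; split; first exact: smooth_derive1.
exists a, b; split => // t; apply: contra_neqT => h.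
rewrite derive1E (@near_eq_derive _ _ _ _ (cst 0)) ?derive_cst//.
have phi0 s : ~~ (a <= s <= b) -> phi s = 0.
  by move=> hs; apply: contra_notP (negP hs) => /eqP/supp.
move: h; rewrite negb_and -!ltNge => /orP[ta|bt].
  by near=> s; apply: phi0; rewrite negb_and -ltNge; apply/orP; left; near: s; exact: lt_nbhsl.
by near=> s; apply: phi0; rewrite negb_and -!ltNge; apply/orP; right; near: s; exact: lt_nbhsr.
Unshelve. all: by end_near. Qed.

Lemma L2K_smooth (phi : R -> R) : smooth phi -> L2K (fun t => ofR (phi t) : K).
Proof.
move=> sphi; split.
- have := sqr_integrable01_smooth sphi; congr sqr_integrable01.
  by apply/funext => t; rewrite reK_ofR.
- by under [X in sqr_integrable01 X]funext do rewrite imK_ofR;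
    exact: sqr_integrable01_cst.
Qed.

(** Integration by parts against the derivatives of the test function, which
    vanish at 0 and 1. *)
Lemma chain_weak_derivative N Z n u : chain N Z -> (n <= N)%N -> L2 u ->
  ae01 u (Z 0%N) -> is_weak_derivative n u (Z n).
Proof.
move=> [L2Z primZ] nN L2u uZ; apply/is_weak_derivativeP => phi tphi i.
have L2Zi m : (m <= N)%N -> L2K (fun t => Z m t i 0).
  by move=> /L2Z/L2P.
have [sphi _ _] := test_functionP tphi.
have L2n : L2K (fun t => ofR (derive1n n phi t) : K).
  by apply: L2K_smooth; exact: smooth_derive1n.
have L2ui : L2K (fun t => u t i 0) by move: L2u => /L2P.
transitivity (integralK (fun t => ofR (derive1n n phi t) * Z 0%N t i 0)).
  apply: integralK_ae.
  - exact: measurableKM (L2K_measurable L2n) (L2K_measurable L2ui).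
  - exact: measurableKM (L2K_measurable L2n) (L2K_measurable (L2Zi _ (leq0n _))).
  - by apply: aeS uZ => t /[apply] ->.
elim: n nN phi tphi {sphi L2n} => [_ phi _|n IH nN phi tphi]; first by rewrite mul1r.
have [sphi p0 p1] := test_functionP tphi.
rewrite derive1Sn IH ?(ltnW nN)//; last exact: test_function_derive1.
have := integralK_by_parts (L2K_smooth sphi) (L2K_smooth (smooth_derive1 sphi))
  (L2Zi _ (ltnW nN)) (L2Zi _ nN) (primitiveK_ofR (primitive01_smooth sphi))
  (primZ _ nN i).
rewrite p0 p1 !raddf0 !mul0r subrr => /eqP; rewrite addr_eq0 => /eqP ->.
by rewrite exprS mulN1r mulrN mulNr.
Qed.

Lemma reK_integral_ofR (a : R -> R) (f : R -> K) :
  reK (integralK (fun t => ofR (a t) * f t)) = int01 (fun t => a t * reK (f t)).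
Proof.
rewrite reK_integral; apply: eq_int01 => t _.
by rewrite reKM reK_ofR imK_ofR mul0r subr0.
Qed.

Lemma imK_integral_ofR (a : R -> R) (f : R -> K) :
  imK (integralK (fun t => ofR (a t) * f t)) = int01 (fun t => a t * imK (f t)).
Proof.
rewrite imK_integral; apply: eq_int01 => t _.
by rewrite imKM reK_ofR imK_ofR mul0r addr0.
Qed.

Lemma weak_derivative_unique n u g g' : L2 g -> L2 g' ->
  is_weak_derivative n u g -> is_weak_derivative n u g' -> ae01 g g'.
Proof.
move=> /L2P Lg /L2P Lg' /is_weak_derivativeP wg /is_weak_derivativeP wg'.
apply/ae01_colP => i.
have E phi : test_function phi ->
    integralK (fun t => ofR (phi t) * g t i 0) = integralK (fun t => ofR (phi t) * g' t i 0).
  move=> tphi; have := wg _ tphi i; rewrite (wg' _ tphi i).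
  by move=> /(congr1 ( *%R ((-1) ^+ n))); rewrite !mulrA -!exprMn mulrNN mulr1 !expr1n !mul1r.
have [g1 g2] := Lg i; have [g1' g2'] := Lg' i.
have key (f f' : R -> R) : sqr_integrable01 f -> sqr_integrable01 f' ->
    (forall phi, test_function phi ->
       int01 (fun t => phi t * f t) = int01 (fun t => phi t * f' t)) -> ae01 f f'.
  move=> sf sf' H.
  have [hf hf'] := (sqr_integrable01_integrable sf, sqr_integrable01_integrable sf').
  have : ae01 (fun t => f t - f' t) (cst 0).
    apply: ae01_eq0_test; first exact: integrable01B.
    move=> phi tphi; have [sphi _ _] := test_functionP tphi.
    transitivity (int01 (fun t => phi t * f t - phi t * f' t)).
      by apply: eq_int01 => t _; rewrite mulrBr.
    by rewrite int01B ?H ?subrr//; exact: integrable01M_smooth.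
  by apply: aeS => t /[apply] /eqP; rewrite subr_eq0 => /eqP.
split; apply: key => // phi /E.
  by move=> /(congr1 reK); rewrite !reK_integral_ofR.
by move=> /(congr1 imK); rewrite !imK_integral_ofR.
Qed.

Lemma continuous01_ae_eq u g : continuous01 u -> continuous01 g -> ae01 u g ->
  forall t, I01 t -> u t = g t.
Proof.
move=> cu cg /ae01_colP ug t It; apply/colP => i.
have [u1 u2] := cu i 0; have [g1 g2] := cg i 0; have [e1 e2] := ug i.
by apply: K_ext; [exact: (continuous_ae01_eq u1 g1 e1)|
  exact: (continuous_ae01_eq u2 g2 e2)].
Qed.

Lemma chain_continuous N Z n : chain N Z -> (n < N)%N -> continuous01 (Z n).
Proof.
move=> [_ pZ] nN i j; rewrite (ord1 j).
exact: primitiveK_continuous (pZ _ nN i).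
Qed.

(** Weak derivatives are unique almost everywhere, and continuous representatives
    everywhere on the interval; hence a chain determines whatever is defined by
    choosing them. *)
Lemma chain_sobolev N Z u : L2 u -> chain N Z -> ae01 u (Z 0%N) ->
  [/\ sobolev N u,
      forall n, (n <= N)%N -> ae01 (wderiv n u) (Z n)
    & forall n a, (n < N)%N -> I01 a -> trace n u a = Z n a].
Proof.
move=> L2u cZ uZ.
have wZ n : (n <= N)%N -> is_weak_derivative n u (Z n).
  by move=> nN; exact: (chain_weak_derivative cZ).
have wdZ n : (n <= N)%N -> ae01 (wderiv n u) (Z n).
  move=> nN; rewrite /wderiv; case: xgetP => [g _ [L2g wg]|/(_ (Z n))[]].
    by apply: (weak_derivative_unique _ _ wg (wZ n nN)) => //; exact: cZ.1.
  by split; [exact: cZ.1|exact: wZ].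
split => //; first by split => // n nN; exists (Z n); split; [exact: cZ.1|exact: wZ].
move=> n a nN Ia; rewrite /trace /contrep; have cZn := chain_continuous cZ nN.
case: xgetP => [g _ [cg wg]|/(_ (Z n))[]]; last by split => //; exact: (wdZ _ (ltnW nN)).
apply: (continuous01_ae_eq cg cZn) => //.
by apply: ae01_trans (ae01_sym wg) _; exact: (wdZ _ (ltnW nN)).
Qed.

Lemma primitive01_ae (F f f' : R -> R) : measurable_fun I01 f' -> ae01 f f' ->
  primitive01 F f -> primitive01 F f'.
Proof.
move=> mf' ff' [hf FE]; split; first exact: integrable01_ae ff' hf.
by move=> t It; rewrite FE// (prim_ae It hf mf' ff').
Qed.

Lemma primitiveK_ae (F f f' : R -> K) : measurableK f' -> ae01 f f' ->
  primitiveK F f -> primitiveK F f'.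
Proof.
move=> [m1 m2] ff' [h1 h2]; split.
- by apply: primitive01_ae h1 => //; apply: aeS ff' => t /[apply] ->.
- by apply: primitive01_ae h2 => //; apply: aeS ff' => t /[apply] ->.
Qed.

Lemma primitiveK_mk (f1 f2 : R -> R) (F f : R -> K) :
  primitive01 f1 (fun t => reK (f t)) -> primitive01 f2 (fun t => imK (f t)) ->
  ae01 (fun t => reK (F t)) f1 -> ae01 (fun t => imK (F t)) f2 ->
  exists2 G : R -> K, primitiveK G f & ae01 F G.
Proof.
case: k F f => [|] F f p1 p2 a1 a2.
  exists f1 => //; split => //; exact: primitive01_cst.
exists (fun t => Complex (f1 t) (f2 t)) => //.
apply: aeS (aeI a1 a2) => t [h1 h2] It.
by rewrite -(h1 It) -(h2 It) [LHS]complexE -complexE; case: (F t).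
Qed.

(** A test function and its derivative are both test functions, so the weak
    derivative of order [n+1] is the first weak derivative of the one of order
    [n], which is therefore a primitive up to a null set. *)
Lemma sobolev_chain N u : sobolev N u ->
  exists Z, chain N Z /\ ae01 u (Z 0%N).
Proof.
move=> [L2u Hw].
pose W n := wderiv n u.
have HW n : (n <= N)%N -> L2 (W n) /\ is_weak_derivative n u (W n).
  move=> nN; rewrite /W /wderiv; case: xgetP => [g _ //|H].
  by have [g Hg] := Hw n nN; have := H g Hg.
have step n i : (n < N)%N -> exists2 G : R -> K,
    primitiveK G (fun t => W n.+1 t i 0) & ae01 (fun t => W n t i 0) G.
  move=> nN; have [/L2P L0 /is_weak_derivativeP w0] := HW _ (ltnW nN).
  have [/L2P L1 /is_weak_derivativeP w1] := HW _ nN.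
  have E phi : test_function phi ->
      integralK (fun t => ofR (derive1 phi t) * W n t i 0) =
      - integralK (fun t => ofR (phi t) * W n.+1 t i 0).
    move=> tphi; have := w1 _ tphi i; rewrite derive1Sn w0; last exact: test_function_derive1.
    move=> /(congr1 ( *%R ((-1) ^+ n))).
    by rewrite exprS mulN1r mulNr mulrN !mulrA -!exprMn mulrNN mulr1 !expr1n !mul1r.
  have [g1 g2] := L0 i; have [h1 h2] := L1 i.
  have [|c1 e1] := weak_derivative_prim (sqr_integrable01_integrable g1)
    (sqr_integrable01_integrable h1).
    by move=> phi /E /(congr1 reK); rewrite raddfN /= !reK_integral_ofR.
  have [|c2 e2] := weak_derivative_prim (sqr_integrable01_integrable g2)
    (sqr_integrable01_integrable h2).
    by move=> phi /E /(congr1 imK); rewrite raddfN /= !imK_integral_ofR.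
  apply: (primitiveK_mk _ _ e1 e2); apply: primitive01_prim;
    exact: sqr_integrable01_integrable.
(* [G n] is the absolutely continuous representative of the weak derivative of
   order [n]. *)
have [G HG] : exists G : nat -> 'I_d -> R -> K, forall n i, (n < N)%N ->
    primitiveK (G n i) (fun t => W n.+1 t i 0) /\ ae01 (fun t => W n t i 0) (G n i).
  have /choice[G HG] : forall p : nat * 'I_d, exists G : R -> K, (p.1 < N)%N ->
      primitiveK G (fun t => W p.1.+1 t p.2 0) /\ ae01 (fun t => W p.1 t p.2 0) G.
    move=> [n i] /=; have [nN|_] := boolP (n < N)%N; last by exists (fun=> 0).
    by have [G G1 G2] := step n i nN; exists G.
  by exists (fun n i => G (n, i)) => n i nN; exact: (HG (n, i)).
pose Z n t : 'cV[K]_d := if (n < N)%N then \col_i G n i t else W n t.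
have aeWZ n : (n <= N)%N -> ae01 (W n) (Z n).
  rewrite /Z; case: (ltnP n N) => nN _; last exact: ae_everywhere.
  apply/ae01_colP => i; have [_ ae] := HG n i nN.
  by split; apply: aeS ae => t /[apply] ->; rewrite mxE.
have L2Z n : (n <= N)%N -> L2 (Z n).
  rewrite /Z; case: (ltnP n N) => nN nN'; last by have [] := HW n nN'.
  apply/L2P => i; have [pG _] := HG n i nN.
  have := continuousK_L2K (primitiveK_continuous pG).
  by congr L2K; apply/funext => t; rewrite mxE.
exists Z; split; last first.
  have [_ w0] := HW 0%N (leq0n _).
  apply: ae01_trans (aeWZ 0%N (leq0n _)).
  apply: (weak_derivative_unique (n := 0%N) (u := u) _ _ _ w0) => //.
    by have [] := HW 0%N (leq0n _).
  by move=> phi tphi; rewrite expr0 scale1r.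
split => // n nN i; have [pG _] := HG n i nN.
have -> : (fun t => Z n t i 0) = G n i by apply/funext => t; rewrite /Z nN mxE.
apply: primitiveK_ae pG.
  by apply: L2K_measurable; have /L2P := L2Z _ nN; exact.
by apply: aeS (aeWZ _ nN) => t /[apply] ->.
Qed.

End SobolevChains.

(** * Linear differential equations *)

Section Picard.
Context {R : realType}.
Local Notation mu := (@lebesgue_measure R).
Local Notation I01 := (@I01 R).

(** This inequality is what makes exponential weights turn the integral operator
    into a contraction. *)
Lemma prim_exp_le (M t : R) : 0 < M -> I01 t ->
  prim (fun s => expR (M * s)) t <= expR (M * t) / M.
Proof.
move=> M0 It.
have H (s : R) : is_derive (s : R) (1 : R) (fun s => M^-1 * expR (M * s)) (expR (M * s)).
  have -> : expR (M * s) = M^-1 * (expR (M * s) * M).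
    by rewrite mulrCA mulVf ?mulr1// gt_eqF.
  apply: is_deriveZ; apply: (@is_derive1_comp _ expR (fun s => M * s)).
  by rewrite -[X in is_derive _ _ _ X]mulr1; apply: is_deriveZ.
have E := is_derive_derive1 H.
have [||_ /(_ t It)] := @primitive01_C1 _ (fun s => M^-1 * expR (M * s)).
- by move=> x; have [] := H x.
- rewrite E => x; apply: continuous_comp; last exact: continuous_expR.
  exact: mulrl_continuous.
rewrite E mulr0 expR0 mulr1 => e.
by rewrite mulrC e lerDr invr_ge0 ltW.
Qed.

Variables (I : finType) (a : I -> I -> R -> R) (f : I -> R -> R) (c : I -> R) (L : R).
Hypothesis ma : forall i j, measurable_fun I01 (a i j).
Hypothesis aL : forall i j t, I01 t -> `|a i j t| <= L.
Hypothesis hf : forall i, integrable01 (f i).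

Let rhs (y : I -> R -> R) i t := \sum_j a i j t * y j t + f i t.

Fixpoint picard (n : nat) : I -> R -> R :=
  if n is n'.+1 then fun i t => c i + prim (rhs (picard n') i) t else fun i => cst (c i).

Let integrable_rhs y : (forall i, {within I01, continuous (y i)}) ->
  forall i, integrable01 (rhs y i).
Proof.
move=> cy i; apply: integrable01D => //; apply: integrable01_sum => j.
rewrite (_ : (fun _ => _) = fun t => y j t * a i j t).
  apply: integrable01M_continuous => //; apply: (@integrable01_bounded _ _ L) => //.
  by apply: ae_everywhere => t; exact: aL.
by apply/funext => t; rewrite mulrC.
Qed.

Let picard_continuous n i : {within I01, continuous (picard n i)}.
Proof.
elim: n i => [|n IH] i /=; first by move=> x; exact: cvg_cst.
move=> x; apply: cvgD; first exact: cvg_cst.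
by apply: prim_continuous; exact: integrable_rhs.
Qed.

Let D n i t := picard n.+1 i t - picard n i t.

Let M : R := #|I|%:R * `|L| + 1.

Let M0 : 0 < M.
Proof. by rewrite ltr_wpDl// mulr_ge0. Qed.

Let C_exists : exists C : R, 0 <= C /\ forall i t, I01 t -> `|D 0 i t| <= C.
Proof.
have bnd i : exists C : R, forall t, I01 t -> `|D 0 i t| <= C.
  apply: continuous01_bounded => x; apply: cvgB; exact: picard_continuous.
have [C HC] := choice bnd.
exists (\sum_i `|C i|); split; first by apply: sumr_ge0.
move=> i t It; apply: le_trans (HC i t It) _; apply: le_trans (ler_norm _) _.
by rewrite (bigD1 i)//= lerDl sumr_ge0.
Qed.

(** In the supremum norm of weight [exp(-2Mt)] the iteration is a contraction of
    ratio 1/2, whatever the size of the coefficients. *)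
Let D_le C n : (forall i t, I01 t -> `|D 0 i t| <= C) ->
  forall i t, I01 t -> `|D n i t| <= C * 2^-1 ^+ n * expR ((2 * M) * t).
Proof.
move=> HC; elim: n => [|n IH] i t It.
  rewrite expr0 mulr1; apply: le_trans (HC i t It) _.
  have C0 : 0 <= C by apply: le_trans (normr_ge0 _) (HC i t It).
  have /in_I01/andP[t0 _] := It.
  by rewrite ler_peMr// -expR0 ler_expR !mulr_ge0// ltW.
have C0 : 0 <= C by apply: le_trans (normr_ge0 _) (HC i t It).
have i1 := integrable_rhs (@picard_continuous n.+1) i.
have i2 := integrable_rhs (@picard_continuous n) i.
have -> : D n.+1 i t = prim (fun s => rhs (picard n.+1) i s - rhs (picard n) i s) t.
  rewrite primD ?primN//; last exact: integrable01N.
  by rewrite /D /= opprD addrACA subrr add0r.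
apply: le_trans (prim_normr It (integrable01B i1 i2)) _.
pose E s := expR ((2 * M) * s).
have cE : continuous E.
  move=> x; apply: continuous_comp; last exact: continuous_expR.
  exact: mulrl_continuous.
have iE : integrable01 E by apply: integrable01_continuous; exact: continuous_subspaceT.
apply: (@le_trans _ _ (prim (fun s => (M * (C * 2^-1 ^+ n)) * E s) t)).
  apply: prim_le => //; first exact/integrable01_normr/integrable01B.
    exact: integrable01Z.
  move=> s Is.
  have -> : rhs (picard n.+1) i s - rhs (picard n) i s = \sum_j a i j s * D n j s.
    rewrite /rhs opprD addrACA subrr addr0 -sumrB.
    by apply: eq_bigr => j _; rewrite /D mulrBr.
  apply: le_trans (ler_norm_sum _ _ _) _.
  apply: (@le_trans _ _ (\sum_(j : I) `|L| * (C * 2^-1 ^+ n * E s))).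
    apply: ler_sum => j _; rewrite normrM ler_pM//; last exact: IH.
    by apply: le_trans (aL i j Is) _; exact: ler_norm.
  have -> : M * (C * 2^-1 ^+ n) * E s = M * (C * 2^-1 ^+ n * E s) by rewrite !mulrA.
  have : 0 <= C * 2^-1 ^+ n * E s.
    by rewrite !mulr_ge0// ?exprn_ge0 ?expR_ge0// invr_ge0.
  move: (C * 2^-1 ^+ n * E s) => X X0.
  by rewrite big_const iter_addr_0 -mulr_natl mulrA ler_wpM2r// /M lerDl.
rewrite primZ//.
have M20 : 0 < 2 * M by rewrite mulr_gt0.
apply: le_trans (ler_wpM2l _ (prim_exp_le M20 It)) _.
  by rewrite !mulr_ge0 ?exprn_ge0 ?invr_ge0// ltW.
rewrite le_eqVlt; apply/orP; left; apply/eqP; rewrite exprS.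
by field; rewrite gt_eqF.
Qed.

(** The increments of the iteration decrease geometrically, so the iterates
    converge pointwise and boundedly; dominated convergence then takes the
    integral equation to the limit. *)
Lemma picard_existence : exists y : I -> R -> R, forall i,
  y i 0 = c i /\ primitive01 (y i) (fun t => \sum_j a i j t * y j t + f i t).
Proof.
have [C [C0 HC]] := C_exists.
pose C1 := C * expR (2 * M).
have C10 : 0 <= C1 by rewrite mulr_ge0// expR_ge0.
have DC n i t : I01 t -> `|D n i t| <= C1 * 2^-1 ^+ n.
  move=> It; apply: le_trans (D_le n HC i It) _.
  rewrite /C1 mulrAC ler_wpM2r ?exprn_ge0 ?invr_ge0// ler_wpM2l//.
  have /in_I01/andP[_ t1] := It.
  by rewrite ler_expR -[leRHS]mulr1 ler_wpM2l// mulr_ge0// ltW.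
have seriesE i t n : picard n i t = c i + series (fun m => D m i t) n.
  rewrite /series /=; elim: n => [|n IH]; first by rewrite big_geq// addr0.
  by rewrite big_nat_recr//= addrA -IH /D subrKC.
have half1 : `|2^-1 : R| < 1 by rewrite ger0_norm ?invr_ge0// invf_lt1// ltr1n.
have cg : cvgn (series (geometric C1 (2^-1 : R))).
  by apply: is_cvg_geometric_series.
have cS i t : I01 t -> cvgn (series (fun m => D m i t)).
  move=> It; apply: normed_cvg; apply: series_le_cvg cg.
  - by move=> n; exact: normr_ge0.
  - by move=> n; rewrite /geometric /= mulr_ge0// exprn_ge0// invr_ge0.
  - by move=> n; exact: DC.
have cP i t : I01 t -> cvgn (fun n => picard n i t).
  move=> It; under eq_fun do rewrite seriesE.
  by apply: is_cvgD; [exact: is_cvg_cst|exact: cS].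
have bP n i t : I01 t -> `|picard n i t| <= `|c i| + C1 * 2.
  move=> It; rewrite seriesE; apply: le_trans (ler_normD _ _) _.
  rewrite lerD2l /series /=; apply: le_trans (ler_norm_sum _ _ _) _.
  apply: (@le_trans _ _ (\sum_(0 <= m < n) C1 * 2^-1 ^+ m)).
    by apply: ler_sum => m _; exact: DC.
  rewrite -mulr_sumr ler_wpM2l//.
  elim: n => [|n IH]; first by rewrite big_geq.
  rewrite big_nat_recl// expr0.
  under eq_bigr do rewrite exprS.
  rewrite -mulr_sumr.
  apply: (@le_trans _ _ (1 + 2^-1 * 2)); first by rewrite lerD2l ler_wpM2l ?invr_ge0.
  by rewrite mulVf// -natr1.
pose y i t := limn (fun n => picard n i t).
have yP i t : I01 t -> picard n i t @[n --> \oo] --> y i t by move=> It; exact: cP.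
exists y => i.
have y0 : y i 0 = c i.
  rewrite /y; apply: cvg_lim; first exact: Rhausdorff.
  have pic0 n : picard n i 0 = c i by case: n => [//|n]; rewrite /= prim0 addr0.
  by under eq_fun do rewrite pic0; exact: cvg_cst.
split => //.
have my j : measurable_fun I01 (y j).
  apply: (@measurable_fun_cvg _ _ _ _ (fun n => picard n j)) => [n|t It]; last exact: yP.
  by apply: integrable01_measurable; exact: integrable01_continuous.
pose B := \sum_j (`|c j| + C1 * 2).
have BP n j t : I01 t -> `|picard n j t| <= B.
  move=> It; apply: le_trans (bP n j t It) _; rewrite /B (bigD1 j)//= lerDl.
  by apply: sumr_ge0 => l _; rewrite addr_ge0// mulr_ge0.
have mrhs z : (forall j, measurable_fun I01 (z j)) -> measurable_fun I01 (rhs z i).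
  move=> mz; apply: measurable_funD; last exact: integrable01_measurable.
  by apply: measurable_sum => j; exact: measurable_funM.
pose g t := \sum_(j : I) `|L| * B + `|f i t|.
have ig : integrable01 g.
  by apply: integrable01D; [exact: integrable01_cst|exact: integrable01_normr].
have dom n t : I01 t -> `|rhs (picard n) i t| <= g t.
  move=> It; apply: le_trans (ler_normD _ _) _; rewrite lerD2r.
  apply: le_trans (ler_norm_sum _ _ _) _; apply: ler_sum => j _.
  rewrite normrM ler_pM//; last exact: BP.
  by apply: le_trans (aL i j It) _; exact: ler_norm.
have crhs t : I01 t -> rhs (picard n) i t @[n --> \oo] --> rhs y i t.
  move=> It; apply: cvgD; last exact: cvg_cst.
  apply: cvg_big => [|j _]; first exact: add_continuous.
  apply: cvgM; first exact: cvg_cst.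
  exact: yP.
have mP n : measurable_fun I01 (rhs (picard n) i).
  by apply: mrhs => j; apply: integrable01_measurable; exact: integrable01_continuous.
have [irhs _] := int01_dominated mP crhs ig dom.
split; first exact: irhs.
move=> t It; rewrite y0.
have c1 : picard n.+1 i t @[n --> \oo] --> c i + prim (rhs y i) t.
  apply: cvgD; first exact: cvg_cst.
  exact: prim_dominated It mP crhs ig dom.
have c2 : picard n.+1 i t @[n --> \oo] --> y i t.
  by have := yP i t It; rewrite -cvg_shiftS.
by apply: (cvg_unique _ c2 c1); exact: Rhausdorff.
Qed.

End Picard.

Section LinearODE.
Context {R : realType} {k : scalar_kind}.
Local Notation K := (Kfield R k).
Local Notation mu := (@lebesgue_measure R).
Local Notation I01 := (@I01 R).

Lemma imK_mk (a b : R) : k = ComplexScalars -> imK (mkK a b : K) = b.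
Proof. by case: k. Qed.

Lemma imKM_mk (x : K) (a b : R) : imK x * imK (mkK a b : K) = imK x * b.
Proof. by case: k x => [|] x //=; rewrite !mul0r. Qed.

Lemma primitiveK_mkK (z1 z2 : R -> R) (f : R -> K) :
  primitive01 z1 (fun t => reK (f t)) ->
  (k = ComplexScalars -> primitive01 z2 (fun t => imK (f t))) ->
  primitiveK (fun t => mkK (z1 t) (z2 t)) f.
Proof.
case: k f => [|] f p1 p2; split => //; first exact: primitive01_cst.
exact: p2.
Qed.

(** Truncation to [[-L, L]]: it turns essential bounds on the coefficients into
    bounds that hold everywhere. *)
Definition clip (L x : R) : R := Num.max (- L) (Num.min L x).

Lemma clip_le L x : 0 <= L -> `|clip L x| <= L.
Proof.
move=> L0; rewrite /clip ler_norml le_max lexx /= ge_max ge_min lexx /= andbT.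
by rewrite (le_trans _ L0)// oppr_le0.
Qed.

Lemma clip_id L x : `|x| <= L -> clip L x = x.
Proof. by rewrite ler_norml => /andP[l u]; rewrite /clip min_r// max_r. Qed.

Lemma measurable_clip L (f : R -> R) : measurable_fun I01 f ->
  measurable_fun I01 (fun t => clip L (f t)).
Proof.
move=> mf; apply: measurable_maxr => //; apply: measurable_minr => //.
Qed.

Lemma sum_prod_bool (I : finType) (h : I * bool -> R) :
  \sum_p h p = \sum_i (h (i, true) + h (i, false)).
Proof.
rewrite (eq_bigr (fun p => h (p.1, p.2))); last by move=> [].
rewrite -(pair_bigA _ (fun i b => h (i, b))) /=.
by apply: eq_bigr => i _; rewrite big_bool.
Qed.

(** The equation is split into real and imaginary parts, and the boolean selects
    the part.  Over the reals the imaginary parts of the coefficients vanish, and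
    the second component of the real solution is discarded. *)
Lemma linear_ode (I : finType) (A : I -> I -> R -> K) (f : I -> R -> K)
    (c : I -> K) (L : R) :
  (forall i j, measurableK (A i j)) ->
  (forall i j, {ae mu, forall t, I01 t -> `|reK (A i j t)| <= L /\ `|imK (A i j t)| <= L}) ->
  (forall i, integrableK (f i)) ->
  exists y : I -> R -> K, forall i, y i 0 = c i /\
    primitiveK (y i) (fun t => \sum_j A i j t * y j t + f i t).
Proof.
move=> mA AL hf.
pose a (p q : I * bool) t :=
  let re := clip `|L| (reK (A p.1 q.1 t)) in
  let im := clip `|L| (imK (A p.1 q.1 t)) in
  match p.2, q.2 with
  | false, false => re | false, true => - im | true, false => im | true, true => re
  end.
pose g (p : I * bool) t := if p.2 then imK (f p.1 t) else reK (f p.1 t).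
pose c0 (p : I * bool) := if p.2 then imK (c p.1) else reK (c p.1).
have ma p q : measurable_fun I01 (a p q).
  have [m1 m2] := mA p.1 q.1; rewrite /a; case: p.2; case: q.2.
  - exact: measurable_clip.
  - exact: measurable_clip.
  - by apply: measurableT_comp => //; exact: measurable_clip.
  - exact: measurable_clip.
have aL p q t : I01 t -> `|a p q t| <= `|L|.
  by move=> _; rewrite /a; case: p.2; case: q.2; rewrite ?normrN clip_le.
have hg p : integrable01 (g p).
  by have [h1 h2] := hf p.1; rewrite /g; case: p.2.
have [z Hz] := picard_existence c0 ma aL hg.
pose y i t : K := mkK (z (i, false) t) (z (i, true) t).
exists y => i; have [z10 pz1] := Hz (i, false); have [z20 pz2] := Hz (i, true).
split; first by rewrite /y z10 z20 /c0 /= mkKE.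
have aeA : {ae mu, forall t, forall j, I01 t ->
    `|reK (A i j t)| <= L /\ `|imK (A i j t)| <= L}.
  by have FF := ae_filter_ringOfSetsType mu; apply: filter_forall => j; exact: AL.
have L0 : forall x : R, x <= L -> x <= `|L|.
  by move=> x xL; apply: le_trans xL (ler_norm _).
have mz p : measurable_fun I01 (z p).
  have [_ pz] := Hz p; apply: integrable01_measurable; apply: integrable01_continuous.
  exact: primitive01_continuous pz.
have my j : measurableK (y j).
  split.
    by move: (mz (j, false)); congr measurable_fun; apply/funext => t; rewrite reK_mk.
  rewrite /y; case: (k) => [|] /=; first exact: measurable_cst.
  exact: mz.
have mrhs : measurableK (fun t => \sum_j A i j t * y j t + f i t).
  apply: measurableKD; last exact: integrableK_measurable.
  by apply: measurableK_sum => j; exact: measurableKM.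
apply: primitiveK_mkK => [|kC].
- apply: primitive01_ae pz1; first exact: mrhs.1.
  apply: aeS aeA => t At It; rewrite raddfD raddf_sum /=; congr (_ + _).
  rewrite sum_prod_bool.
  apply: eq_bigr => j _; rewrite /= reKM imKM_mk reK_mk.
  have [r m] := At j It.
  by rewrite /a /= !clip_id ?L0// addrC mulNr.
- apply: primitive01_ae pz2; first exact: mrhs.2.
  apply: aeS aeA => t At It; rewrite raddfD raddf_sum /=; congr (_ + _).
  rewrite sum_prod_bool.
  apply: eq_bigr => j _; rewrite /= imKM imK_mk// reK_mk.
  have [r m] := At j It.
  by rewrite /a /= !clip_id ?L0.
Qed.

End LinearODE.

(** * Measurable families of matrices *)

Section MatrixFunctions.
Context {R : realType} {k : scalar_kind}.
Local Notation K := (Kfield R k).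
Local Notation mu := (@lebesgue_measure R).
Local Notation I01 := (@I01 R).

Lemma reKD (x y : K) : reK (x + y) = reK x + reK y.
Proof. by rewrite raddfD. Qed.

Lemma reKN (x : K) : reK (- x) = - reK x.
Proof. by rewrite raddfN. Qed.

Lemma imKD (x y : K) : imK (x + y) = imK x + imK y.
Proof. by rewrite raddfD. Qed.

Lemma imKN (x : K) : imK (- x) = - imK x.
Proof. by rewrite raddfN. Qed.

Definition reimKE := (reKD, imKD, reKN, imKN, @reKM R k, @imKM R k, @reK_ofR R k, @imK_ofR R k,
  @reK1 R k, @imK1 R k).

(** It reduces the measurability of inverses to that of a real power. *)
Lemma invK (z : K) : z^-1 = conjF z * ofR (normKsq z)^-1.
Proof.
have [->|z0] := eqVneq z 0; first by rewrite invr0 raddf0 mul0r.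
apply: (mulfI z0); rewrite mulfV//.
have n0 : normKsq z != 0.
  apply: contra z0; rewrite /normKsq paddr_eq0 ?sqr_ge0// !sqrf_eq0 => /andP[/eqP r0 /eqP i0].
  by apply/eqP/K_ext; rewrite ?r0 ?i0 raddf0.
have -> : z * (conjF z * ofR (normKsq z)^-1) = ofR (normKsq z) * ofR (normKsq z)^-1.
  rewrite mulrA; congr (_ * _); apply: K_ext;
    rewrite ?(reKM, imKM, reK_conj, imK_conj, reK_ofR, imK_ofR) /normKsq; ring.
by rewrite -rmorphM divff// rmorph1.
Qed.

Lemma measurableK_inv (f : R -> K) : measurableK f -> measurableK (fun t => (f t)^-1).
Proof.
move=> mf.
have mq : measurable_fun I01 (fun t => (normKsq (f t))^-1).
  have [m1 m2] := mf.
  have m : measurable_fun I01 (fun t => normKsq (f t)).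
    by apply: measurable_funD; exact: measurable_funX.
  have := measurableT_comp (measurable_powR (-1)) m.
  by congr measurable_fun; apply/funext => t; rewrite /= powR_inv1// normKsq_ge0.
have mo : measurableK (fun t => ofR (normKsq (f t))^-1 : K).
  split.
    by move: mq; congr measurable_fun; apply/funext => t; rewrite reK_ofR.
  by under [X in measurable_fun _ X]funext do rewrite imK_ofR; exact: measurable_cst.
have mc : measurableK (fun t => conjF (f t)).
  have [m1 m2] := mf; split.
    by move: m1; congr measurable_fun; apply/funext => t; rewrite reK_conj.
  have : measurable_fun I01 (fun t => - imK (f t)) by exact: measurableT_comp.
  by congr measurable_fun; apply/funext => t; rewrite imK_conj.
have := measurableKM mc mo; congr measurableK.
by apply/funext => t; rewrite invK.
Qed.

Lemma measurableK_det n (G : R -> 'M[K]_n) :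
  (forall i j, measurableK (fun t => G t i j)) -> measurableK (fun t => \det (G t)).
Proof.
move=> mG; rewrite /determinant; apply: measurableK_sum => s.
apply: measurableKM; first exact: measurableK_cst.
by apply: measurableK_prod => i; exact: mG.
Qed.

Lemma measurableK_mulmx m n p (A : R -> 'M[K]_(m, n)) (B : R -> 'M[K]_(n, p)) :
  (forall i j, measurableK (fun t => A t i j)) ->
  (forall i j, measurableK (fun t => B t i j)) ->
  forall i j, measurableK (fun t => (A t *m B t) i j).
Proof.
move=> mA mB i j.
have := measurableK_sum (index_enum 'I_n) (fun l => measurableKM (mA i l) (mB l j)).
by congr measurableK; apply/funext => t; rewrite mxE.
Qed.

(** The inverse given by Cramer's rule, whose entries depend measurably on the
    entries of the matrix. *)
Definition cramer_inv n (G : 'M[K]_n) : 'M[K]_n := (\det G)^-1 *: \adj G.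

Lemma measurableK_cramer_inv n (G : R -> 'M[K]_n) :
  (forall i j, measurableK (fun t => G t i j)) ->
  forall i j, measurableK (fun t => cramer_inv (G t) i j).
Proof.
move=> mG i j.
have : measurableK (fun t => (\det (G t))^-1 * \adj (G t) i j).
  apply: measurableKM; first exact/measurableK_inv/measurableK_det.
  have : measurableK (fun t => (-1) ^+ (j + i) * \det (row' j (col' i (G t)))).
    apply: measurableKM; first exact: measurableK_cst.
    apply: measurableK_det => r s.
    by have := mG (lift j r) (lift i s); congr measurableK; apply/funext => t; rewrite !mxE.
  by congr measurableK; apply/funext => t; rewrite !mxE.
by congr measurableK; apply/funext => t; rewrite !mxE.
Qed.

Definition coercive n (c : R) (G : 'M[K]_n) : Prop :=
  forall w : 'cV[K]_n, c * reK (dotv w w) <= reK (dotv w (G *m w)).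

Lemma coercive_unit n c (G : 'M[K]_n) : 0 < c -> coercive c G -> G \in unitmx.
Proof.
move=> c0 cG; rewrite -unitmx_tr -row_free_unit; apply: inj_row_free => v vG.
have Gv : G *m v^T = 0 by apply: trmx_inj; rewrite trmx_mul trmxK vG trmx0.
have := cG v^T; rewrite Gv dotv0r raddf0 pmulr_rle0// => le0.
have v0 : v^T = 0 by apply: dotvv_eq0; apply/eqP; rewrite eq_le le0 dotvv_ge0.
by apply: trmx_inj; rewrite v0 trmx0.
Qed.

Lemma cramer_mul n (G : 'M[K]_n) : G \in unitmx -> G *m cramer_inv G = 1%:M.
Proof.
move=> uG; rewrite /cramer_inv -scalemxAr mul_mx_adj scale_scalar_mx mulVf//.
by move: uG; rewrite unitmxE unitfE.
Qed.

(** The expansion of the squared norm of [c w - v]. *)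
Lemma dotv_young n (c : R) (w v : 'cV[K]_n) :
  2 * c * reK (dotv w v) <= c ^+ 2 * reK (dotv w w) + reK (dotv v v).
Proof.
have := dotvv_ge0 (ofR c *: w - v).
have -> : ofR c *: w - v = ofR c *: w + (-1) *: v by rewrite scaleN1r.
rewrite !(dotvDl, dotvDr, dotvZl, dotvZr) conjF_ofR !rmorphN !rmorph1.
have := conj_dotv w v; move=> /(congr1 reK); rewrite reK_conj => e.
by rewrite !reimKE -e; nra.
Qed.

Lemma coercive_solution_le n c (G : 'M[K]_n) (w : 'cV[K]_n) : 0 < c -> coercive c G ->
  c ^+ 2 * reK (dotv w w) <= reK (dotv (G *m w) (G *m w)).
Proof. by move=> c0 cG; have := cG w; have := dotv_young c w (G *m w); nra. Qed.

(** The bound on solutions is applied to the columns of the inverse, which are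
    mapped to unit vectors. *)
Lemma cramer_inv_le n c (G : 'M[K]_n) i j : 0 < c -> coercive c G ->
  `|reK (cramer_inv G i j)| <= c^-1 /\ `|imK (cramer_inv G i j)| <= c^-1.
Proof.
move=> c0 cG; pose w := col j (cramer_inv G).
have Gw : G *m w = col j 1%:M.
  by rewrite /w !colE mulmxA cramer_mul//; exact: coercive_unit cG.
have le1 : c ^+ 2 * reK (dotv w w) <= 1.
  apply: le_trans (coercive_solution_le w c0 cG) _; rewrite Gw reK_dotvv (bigD1 j)//=.
  rewrite big1 => [|l lj]; last first.
    by rewrite /normKsq !mxE (negbTE lj) !raddf0 expr0n addr0.
  by rewrite /normKsq !mxE eqxx reK1 imK1 expr1n expr0n !addr0.
have le2 : normKsq (cramer_inv G i j) <= (c^-1) ^+ 2.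
  apply: (@le_trans _ _ (reK (dotv w w))).
    have <- : w i 0 = cramer_inv G i j by rewrite mxE.
    by rewrite reK_dotvv (bigD1 i)//= lerDl sumr_ge0// => l _; exact: normKsq_ge0.
  by rewrite exprVn -[leRHS]mul1r ler_pdivlMr ?exprn_gt0// mulrC.
have ci0 : 0 <= c^-1 by rewrite invr_ge0 ltW.
split; rewrite -ler_sqr ?nnegrE// real_normK ?num_real//; apply: le_trans le2.
  by rewrite /normKsq lerDl sqr_ge0.
by rewrite /normKsq lerDr sqr_ge0.
Qed.

Lemma L2_mulmx_bounded m n (A : R -> 'M[K]_(m, n)) (x : R -> 'cV[K]_n) (C : R) :
  (forall i j, measurableK (fun t => A t i j)) ->
  {ae mu, forall t, I01 t -> forall i j, `|reK (A t i j)| <= C /\ `|imK (A t i j)| <= C} ->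
  L2 x -> L2 (fun t => A t *m x t).
Proof.
move=> mA AC /L2P Lx; apply/L2P => i.
have := L2K_sum (index_enum 'I_n) (h := fun j t => A t i j * x t j 0) _.
rewrite (_ : (fun t => (A t *m x t) i 0) = fun t => \sum_j A t i j * x t j 0).
  apply => j; apply: (@L2KM_bounded _ _ _ _ C) => //.
  by apply: aeS AC => t h It; exact: h.
by apply/funext => t; rewrite mxE.
Qed.

Lemma L2D n (x y : R -> 'cV[K]_n) : L2 x -> L2 y -> L2 (fun t => x t + y t).
Proof.
move=> /L2P Lx /L2P Ly; apply/L2P => i.
by have := L2KD (Lx i) (Ly i); congr L2K; apply/funext => t; rewrite mxE.
Qed.

Lemma L2_mulmx m n (A : 'M[K]_(m, n)) (x : R -> 'cV[K]_n) :
  L2 x -> L2 (fun t => A *m x t).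
Proof.
move=> Lx; pose C := \sum_i \sum_j (`|reK (A i j)| + `|imK (A i j)|).
apply: (@L2_mulmx_bounded _ _ (fun=> A) x C) => //.
apply: ae_everywhere => t _ i j.
have le : `|reK (A i j)| + `|imK (A i j)| <= C.
  rewrite /C (bigD1 i)//= (bigD1 j)//= -addrA lerDl addr_ge0//.
    by apply: sumr_ge0 => l _; rewrite addr_ge0.
  by apply: sumr_ge0 => l _; apply: sumr_ge0 => l' _; rewrite addr_ge0.
by split; apply: le_trans le; rewrite ?lerDl ?lerDr.
Qed.

Lemma L2Z n (c : K) (x : R -> 'cV[K]_n) : L2 x -> L2 (fun t => c *: x t).
Proof.
move=> /(L2_mulmx c%:M); congr L2; apply/funext => t.
by rewrite mul_scalar_mx.
Qed.

Lemma L2_sum n (I : Type) (s : seq I) (x : I -> R -> 'cV[K]_n) :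
  (forall i, L2 (x i)) -> L2 (fun t => \sum_(i <- s) x i t).
Proof.
move=> Lx; apply/L2P => j.
have := L2K_sum s (h := fun i t => x i t j 0) (fun i => (L2P (x i)).1 (Lx i) j).
by congr L2K; apply/funext => t; rewrite summxE.
Qed.

Lemma L2_dotv n (x y : R -> 'cV[K]_n) : L2 x -> L2 y ->
  integrableK (fun t => dotv (x t) (y t)).
Proof.
move=> /L2P Lx /L2P Ly.
have := integrableK_sum (index_enum 'I_n) (h := fun i t => conjF (x t i 0) * y t i 0) _.
rewrite (_ : (fun t => dotv (x t) (y t)) = fun t => \sum_i conjF (x t i 0) * y t i 0).
  by apply => i; apply: L2KM => //; exact: L2K_conj.
by apply/funext => t; rewrite dotvE.
Qed.

End MatrixFunctions.

(** * Chains and the port-Hamiltonian operator *)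

Section ChainAlgebra.
Context {R : realType} {k : scalar_kind} {N d : nat}.
Local Notation K := (Kfield R k).
Local Notation mu := (@lebesgue_measure R).
Local Notation I01 := (@I01 R).
Implicit Types Z Y : nat -> R -> 'cV[K]_d.

Lemma chainD Z Y : chain N Z -> chain N Y -> chain N (fun n t => Z n t + Y n t).
Proof.
move=> [LZ pZ] [LY pY]; split=> [n nN|n nN i].
  by apply: L2D; [exact: LZ|exact: LY].
have := primitiveKD (pZ n nN i) (pY n nN i).
by congr primitiveK; apply/funext => t; rewrite mxE.
Qed.

Lemma chain_mulmx (A : 'M[K]_d) Z : chain N Z -> chain N (fun n t => A *m Z n t).
Proof.
move=> [LZ pZ]; split=> [n nN|n nN i]; first exact/L2_mulmx/LZ.
have := primitiveK_sum (index_enum 'I_d) (fun j => primitiveKZ (A i j) (pZ n nN j)).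
by congr primitiveK; apply/funext => t; rewrite mxE.
Qed.

Lemma chainZ (c : K) Z : chain N Z -> chain N (fun n t => c *: Z n t).
Proof.
move=> /(chain_mulmx c%:M); congr chain; apply/funext => n; apply/funext => t.
by rewrite mul_scalar_mx.
Qed.

Lemma chainB Z Y : chain N Z -> chain N Y -> chain N (fun n t => Z n t - Y n t).
Proof.
move=> cZ cY; have := chainD cZ (chainZ (-1) cY).
congr chain; apply/funext => n; apply/funext => t.
by rewrite scaleN1r.
Qed.

Lemma chain0 : chain N (fun _ _ => 0 : 'cV[K]_d).
Proof.
split=> [n nN|n nN i].
  by apply/L2P => i; have := @L2K0 R k; congr L2K; apply/funext => t; rewrite mxE.
by have := @primitiveK0 R k; congr primitiveK; apply/funext => t; rewrite mxE.
Qed.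

Lemma chain_sum (I : Type) (s : seq I) (Z : I -> nat -> R -> 'cV[K]_d) :
  (forall i, chain N (Z i)) -> chain N (fun n t => \sum_(i <- s) Z i n t).
Proof.
move=> cZ; elim: s => [|i s IH].
  have := chain0; congr chain; apply/funext => n; apply/funext => t.
  by rewrite big_nil.
have := chainD (cZ i) IH; congr chain; apply/funext => n; apply/funext => t.
by rewrite big_cons.
Qed.

Definition chain_traces Z : 'cV[K]_(bdim N d + bdim N d) :=
  col_mx (\mxcol_(n < N) Z n 1) (\mxcol_(n < N) Z n 0).

(** Each integration by parts moves one derivative to [Y] and changes the sign;
    there are no boundary terms, because the boundary values of [Y] vanish. *)
Lemma chain_by_parts Z Y n : chain N Z -> chain N Y ->
  (forall m, (m < N)%N -> Y m 0 = 0 /\ Y m 1 = 0) -> (n <= N)%N ->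
  integralK (fun t => dotv (Z n t) (Y 0%N t)) =
  (-1) ^+ n * integralK (fun t => dotv (Z 0%N t) (Y n t)).
Proof.
move=> [LZ pZ] [LY pY] Y0.
have step a b : (a < N)%N -> (b < N)%N ->
    integralK (fun t => dotv (Z a.+1 t) (Y b t)) =
    - integralK (fun t => dotv (Z a t) (Y b.+1 t)).
  move=> aN bN.
  have LZi m i : (m <= N)%N -> L2K (fun t => conjF (Z m t i 0)).
    by move=> mN; apply: L2K_conj; have /L2P := LZ m mN; exact.
  have LYi m i : (m <= N)%N -> L2K (fun t => Y m t i 0).
    by move=> mN; have /L2P := LY m mN; exact.
  have dotE m l : (m <= N)%N -> (l <= N)%N ->
      integralK (fun t => dotv (Z m t) (Y l t)) =
      \sum_i integralK (fun t => conjF (Z m t i 0) * Y l t i 0).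
    move=> mN lN; rewrite -integralK_sum.
      by apply: eq_integralK => t _; rewrite dotvE.
    by move=> i; apply: L2KM; [exact: LZi|exact: LYi].
  rewrite !dotE ?(ltnW aN) ?(ltnW bN)// -sumrN; apply: eq_bigr => i _.
  apply/eqP; rewrite -addr_eq0; apply/eqP.
  have [Yb0 Yb1] := Y0 b bN.
  rewrite (integralK_by_parts (LZi a i (ltnW aN)) (LZi a.+1 i aN) (LYi b i (ltnW bN))
    (LYi b.+1 i bN) (primitiveK_conj (pZ a aN i)) (pY b bN i)).
  by rewrite Yb0 Yb1 !mxE !mulr0 subr0.
move=> nN.
suff H b : (b <= n)%N -> integralK (fun t => dotv (Z n t) (Y 0%N t)) =
    (-1) ^+ b * integralK (fun t => dotv (Z (n - b)%N t) (Y b t)).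
  by rewrite (H n)// subnn.
elim: b => [_|b IH bn]; first by rewrite mul1r subn0.
rewrite IH ?(ltnW bn)// -[(n - b)%N]prednK ?subn_gt0// -subnS step.
- by rewrite exprS mulN1r mulrN mulNr.
- by rewrite (leq_trans _ nN)// subnS prednK ?subn_gt0// leq_subr.
- exact: leq_trans bn nN.
Qed.

End ChainAlgebra.

Section PortHamiltonianTheory.
Context {R : realType} {k : scalar_kind} {N d : nat}.
Local Notation K := (Kfield R k).
Local Notation mu := (@lebesgue_measure R).
Local Notation I01 := (@I01 R).
Variables (P : nat -> 'M[K]_d) (H : R -> 'M[K]_d) (m : R).
Hypotheses (hH : Linfty H) (m0 : 0 < m).
Hypothesis Hcoer : {ae mu, forall t, I01 t -> H t = ctmx (H t) /\ coercive m (H t)}.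
Implicit Types (x y : R -> 'cV[K]_d) (Z : nat -> R -> 'cV[K]_d).

Local Notation Hinv t := (cramer_inv (H t)).

Lemma measurable_H i j : measurableK (fun t => H t i j).
Proof. by have [mH _] := hH; exact: mH. Qed.

Lemma bounded_H : exists C : R, {ae mu, forall t, I01 t -> forall i j,
  `|reK (H t i j)| <= C /\ `|imK (H t i j)| <= C}.
Proof.
have [_ [C HC]] := hH; exists C; apply: aeS HC => t h It i j.
exact/normK_le/h.
Qed.

Lemma L2_Hmul x : L2 x -> L2 (Hmul H x).
Proof.
by have [C HC] := bounded_H; move=> Lx; apply: (L2_mulmx_bounded _ HC) => //;
  exact: measurable_H.
Qed.

Lemma bounded_Hinv : {ae mu, forall t, I01 t -> forall i j,
  `|reK (Hinv t i j)| <= m^-1 /\ `|imK (Hinv t i j)| <= m^-1}.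
Proof.
by apply: aeS Hcoer => t /[apply] -[_ h] i j; exact: cramer_inv_le.
Qed.

Lemma L2_Hinv x : L2 x -> L2 (fun t => Hinv t *m x t).
Proof.
move=> Lx; apply: (L2_mulmx_bounded _ bounded_Hinv) => //.
exact: measurableK_cramer_inv measurable_H.
Qed.

Lemma Hmul_Hinv x : ae01 (Hmul H (fun t => Hinv t *m x t)) x.
Proof.
apply: aeS Hcoer => t /[apply] -[_ h].
by rewrite /Hmul mulmxA cramer_mul ?mul1mx//; exact: coercive_unit h.
Qed.

(** From here on the operator and the ports are computed from a chain that starts
    at [Hx]. *)
Lemma pH_chain x Z : L2 x -> chain N Z -> ae01 (Hmul H x) (Z 0%N) ->
  [/\ pH_dom N H x,
      ae01 (pH_A N P H x) (fun t => \sum_(n < N.+1) P n *m Z n t)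
    & forall W, pH_port P H W x = W *m (R0 P *m chain_traces (N := N) Z)].
Proof.
move=> Lx cZ xZ; have [sx wx tx] := chain_sobolev (L2_Hmul Lx) cZ xZ.
split; first by split.
- have FF := ae_filter_ringOfSetsType mu.
  have : {ae mu, forall t, forall n : 'I_N.+1, I01 t -> wderiv n (Hmul H x) t = Z n t}.
    by apply: filter_forall => n; apply: wx; rewrite -ltnS.
  apply: aeS => t h It; rewrite /pH_A; apply: eq_bigr => n _; congr (_ *m _).
  exact: h.
- move=> W; rewrite /pH_port /flow_effort /boundary_trace /chain_traces.
  congr (_ *m (_ *m col_mx _ _)); apply: eq_mxcol => n; apply: tx => //.
    exact: I01_1.
  exact: I01_0.
Qed.

Lemma chain_pH Z : chain N Z -> exists x, [/\ L2 x, ae01 (Hmul H x) (Z 0%N),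
  x = (fun t => Hinv t *m Z 0%N t) &
  [/\ pH_dom N H x,
      ae01 (pH_A N P H x) (fun t => \sum_(n < N.+1) P n *m Z n t)
    & forall W, pH_port P H W x = W *m (R0 P *m chain_traces (N := N) Z)]].
Proof.
move=> cZ; pose x t := Hinv t *m Z 0%N t.
have Lx : L2 x by apply: L2_Hinv; exact: cZ.1.
have xZ : ae01 (Hmul H x) (Z 0%N) by exact: Hmul_Hinv.
by exists x; split => //; exact: pH_chain.
Qed.

Lemma L2_pH_A x : pH_dom N H x -> L2 (pH_A N P H x).
Proof.
move=> [Lx [LHx Hw]].
have Lw n : (n <= N)%N -> L2 (wderiv n (Hmul H x)).
  move=> nN; rewrite /wderiv; case: xgetP => [g _ []//|hg].
  by have [g Hg] := Hw n nN; have := hg g Hg.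
by apply: L2_sum => n; apply: L2_mulmx; apply: Lw; rewrite -ltnS.
Qed.

Lemma inner_X_ae y y' x : L2 y -> L2 y' -> L2 x -> ae01 y y' ->
  inner_X H y x = inner_X H y' x.
Proof.
move=> Ly Ly' Lx yy'; apply: integralK_ae.
- by apply: integrableK_measurable; apply: L2_dotv => //; exact: L2_Hmul.
- by apply: integrableK_measurable; apply: L2_dotv => //; exact: L2_Hmul.
- by apply: aeS yy' => t /[apply] ->.
Qed.

(** The norm of [X] dominates the one of [L^2], since [H >= m]. *)
Lemma norm2_X_le0 x : L2 x -> norm2_X H x <= 0 -> ae01 x (fun=> 0).
Proof.
move=> Lx; rewrite /norm2_X /inner_X reK_integral => le0.
have [ir _] := L2_dotv Lx (L2_Hmul Lx).
have ge : {ae mu, forall t, I01 t -> m * reK (dotv (x t) (x t)) <= reK (dotv (x t) (H t *m x t))}.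
  by apply: aeS Hcoer => t /[apply] -[_ h]; exact: h.
have ge0 : {ae mu, forall t, I01 t -> 0 <= reK (dotv (x t) (H t *m x t))}.
  apply: aeS ge => t /[apply]; apply: le_trans.
  by rewrite mulr_ge0 ?dotvv_ge0// ltW.
apply: aeS (aeI ge (int01_eq0 ir ge0 le0)) => t [h1 h2] It.
apply: dotvv_eq0; apply/eqP; rewrite eq_le dotvv_ge0 andbT.
by have := h1 It; rewrite (h2 It) pmulr_rle0.
Qed.

End PortHamiltonianTheory.

(** * The range condition *)

Section EssentialBounds.
Context {R : realType} {k : scalar_kind}.
Local Notation K := (Kfield R k).
Local Notation mu := (@lebesgue_measure R).
Local Notation I01 := (@I01 R).

Definition essbdK (f : R -> K) : Prop := exists C : R,
  {ae mu, forall t, I01 t -> `|reK (f t)| <= C /\ `|imK (f t)| <= C}.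

Lemma essbdK_cst (c : K) : essbdK (fun=> c).
Proof.
exists (`|reK c| + `|imK c|); apply: ae_everywhere => t _.
by rewrite lerDl lerDr !normr_ge0.
Qed.

Lemma essbdKD (f g : R -> K) : essbdK f -> essbdK g -> essbdK (fun t => f t + g t).
Proof.
move=> [C HC] [D HD]; exists (C + D); apply: aeS (aeI HC HD) => t [h1 h2] It.
have [r1 i1] := h1 It; have [r2 i2] := h2 It.
by rewrite reKD imKD; split; apply: le_trans (ler_normD _ _) _; exact: lerD.
Qed.

Lemma essbdKM (f g : R -> K) : essbdK f -> essbdK g -> essbdK (fun t => f t * g t).
Proof.
move=> [C HC] [D HD]; exists (C * D + C * D).
apply: aeS (aeI HC HD) => t [h1 h2] It.
have [r1 i1] := h1 It; have [r2 i2] := h2 It.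
rewrite reKM imKM; split.
  by apply: le_trans (ler_normB _ _) _; rewrite !normrM; apply: lerD; exact: ler_pM.
by apply: le_trans (ler_normD _ _) _; rewrite !normrM; apply: lerD; exact: ler_pM.
Qed.

Lemma essbdK_sum (I : Type) (s : seq I) (h : I -> R -> K) :
  (forall i, essbdK (h i)) -> essbdK (fun t => \sum_(i <- s) h i t).
Proof.
move=> hh; elim: s => [|i s IH].
  by have := essbdK_cst 0; congr essbdK; apply/funext => t; rewrite big_nil.
by have := essbdKD (hh i) IH; congr essbdK; apply/funext => t; rewrite big_cons.
Qed.

Lemma essbdK_mulmx m n p (A : R -> 'M[K]_(m, n)) (B : R -> 'M[K]_(n, p)) :
  (forall i j, essbdK (fun t => A t i j)) -> (forall i j, essbdK (fun t => B t i j)) ->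
  forall i j, essbdK (fun t => (A t *m B t) i j).
Proof.
move=> bA bB i j.
have := essbdK_sum (index_enum 'I_n) (fun l => essbdKM (bA i l) (bB l j)).
by congr essbdK; apply/funext => t; rewrite mxE.
Qed.

Lemma essbdK_uniform (I : finType) (f : I -> R -> K) : (forall i, essbdK (f i)) ->
  exists C : R, forall i,
    {ae mu, forall t, I01 t -> `|reK (f i t)| <= C /\ `|imK (f i t)| <= C}.
Proof.
move=> /choice[C HC]; exists (\sum_i `|C i|) => i.
have le x : x <= C i -> x <= \sum_j `|C j|.
  move=> /le_trans; apply; apply: le_trans (ler_norm _) _.
  by rewrite (bigD1 i)//= lerDl sumr_ge0.
by apply: aeS (HC i) => t /[apply] -[h1 h2]; split; exact: le.
Qed.

Lemma L2_mulmx_essbd m n (A : R -> 'M[K]_(m, n)) (x : R -> 'cV[K]_n) :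
  (forall i j, measurableK (fun t => A t i j)) ->
  (forall i j, essbdK (fun t => A t i j)) -> L2 x -> L2 (fun t => A t *m x t).
Proof.
move=> mA bA Lx.
have [C HC] := @essbdK_uniform ('I_m * 'I_n)%type (fun p t => A t p.1 p.2) (fun p => bA p.1 p.2).
apply: (@L2_mulmx_bounded _ _ _ _ _ _ C) => //.
have FF := ae_filter_ringOfSetsType mu.
have : {ae mu, forall t, forall p : 'I_m * 'I_n, I01 t ->
    `|reK (A t p.1 p.2)| <= C /\ `|imK (A t p.1 p.2)| <= C}.
  by apply: filter_forall => p; exact: HC.
by apply: aeS => t h It i j; exact: (h (i, j)).
Qed.

End EssentialBounds.

Section PortHamiltonianODE.
Context {R : realType} {k : scalar_kind} {N d : nat}.
Local Notation K := (Kfield R k).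
Local Notation mu := (@lebesgue_measure R).
Local Notation I01 := (@I01 R).
Variables (P : nat -> 'M[K]_d) (H : R -> 'M[K]_d) (m : R).
Hypotheses (hH : Linfty H) (m0 : 0 < m).
Hypothesis Hcoer : {ae mu, forall t, I01 t -> H t = ctmx (H t) /\ coercive m (H t)}.
Hypotheses (hPN : P N \in unitmx).
Implicit Types (x y : R -> 'cV[K]_d) (Z : nat -> R -> 'cV[K]_d).

Local Notation Hinv t := (cramer_inv (H t)).

(** The equation [Ax - beta x = y], for [z = Hx], is solved for the derivative
    of order [N] of [z] and written as a first-order system; the entries of
    [ode_coef j] multiply the derivative of order [j]. *)
Let ode_coef (beta : R) (j : nat) (t : R) : 'M[K]_d :=
  invmx (P N) *m ((if j == 0%N then ofR beta *: Hinv t else 0) - P j).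

Let measurable_ode_coef beta j a b : measurableK (fun t => ode_coef beta j t a b).
Proof.
apply: measurableK_mulmx; first by move=> *; exact: measurableK_cst.
move=> l q; have mHi := measurableK_cramer_inv (measurable_H hH) l q.
have : measurableK (fun t => (if j == 0%N then ofR beta * Hinv t l q else 0) - P j l q).
  apply: measurableKD; last exact: measurableK_cst.
  case: eqP => _; last exact: measurableK_cst.
  exact: measurableKM (measurableK_cst _) mHi.
by congr measurableK; apply/funext => t; rewrite !mxE; case: eqP => _; rewrite !mxE.
Qed.

Let essbd_ode_coef beta j a b : essbdK (fun t => ode_coef beta j t a b).
Proof.
apply: essbdK_mulmx; first by move=> *; exact: essbdK_cst.
move=> l q.
have bHi : essbdK (fun t => Hinv t l q).
  by exists m^-1; apply: aeS (bounded_Hinv m0 Hcoer) => t /[apply]; exact.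
have : essbdK (fun t => (if j == 0%N then ofR beta * Hinv t l q else 0) - P j l q).
  apply: essbdKD; last exact: essbdK_cst.
  case: eqP => _; last exact: essbdK_cst.
  exact: essbdKM (essbdK_cst _) bHi.
by congr essbdK; apply/funext => t; rewrite !mxE; case: eqP => _; rewrite !mxE.
Qed.

(** The unknowns are the derivatives of order less than [N], and the last
    derivative of the chain is defined by the equation. *)
Lemma ode_chain (beta : R) y (v : 'I_N -> 'cV[K]_d) : L2 y -> exists Z,
  [/\ chain N Z, forall n : 'I_N, Z n 0 = v n &
   (0 < N)%N -> forall t, \sum_(n < N.+1) P n *m Z n t = y t + ofR beta *: (Hinv t *m Z 0%N t)].
Proof.
move=> Ly.
pose top (y' : 'I_N -> R -> 'cV[K]_d) (t : R) : 'cV[K]_d := \sum_(j < N) ode_coef beta j t *m y' j t + invmx (P N) *m y t.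
(* Rows of order less than [N-1] say that the next unknown is the derivative; the
   row of order [N-1] is the equation. *)
pose A (p q : 'I_N * 'I_d) t : K := if (p.1.+1 < N)%N
  then ((q.1 == p.1.+1 :> nat) && (q.2 == p.2))%:R else ode_coef beta q.1 t p.2 q.2.
pose f (p : 'I_N * 'I_d) t : K := if (p.1.+1 < N)%N then 0 else (invmx (P N) *m y t) p.2 0.
have mA p q : measurableK (A p q).
  by rewrite /A; case: (p.1.+1 < N)%N; [exact: measurableK_cst|exact: measurable_ode_coef].
have bA p q : essbdK (A p q).
  by rewrite /A; case: (p.1.+1 < N)%N; [exact: essbdK_cst|exact: essbd_ode_coef].
have Lf p : L2K (f p).
  rewrite /f; case: (p.1.+1 < N)%N; first exact: L2K0.
  by have /L2P := L2_mulmx (invmx (P N)) Ly; exact.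
have [C HC] := @essbdK_uniform _ _ ('I_N * 'I_d * ('I_N * 'I_d))%type
  (fun pq => A pq.1 pq.2) (fun pq => bA pq.1 pq.2).
have [z Hz] := linear_ode (fun p => v p.1 p.2 0) mA (fun p q => HC (p, q))
  (fun p => L2K_integrable (Lf p)).
pose z' (n : 'I_N) t : 'cV[K]_d := \col_i z (n, i) t.
pose Z (n : nat) t : 'cV[K]_d := if insub n is Some n' then z' n' t else top z' t.
have ZE (n : 'I_N) t : Z n t = z' n t by rewrite /Z valK.
have ZN t : Z N t = top z' t by rewrite /Z insubF// ltnn.
have pz (n : 'I_N) i : primitiveK (z (n, i)) (fun t => Z n.+1 t i 0).
  have [_] := Hz (n, i); congr primitiveK; apply/funext => t; rewrite /A /f /=.
  case: ltnP => nN.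
    rewrite addr0 (ZE (Ordinal nN)) mxE (bigD1 (Ordinal nN, i))//= !eqxx mul1r.
    rewrite big1 ?addr0// => -[j l]; rewrite -pair_eqE /= negb_and => h.
    rewrite -val_eqE /= in h.
    by move: h; rewrite -negb_and => /negbTE ->; rewrite mul0r.
  have -> : n.+1 = N by apply/eqP; rewrite eqn_leq nN andbT ltn_ord.
  rewrite ZN /top [RHS]mxE; congr (_ + _); rewrite summxE.
  transitivity (\sum_(j < N) \sum_(l < d) ode_coef beta j t i l * z (j, l) t).
    by rewrite pair_bigA /=; apply: eq_bigr => -[].
  by apply: eq_bigr => j _; rewrite [RHS]mxE; apply: eq_bigr => l _; congr (_ * _); rewrite mxE.
have cz (n : 'I_N) i : continuousK (z (n, i)) by exact: primitiveK_continuous (pz n i).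
have Lz (n : 'I_N) : L2 (z' n).
  apply/L2P => i; have := continuousK_L2K (cz n i); congr L2K.
  by apply/funext => t; rewrite mxE.
have Ltop : L2 (top z').
  apply: L2D; last exact: L2_mulmx.
  by apply: L2_sum => j; apply: L2_mulmx_essbd.
exists Z; split.
- split=> [n|n nN i].
    rewrite leq_eqVlt => /predU1P[->|nN].
      by move: Ltop; congr L2; apply/funext => t; rewrite ZN.
    by move: (Lz (Ordinal nN)); congr L2; apply/funext => t; rewrite -ZE.
  have := pz (Ordinal nN) i; congr primitiveK; apply/funext => t.
  by rewrite (ZE (Ordinal nN)) mxE.
- move=> n; rewrite ZE; apply/colP => i; rewrite mxE.
  by have [->] := Hz (n, i).
- move=> N0 t; rewrite big_ord_recr /= ZN /top mulmxDr mulmxA mulmxV// mul1mx.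
  rewrite mulmx_sumr addrA [_ + y t]addrC; congr (_ + _).
  rewrite -big_split /=.
  rewrite (bigD1 (Ordinal N0))//= big1 ?addr0 => [|n n0].
    by rewrite !mulmxA mulmxV// mul1mx -(ZE (Ordinal N0)) /= mulmxBl subrKC scalemxAl.
  rewrite mulmxA /ode_coef mulmxA mulmxV// mul1mx.
  have -> : (n == 0 :> nat) = false by apply: negbTE; rewrite -val_eqE in n0.
  by rewrite sub0r mulNmx ZE subrr.
Qed.

(** Here [Ax = beta x] and the output of [x] vanishes, so passivity gives
    [beta |x|^2 <= 0].  Then the first function of the chain vanishes almost
    everywhere, hence everywhere by continuity, and so do its successors. *)
Lemma homogeneous_traces (WB WC : 'M[K]_(bdim N d, bdim N d + bdim N d)) (beta : R) Z :
  (0 < N)%N -> 0 < beta -> impedance_passive P H WB WC -> chain N Z ->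
  (forall t, \sum_(n < N.+1) P n *m Z n t = ofR beta *: (Hinv t *m Z 0%N t)) ->
  WC *m (R0 P *m chain_traces (N := N) Z) = 0 ->
  forall n, (n < N)%N -> Z n 0 = 0.
Proof.
move=> N0 b0 pass cZ eqZ WZ.
have [x [Lx xZ xE [dx Ax port]]] := chain_pH P hH m0 Hcoer cZ.
have Axb : ae01 (pH_A N P H x) (fun t => ofR beta *: x t).
  by apply: aeS Ax => t /[apply] ->; rewrite eqZ xE.
have x0 : ae01 x (fun=> 0).
  apply: (norm2_X_le0 hH m0 Hcoer) => //.
  have := pass x dx; rewrite (port WC) WZ dotv0r raddf0 /=.
  rewrite (inner_X_ae hH (L2_pH_A P dx) (L2Z _ Lx) Lx Axb).
  have -> : inner_X H (fun t => ofR beta *: x t) x = ofR beta * inner_X H x x.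
    rewrite /inner_X -integralKZ; last exact: L2_dotv Lx (L2_Hmul hH Lx).
    by apply: eq_integralK => t _; rewrite dotvZl conjF_ofR.
  by rewrite reKM reK_ofR imK_ofR mul0r subr0 pmulr_rle0.
have Z0 : ae01 (Z 0%N) (fun=> 0).
  apply: aeS (aeI xZ x0) => t [h1 h2] It.
  by rewrite -(h1 It) /Hmul (h2 It) mulmx0.
have cont0 : continuous01 (fun=> 0 : 'cV[K]_d).
  by move=> i j; split => t; rewrite mxE; exact: cvg_cst.
suff Hn n : (n < N)%N -> forall t, I01 t -> Z n t = 0.
  by move=> n nN; apply: Hn => //; exact: I01_0.
elim: n => [|n IH] nN; first exact: (continuous01_ae_eq (chain_continuous cZ nN) cont0).
have nN' := ltnW nN.
apply: (continuous01_ae_eq (chain_continuous cZ nN) cont0).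
apply/ae01_colP => i; have [[i1 p1] [i2 p2]] := cZ.2 n nN' i.
have Zn t : I01 t -> Z n t i 0 = 0 by move=> It; rewrite IH// mxE.
split.
  apply: ae01_trans (prim_eq0 i1 _) _; last first.
    by apply: ae_everywhere => t _; rewrite mxE raddf0.
  move=> t It; have := p1 t It; rewrite !Zn//; last exact: I01_0.
  by rewrite raddf0 add0r.
apply: ae01_trans (prim_eq0 i2 _) _; last first.
  by apply: ae_everywhere => t _; rewrite mxE raddf0.
move=> t It; have := p2 t It; rewrite !Zn//; last exact: I01_0.
by rewrite raddf0 add0r.
Qed.

Lemma chain_traces_sum (I : finType) (v : I -> K) (Z : I -> nat -> R -> 'cV[K]_d) :
  chain_traces (N := N) (fun n t => \sum_i v i *: Z i n t) =
  \sum_i v i *: chain_traces (N := N) (Z i).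
Proof.
rewrite /chain_traces; apply/matrixP => a b; rewrite summxE.
case: (split_ordP a) => {}a ->.
  rewrite col_mxEu mxE summxE; apply: eq_bigr => i _.
  by rewrite [RHS]mxE col_mxEu !mxE.
rewrite col_mxEd mxE summxE; apply: eq_bigr => i _.
by rewrite [RHS]mxE col_mxEd !mxE.
Qed.

Lemma chain_tracesD Z Y : chain_traces (N := N) (fun n t => Z n t + Y n t) =
  chain_traces (N := N) Z + chain_traces (N := N) Y.
Proof. by rewrite /chain_traces !mxcolD add_col_mx. Qed.

(** Solutions of the differential equation are parametrized by their boundary
    values [w] at 0, through a fundamental system [Zh] and a particular solution
    [Zp].  The boundary condition is then a square linear system for [w], with
    matrix [G]; it is solvable because it is injective, by the uniqueness of
    homogeneous solutions. *)
Lemma range_ker_pos (WB WC : 'M[K]_(bdim N d, bdim N d + bdim N d)) (beta : R) y :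
  (0 < N)%N -> 0 < beta -> impedance_passive P H WB WC -> L2 y -> exists x,
    [/\ pH_dom N H x, pH_port P H WC x = 0
      & ae01 (fun t => pH_A N P H x t - ofR beta *: x t) y].
Proof.
move=> N0 b0 pass Ly.
have L0 : L2 (fun=> 0 : 'cV[K]_d) by have [] := @chain0 R k 0 d => /(_ 0%N (leqnn _)).
have [Zp [cZp Zp0 eqZp]] := ode_chain beta (fun=> 0) Ly.
have /choice[Zh HZh] (j : 'I_(bdim N d)) := ode_chain beta
  (fun n => submxcol (delta_mx j 0 : 'cV[K]_(bdim N d)) n) L0.
have cZh j : chain N (Zh j) by have [] := HZh j.
have traces_h j : dsubmx (chain_traces (N := N) (Zh j)) = delta_mx j 0.
  rewrite /chain_traces col_mxKd -[RHS]submxcolK; apply: eq_mxcol => n.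
  by have [_ -> _] := HZh j.
have eqZh (w : 'cV[K]_(bdim N d)) t : \sum_(n < N.+1) P n *m (\sum_j w j 0 *: Zh j n t) =
    ofR beta *: (Hinv t *m \sum_j w j 0 *: Zh j 0%N t).
  under eq_bigr do rewrite mulmx_sumr.
  rewrite exchange_big mulmx_sumr scaler_sumr; apply: eq_bigr => j _ /=.
  have [_ _ /(_ N0 t)] := HZh j; rewrite add0r => E.
  rewrite -scalemxAr scalerA mulrC -scalerA -E scaler_sumr.
  by apply: eq_bigr => n _; rewrite -scalemxAr.
(* The boundary values at 1 and at 0 of the solution with data [w] are [T w]. *)
pose T := \matrix_(a, j) chain_traces (N := N) (Zh j) a 0.
have TE (w : 'cV[K]_(bdim N d)) : chain_traces (N := N) (fun n t => \sum_j w j 0 *: Zh j n t) = T *m w.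
  rewrite chain_traces_sum; apply/colP => a; rewrite summxE mxE.
  by apply: eq_bigr => j _; rewrite !mxE mulrC.
pose G := WC *m R0 P *m T.
have uG : G \in unitmx.
  rewrite -unitmx_tr -row_free_unit; apply: inj_row_free => v vG.
  have Gv : G *m v^T = 0 by apply: trmx_inj; rewrite trmx_mul trmxK vG trmx0.
  have cv : chain N (fun n t => \sum_j v^T j 0 *: Zh j n t).
    by apply: chain_sum => j; exact: chainZ.
  have := homogeneous_traces N0 b0 pass cv (eqZh v^T).
  rewrite TE !mulmxA -/G Gv => /(_ erefl) Hv.
  have : dsubmx (T *m v^T) = 0.
    rewrite -TE /chain_traces col_mxKd -[RHS]mxcol0; apply: eq_mxcol => n.
    exact: Hv.
  have -> : T *m v^T = \sum_j v^T j 0 *: chain_traces (N := N) (Zh j).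
    by rewrite -TE chain_traces_sum.
  rewrite linear_sum /=; under eq_bigr do rewrite linearZ /= traces_h.
  rewrite -[X in X = 0](_ : v^T = _); first by move=> h; apply: trmx_inj; rewrite h trmx0.
  apply/colP => a; rewrite summxE (bigD1 a)//= big1 ?addr0 => [|j ja].
    by rewrite !mxE !eqxx mulr1.
  by rewrite !mxE eq_sym (negbTE ja) mulr0.
pose w := - (invmx G *m (WC *m (R0 P *m chain_traces (N := N) Zp))).
pose Z n t := \sum_j w j 0 *: Zh j n t + Zp n t.
have cZ : chain N Z.
  by apply: chainD => //; apply: chain_sum => j; exact: chainZ.
have [x [Lx xZ xE [dx Ax port]]] := chain_pH P hH m0 Hcoer cZ.
exists x; split => //.
  rewrite port /Z chain_tracesD TE !mulmxDr !mulmxA -/G.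
  by rewrite /w mulmxN mulKVmx// !mulmxA addNr.
apply: aeS Ax => t /[apply] ->; rewrite xE /Z.
under eq_bigr do rewrite mulmxDr.
rewrite big_split /= eqZh eqZp// mulmxDr scalerDr.
by rewrite addrCA addrK.
Qed.

(** For [N = 0] the operator is the multiplication by [P_0 H], and the equation
    [(P_0 H - 1) x = y] is solved pointwise.  Multiplied by [-H] it has the
    matrix [H - H P_0 H], which is coercive because [P_0] is dissipative. *)
Lemma range_ker_zero (WC : 'M[K]_(bdim N d, bdim N d + bdim N d)) y : N = 0%N ->
  loewner_le (P 0%N + ctmx (P 0%N)) 0 -> L2 y -> exists x,
    [/\ pH_dom N H x, pH_port P H WC x = 0
      & ae01 (fun t => pH_A N P H x t - ofR 1 *: x t) y].
Proof.
move=> NE P0 Ly.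
pose G t := H t - H t *m (P 0%N *m H t).
have mG i j : measurableK (fun t => G t i j).
  have m1 := measurableK_mulmx (A := fun=> P 0%N) (B := H)
    (fun _ _ => measurableK_cst _) (measurable_H hH).
  have m2 := measurableK_mulmx (measurable_H hH) m1 i j.
  have := measurableKD (measurable_H hH i j) (measurableKM (measurableK_cst (-1)) m2).
  by congr measurableK; apply/funext => t; rewrite /G !mxE mulN1r.
have P0re (v : 'cV[K]_d) : reK (dotv v (P 0%N *m v)) <= 0.
  have /leKP[_] := P0 v; rewrite mul0mx dotv0r raddf0 mulmxDl dotvDr reKD.
  rewrite -[in X in _ + X](ctmxK (ctmx (P 0%N))) -dotv_adj ctmxK.
  by rewrite -[in X in _ + X]conj_dotv reK_conj => h; lra.
have cG : {ae mu, forall t, I01 t -> coercive m (G t)}.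
  apply: aeS Hcoer => t /[apply] -[sH cH] w.
  apply: le_trans (cH w) _.
  rewrite /G mulmxBl -scaleN1r dotvDr dotvZr reKD mulN1r reKN lerDl oppr_ge0.
  by rewrite -!mulmxA {1}sH -dotv_adj; exact: P0re.
have bG : {ae mu, forall t, I01 t -> forall i j,
    `|reK (cramer_inv (G t) i j)| <= m^-1 /\ `|imK (cramer_inv (G t) i j)| <= m^-1}.
  by apply: aeS cG => t /[apply] h i j; exact: cramer_inv_le.
pose x t := cramer_inv (G t) *m (- 1 *: Hmul H y t).
have Lx : L2 x.
  apply: (L2_mulmx_bounded (measurableK_cramer_inv mG) bG).
  by apply: L2Z; exact: L2_Hmul.
have cZ : chain N (fun _ => Hmul H x).
  by split; [move=> n _; exact: (L2_Hmul hH Lx)|move=> n; rewrite NE].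
have [dx Ax port] := pH_chain P hH Lx cZ (ae_everywhere (fun t _ => erefl _)).
exists x; split => //.
  apply/matrixP => i; exfalso; move: (ltn_ord i); move: (nat_of_ord i) => j.
  by rewrite bdimE NE.
apply: aeS (aeI Ax (aeI cG Hcoer)) => t [h1 [h2 h3]] It.
rewrite (h1 It); have cGt := h2 It; have [sH cH] := h3 It.
have -> : \sum_(n < N.+1) P n *m Hmul H x t = P 0%N *m Hmul H x t.
  by rewrite NE big_ord1.
have Gx : G t *m x t = - Hmul H y t.
  by rewrite /x mulmxA cramer_mul ?mul1mx ?scaleN1r//; exact: coercive_unit cGt.
rewrite rmorph1 scale1r.
have uH := coercive_unit m0 cH.
apply: (can_inj (mulKmx uH)); rewrite -/(Hmul H y t) mulmxBr.
apply/eqP; rewrite -eqr_opp opprB -Gx /G mulmxBl /Hmul !mulmxA.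
by [].
Qed.

End PortHamiltonianODE.

(** * Boundary layers *)

Section BoundaryLayers.
Context {R : realType}.
Local Notation mu := (@lebesgue_measure R).
Local Notation I01 := (@I01 R).
Variable N : nat.

(** The second factor equals 1 up to order [N] at 0, so that the derivatives of
    order less than [N] at 0 are those of [X^m / m!]; it vanishes to order [K] at
    1, and tends to 0 on the rest of the interval as [K] grows. *)
Definition layer0 (K m : nat) : {poly R} :=
  (m`!%:R^-1 *: 'X^m) * (1 - 'X^(N.+1)) ^+ K.

(** The mirror image of [layer0], concentrated near 1; the sign makes its
    derivative of order [m] at 1 equal to 1. *)
Definition layer1 (K m : nat) : {poly R} := (-1) ^+ m *: (layer0 K m \Po (1 - 'X)).

Lemma eq_cvgn (u v : nat -> R) (l : R) : (forall n, u n = v n) ->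
  v n @[n --> \oo] --> l -> u n @[n --> \oo] --> l.
Proof. by move=> uv; rewrite (_ : u = v)//; exact/funext. Qed.

Lemma layer0_at0 K m i : (i < N)%N -> ((layer0 K m)^`(i)).[0] = (i == m)%:R.
Proof.
move=> iN; rewrite /layer0; have [s ->] : exists s : {poly R}, (1 - 'X^(N.+1)) ^+ K = 1 - 'X^(N.+1) * s.
  elim: K => [|K [s IH]]; first by exists 0; rewrite expr0 mulr0 subr0.
  by exists (s + 1 - 'X^(N.+1) * s); rewrite exprS IH; ring.
rewrite horner_coef0 coef_derivn addn0 ffactnn.
rewrite mulrBr mulr1 coefB coefZ coefXn mulrCA coefXnM (leq_trans iN (leqnSn _)) subr0.
case: eqP => [->|_]; last by rewrite mulr0 mul0rn.
have -> : true%:R = 1 :> R by [].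
by rewrite mulr1 -[LHS]mulr_natr mulVf// pnatr_eq0 -lt0n fact_gt0.
Qed.

Lemma derivn_factor (p q : {poly R}) K i : (i <= K)%N -> exists r, (p * q ^+ K)^`(i) = r * q ^+ (K - i).
Proof.
elim: i => [_|i IH iK]; first by exists p; rewrite subn0.
have [r rE] := IH (ltnW iK).
have -> : (p * q ^+ K)^`(i.+1) = ((p * q ^+ K)^`(i))^`() by rewrite derivnS.
rewrite rE; have -> : (K - i = (K - i.+1).+1)%N by rewrite subnSK.
exists (r^`() * q + r * q^`() *+ (K - i.+1).+1).
move: (K - i.+1)%N => j; rewrite derivM deriv_exp /= exprS mulrDl; congr (_ + _).
  exact: mulrA.
by rewrite mulrnAr mulrnAl; congr (_ *+ _); ring.
Qed.

Lemma layer0_at1 K m i : (N <= K)%N -> (i < N)%N -> ((layer0 K m)^`(i)).[1] = 0.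
Proof.
move=> NK iN; have iK := leq_trans iN NK.
rewrite /layer0; have [r ->] := derivn_factor (m`!%:R^-1 *: 'X^m) (1 - 'X^(N.+1)) (ltnW iK).
rewrite hornerM horner_exp !hornerE expr1n subrr expr0n subn_eq0 leqNgt iK.
by rewrite mulr0.
Qed.

Lemma derivn_reflect (p : {poly R}) i : (p \Po (1 - 'X))^`(i) = (-1) ^+ i *: (p^`(i) \Po (1 - 'X)).
Proof.
elim: i p => [|i IH] p; first by rewrite scale1r.
rewrite derivSn deriv_comp derivB derivC derivX sub0r mulrN1 derivnN IH -derivSn.
by rewrite exprS mulN1r scaleNr.
Qed.

Lemma layer1_derivn K m i a :
  ((layer1 K m)^`(i)).[a] = (-1) ^+ (m + i) * ((layer0 K m)^`(i)).[1 - a].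
Proof.
rewrite /layer1 derivnZ derivn_reflect !hornerZ horner_comp !hornerE.
by rewrite exprD.
Qed.

Lemma layer1_at1 K m i : (i < N)%N -> ((layer1 K m)^`(i)).[1] = (i == m)%:R.
Proof.
move=> iN; rewrite layer1_derivn subrr layer0_at0//.
by case: eqP => [->|_]; rewrite ?mulr0// mulr1 addnn -mul2n exprM sqrrN expr1n expr1n.
Qed.

Lemma layer1_at0 K m i : (N <= K)%N -> (i < N)%N -> ((layer1 K m)^`(i)).[0] = 0.
Proof. by move=> NK iN; rewrite layer1_derivn subr0 layer0_at1// mulr0. Qed.

Lemma layer0E K m t :
  (layer0 K m).[t] = m`!%:R^-1 * t ^+ m * (1 - t ^+ N.+1) ^+ K.
Proof. by rewrite /layer0 hornerM horner_exp !hornerE. Qed.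

Lemma layer0_le1 K m t : I01 t -> `|(layer0 K m).[t]| <= 1.
Proof.
move=> /in_I01/andP[t0 t1]; rewrite layer0E.
have e0 : 0 <= 1 - t ^+ N.+1 <= 1.
  by rewrite subr_ge0 exprn_ile1//= gerBl exprn_ge0.
have /andP[e1 e2] := e0.
have f1 : (m`!%:R^-1 : R) <= 1.
  by rewrite invf_le1 ?ltr0n ?fact_gt0// (ler_nat R 1) fact_gt0.
rewrite ger0_norm; last by rewrite !mulr_ge0 ?exprn_ge0 ?invr_ge0.
rewrite mulr_ile1 ?exprn_ge0 ?exprn_ile1//; last by rewrite mulr_ile1 ?invr_ge0 ?exprn_ge0 ?exprn_ile1.
by rewrite mulr_ge0 ?invr_ge0 ?exprn_ge0.
Qed.

Lemma layer0_cvg m t : I01 t -> t != 0 ->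
  (layer0 K m).[t] @[K --> \oo] --> (0 : R).
Proof.
move=> /in_I01/andP[t0 t1] tn0.
apply: (eq_cvgn (fun K => layer0E K m t)).
rewrite -[X in _ --> X](mulr0 (m`!%:R^-1 * t ^+ m)); apply: cvgMr; apply: cvg_expr.
rewrite ger0_norm ?subr_ge0 ?exprn_ile1// gtrBl exprn_gt0//.
by rewrite lt_neqAle eq_sym tn0.
Qed.

Definition layer (K : nat) (p : 'I_N * bool) : {poly R} :=
  if p.2 then layer1 K p.1 else layer0 K p.1.

Lemma I01_onem t : I01 t -> I01 (1 - t).
Proof. by move=> /in_I01/andP[t0 t1]; apply/in_I01; rewrite subr_ge0 t1 gerBl. Qed.

Lemma layer1E K m t : (layer1 K m).[t] = (-1) ^+ m * (layer0 K m).[1 - t].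
Proof. by have := layer1_derivn K m 0 t; rewrite !derivn0 addn0. Qed.

Lemma layer_le1 K p t : I01 t -> `|(layer K p).[t]| <= 1.
Proof.
rewrite /layer; case: p.2 => It; last exact: layer0_le1.
by rewrite layer1E normrM normrX normrN1 expr1n mul1r layer0_le1//; exact: I01_onem.
Qed.

Lemma layer_cvg p t : I01 t -> t != 0 -> t != 1 ->
  (layer K p).[t] @[K --> \oo] --> (0 : R).
Proof.
move=> It t0 t1; rewrite /layer; case: p.2; last exact: layer0_cvg.
apply: (eq_cvgn (fun K => layer1E K p.1 t)).
rewrite -[X in _ --> X](mulr0 ((-1) ^+ p.1)); apply: cvgMr; apply: layer0_cvg.
  exact: I01_onem.
by rewrite subr_eq0 eq_sym.
Qed.

Lemma horner_continuous01 (p : {poly R}) : {within I01, continuous (fun t => p.[t])}.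
Proof. by apply: continuous_subspaceT; exact: continuous_horner. Qed.

(** The layers are bounded by 1 and tend to 0 except at the endpoints. *)
Lemma int01_layers_cvg p q :
  int01 (fun t => (layer K p).[t] * (layer K q).[t]) @[K --> \oo] --> (0 : R).
Proof.
(* The indicator function removes the endpoints, where the convergence fails. *)
pose ind (t : R) : R := ((t != 0) && (t != 1))%:R.
have mind : measurable_fun I01 ind.
  rewrite (_ : ind = fun t => if t == 0 then 0 else if t == 1 then 0 else 1).
    apply: measurable_funTS; apply: measurable_fun_ifT => //.
      exact: (measurable_fun_eqr (@measurable_id _ _ _) (measurable_cst _)).
    apply: measurable_fun_ifT => //.
    exact: (measurable_fun_eqr (@measurable_id _ _ _) (measurable_cst _)).
  by apply/funext => t; rewrite /ind; case: eqP; case: eqP.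
have ml K r : measurable_fun I01 (fun t => (layer K r).[t]).
  by apply: integrable01_measurable; apply: integrable01_continuous; exact: horner_continuous01.
have E K : int01 (fun t => (layer K p).[t] * (layer K q).[t]) =
    int01 (fun t => ind t * ((layer K p).[t] * (layer K q).[t])).
  apply: int01_ae.
  - exact: measurable_funM.
  - by apply: measurable_funM => //; exact: measurable_funM.
  apply: aeS (aeI (ae_neq 0) (ae_neq 1)) => t [t0 t1] _.
  by rewrite /ind t0 t1 mul1r.
apply: (eq_cvgn E).
rewrite -[X in _ --> X](@int01_cst R 0).
apply: (@int01_dominated _ _ _ (cst 1) _ _ _ _).2.
- by move=> K; apply: measurable_funM => //; exact: measurable_funM.
- move=> t It; rewrite /ind; have [->|t0] := eqVneq t 0.
    by under eq_fun do rewrite mul0r; exact: cvg_cst.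
  have [->|t1] := eqVneq t 1.
    by under eq_fun do rewrite mul0r; exact: cvg_cst.
  apply: (eq_cvgn (fun n => mul1r _)).
  by rewrite /cst -[X in _ --> X](mulr0 0); apply: cvgM; exact: layer_cvg.
- exact: integrable01_cst.
- move=> K t It; rewrite /ind !normrM /cst.
  rewrite mulr_ile1 ?mulr_ge0// ?normr_nat; first by rewrite (ler_nat R _ 1) leq_b1.
  by rewrite mulr_ile1// layer_le1.
Qed.

Lemma primitive01_horner (p : {poly R}) : primitive01 (fun t => p.[t]) (fun t => p^`().[t]).
Proof.
have dE : derive1 (horner p) = horner p^`() by rewrite derivE.
have [||h1 h2] := @primitive01_C1 _ (horner p).
- by move=> x; exact: derivable_horner.
- by rewrite dE; exact: continuous_horner.
by rewrite dE in h1 h2; split.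
Qed.

End BoundaryLayers.

Section LayerChains.
Context {R : realType} {k : scalar_kind} {N d : nat}.
Local Notation K := (Kfield R k).
Local Notation I01 := (@I01 R).

Lemma poly_chain (p : {poly R}) (v : 'cV[K]_d) :
  chain N (fun n t => ofR (p^`(n)).[t] *: v).
Proof.
have pK n i : primitiveK (fun t => (ofR (p^`(n)).[t] *: v) i 0)
    (fun t => (ofR (p^`(n.+1)).[t] *: v) i 0).
  have := primitiveKZ (v i 0) (primitiveK_ofR (primitive01_horner p^`(n))).
  congr primitiveK; apply/funext => t; first by rewrite mxE mulrC.
  by rewrite mxE mulrC derivnS.
split=> [n _|n _ i]; last exact: pK.
apply/L2P => i; apply: continuousK_L2K; exact: primitiveK_continuous (pK n i).
Qed.

Definition layer_value (tau : 'cV[K]_(bdim N d + bdim N d)) (p : 'I_N * bool) : 'cV[K]_d :=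
  submxcol (if p.2 then usubmx tau else dsubmx tau) p.1.

(** Chains with the boundary values [tau] whose first function tends to 0 in
    [L^2] as [M] grows. *)
Definition layer_chain tau (M : nat) (n : nat) (t : R) : 'cV[K]_d :=
  \sum_p ofR ((layer M p)^`(n)).[t] *: layer_value tau p.

Lemma chain_layer tau M : chain N (layer_chain tau M).
Proof. by apply: chain_sum => p; exact: poly_chain. Qed.

Lemma layer_chain_traces tau M : (N <= M)%N ->
  chain_traces (N := N) (layer_chain tau M) = tau.
Proof.
move=> NM.
have sumE (n : 'I_N) (b : bool) (w : 'I_N * bool -> 'cV[K]_d) (c : 'I_N * bool -> R) :
    (forall p, c p = (p == (n, b))%:R) -> \sum_p ofR (c p) *: w p = w (n, b).
  move=> cE; rewrite (bigD1 (n, b))//= big1 ?addr0 => [|p pn].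
    by rewrite cE eqxx rmorph1 scale1r.
  by rewrite cE (negbTE pn) rmorph0 scale0r.
rewrite /chain_traces -[RHS]vsubmxK; congr col_mx; rewrite -[RHS]submxcolK;
  apply: eq_mxcol => n.
- rewrite /layer_chain (sumE n true) // => -[m b]; rewrite /layer /= -pair_eqE /=.
  rewrite (eq_sym m n); case: b; first by rewrite layer1_at1// andbT.
  by rewrite layer0_at1// andbF.
- rewrite /layer_chain (sumE n false) // => -[m b]; rewrite /layer /= -pair_eqE /=.
  rewrite (eq_sym m n); case: b; first by rewrite layer1_at0// andbF.
  by rewrite layer0_at0// andbT.
Qed.

Lemma layer_chain_form_cvg tau (A : 'M[K]_d) :
  reK (integralK (fun t => dotv (A *m layer_chain tau M 0 t) (layer_chain tau M 0 t)))
    @[M --> \oo] --> (0 : R).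
Proof.
pose w p := layer_value tau p.
have E M : reK (integralK (fun t => dotv (A *m layer_chain tau M 0 t) (layer_chain tau M 0 t))) =
    \sum_p \sum_q reK (dotv (A *m w p) (w q)) *
      int01 (fun t => (layer M p).[t] * (layer M q).[t]).
  have ipq (p q : 'I_N * bool) : @integrable01 R (fun t => (layer M p).[t] * (layer M q).[t]).
    apply: integrable01M_continuous; first exact: horner_continuous01.
    by apply: integrable01_continuous; exact: horner_continuous01.
  rewrite reK_integral.
  transitivity (int01 (fun t => \sum_p \sum_q reK (dotv (A *m w p) (w q)) *
      ((layer M p).[t] * (layer M q).[t]))).
    apply: eq_int01 => t _; rewrite /layer_chain mulmx_sumr dotv_suml raddf_sum /=.
    apply: eq_bigr => p _; rewrite dotv_sumr raddf_sum /=; apply: eq_bigr => q _.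
    rewrite -scalemxAr dotvZl dotvZr conjF_ofR ?derivn0 !(reKM, imKM, reK_ofR, imK_ofR).
    by rewrite /w; ring.
  rewrite int01_sum => [|p]; last by apply: integrable01_sum => q; exact: integrable01Z.
  apply: eq_bigr => p _; rewrite int01_sum => [|q]; last exact: integrable01Z.
  by apply: eq_bigr => q _; rewrite int01Z.
apply: (eq_cvgn E).
rewrite -[X in _ --> X](_ : \sum_(p : 'I_N * bool) \sum_(q : 'I_N * bool) 0 = 0 :> R); last first.
  by rewrite big1// => p _; rewrite big1.
apply: cvg_big => [|p _]; first exact: add_continuous.
apply: cvg_big => [|q _]; first exact: add_continuous.
rewrite -[X in _ --> X](mulr0 (reK (dotv (A *m w p) (w q)))); apply: cvgMr.
exact: int01_layers_cvg.
Qed.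

End LayerChains.

(** * Energy balance *)

Section BoundaryMatrix.
Context {R : realType} {k : scalar_kind} {N d : nat}.
Local Notation K := (Kfield R k).
Variables (P : nat -> 'M[K]_d).
Hypothesis (hPN : P N \in unitmx).

(** [Lambda] is block triangular, with the blocks [P_N] up to sign on the
    anti-diagonal; so the blocks of [v] vanish one after the other, the row
    [N-1-j] determining the block [j]. *)
Lemma Lambda_inj (v : 'cV[K]_(bdim N d)) : Lambda P *m v = 0 -> v = 0.
Proof.
move=> Lv; rewrite -[v]submxcolK -[RHS]mxcol0; apply: eq_mxcol => j.
have row (i : 'I_N) : \sum_(j < N)
    (if (i + j + 1 <= N)%N then (-1) ^+ i *: P (i + j + 1)%N else 0) *m submxcol v j = 0.
  move: Lv; rewrite -{1}[v]submxcolK /Lambda mul_mxblock_mxrow -[RHS]mxcol0.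
  by move=> /eq_mxcolP/(_ i).
have [n] := ubnP (j : nat); elim: n j => // n IH j; rewrite ltnS => jn.
have iN : (N - j.+1 < N)%N by rewrite subnSK// leq_subr.
have := row (Ordinal iN); rewrite (bigD1 j)//= big1 ?addr0 => [|l lj].
  have -> : (N - j.+1 + j + 1)%N = N by rewrite -addnA addn1 subnK.
  rewrite leqnn -scalemxAl => /(congr1 (fun w => (-1) ^+ (N - j.+1) *: w)).
  rewrite scalerA -exprMn mulrNN mulr1 expr1n scale1r scaler0.
  by move=> /(congr1 (mulmx (invmx (P N)))); rewrite mulKmx// mulmx0.
case: ifP => [le|_]; last by rewrite mul0mx.
rewrite IH ?mulmx0//.
suff : (l < j)%N by move=> /leq_trans; apply.
rewrite ltn_neqAle lj /=.
move: le; rewrite -addnA -[X in (_ <= X)%N -> _](subnK (ltn_ord j)) leq_add2l addn1.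
by rewrite ltnS.
Qed.

Lemma R0_unit : R0 (N := N) P \in unitmx.
Proof.
rewrite -unitmx_tr -row_free_unit; apply: inj_row_free => v vR.
have Rv : R0 (N := N) P *m v^T = 0 by apply: trmx_inj; rewrite trmx_mul trmxK vR trmx0.
suff v0 : v^T = 0 by apply: trmx_inj; rewrite v0 trmx0.
move: (v^T) Rv => w; rewrite /R0 -scalemxAl => /eqP.
have c0 : (ofR (Num.sqrt 2)^-1 : K) != 0.
  by rewrite fmorph_eq0 invr_eq0 sqrtr_eq0 -ltNge.
rewrite scaler_eq0 (negbTE c0) /= -[w]vsubmxK mul_block_col -col_mx0.
move=> /eqP/eq_col_mx[]; rewrite mulNmx -mulmxBr => /Lambda_inj/eqP.
rewrite subr_eq0 => /eqP ->; rewrite !mul1mx => /eqP.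
rewrite -mulr2n -scaler_nat scaler_eq0 pnatr_eq0 /= => /eqP ->.
by rewrite col_mx0.
Qed.

End BoundaryMatrix.

Section Energy.
Context {R : realType} {k : scalar_kind} {N d : nat}.
Local Notation K := (Kfield R k).
Local Notation mu := (@lebesgue_measure R).
Local Notation I01 := (@I01 R).
Variables (P : nat -> 'M[K]_d) (H : R -> 'M[K]_d) (m : R).
Hypotheses (hH : Linfty H) (m0 : 0 < m).
Hypothesis Hcoer : {ae mu, forall t, I01 t -> H t = ctmx (H t) /\ coercive m (H t)}.
Hypothesis hPk : forall n, (0 < n <= N)%N -> P n = (-1) ^+ n.+1 *: ctmx (P n).
Hypothesis hPN : P N \in unitmx.
Implicit Types (x y : R -> 'cV[K]_d) (Z Y : nat -> R -> 'cV[K]_d).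

(** The contribution of the derivative of order [n] to [<Ax, x>], polarized. *)
Definition pH_form n Z Y : K := integralK (fun t => dotv (P n *m Z n t) (Y 0%N t)).

Lemma integrable_pH_form n Z Y : chain N Z -> chain N Y -> (n <= N)%N ->
  integrableK (fun t => dotv (P n *m Z n t) (Y 0%N t)).
Proof.
move=> [LZ _] [LY _] nN.
by apply: L2_dotv; [apply: L2_mulmx; exact: LZ|exact: LY].
Qed.

Lemma inner_pH_A x Z : L2 x -> chain N Z -> ae01 (Hmul H x) (Z 0%N) ->
  inner_X H (pH_A N P H x) x = \sum_(n < N.+1) pH_form n Z Z.
Proof.
move=> Lx cZ xZ; have [dx Ax _] := pH_chain P hH Lx cZ xZ.
have iform (n : 'I_N.+1) : integrableK (fun t => dotv (P n *m Z n t) (Z 0%N t)).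
  by apply: integrable_pH_form => //; rewrite -ltnS.
rewrite /pH_form -integralK_sum//; apply: integralK_ae.
- apply: integrableK_measurable; apply: L2_dotv; first exact: (L2_pH_A P dx).
  exact: (L2_Hmul hH Lx).
- by apply: integrableK_measurable; exact: integrableK_sum.
apply: aeS (aeI Ax xZ) => t [h1 h2] It.
by rewrite (h1 It) -/(Hmul H x t) (h2 It) dotv_suml.
Qed.

(** Integrating by parts [n] times gives the sign [(-1)^n], and moving [P_n] to
    the other side the sign [(-1)^(n+1)]. *)
Lemma pH_form_skew n Z Y : chain N Z -> chain N Y ->
  (forall j, (j < N)%N -> Y j 0 = 0 /\ Y j 1 = 0) -> (0 < n <= N)%N ->
  reK (pH_form n Z Y) + reK (pH_form n Y Z) = 0.
Proof.
move=> cZ cY Y0 hn; have /andP[n0 nN] := hn.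
have E1 : pH_form n Z Y = (-1) ^+ n * integralK (fun t => dotv (P n *m Z 0%N t) (Y n t)).
  exact: (chain_by_parts (chain_mulmx (P n) cZ) cY Y0 nN).
have iE : integrableK (fun t => dotv (P n *m Z 0%N t) (Y n t)).
  by apply: L2_dotv; [apply: L2_mulmx; exact: cZ.1|exact: cY.1].
have sgn (j : nat) : conjF ((-1) ^+ j : K) = (-1) ^+ j.
  by rewrite rmorphXn /= rmorphN1.
have E2 : pH_form n Y Z = conjF ((-1) ^+ n.+1 * integralK (fun t => dotv (P n *m Z 0%N t) (Y n t))).
  rewrite -integralKZ// -integralK_conj; last exact: integrableKZ.
  apply: eq_integralK => t _; rewrite rmorphM /= conj_dotv sgn {1}hPk//.
  by rewrite -scalemxAl dotvZl sgn dotv_adj ctmxK.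
by rewrite E1 E2 reK_conj exprS mulN1r mulNr reKN subrr.
Qed.

Definition pH_energy Z : R := \sum_(n < N) reK (pH_form n.+1 Z Z).

(** The difference of the two chains has vanishing boundary values, so its mixed
    terms with [Y] cancel and its own energy is 0.  Hence the conservative part
    of [Re <Ax, x>] depends only on the boundary values. *)
Lemma pH_energy_traces Z Y : chain N Z -> chain N Y ->
  chain_traces (N := N) Z = chain_traces (N := N) Y -> pH_energy Z = pH_energy Y.
Proof.
move=> cZ cY /eq_col_mx[/eq_mxcolP T1 /eq_mxcolP T0].
pose D n t := Z n t - Y n t; have cD : chain N D by exact: chainB.
have D0 j : (j < N)%N -> D j 0 = 0 /\ D j 1 = 0.
  move=> jN; have := T0 (Ordinal jN); have := T1 (Ordinal jN) => /= e1 e0.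
  by rewrite /D e1 e0 !subrr.
apply: eq_bigr => n _; have nN : (n < N)%N := ltn_ord n.
have hn : (0 < n.+1 <= N)%N by [].
have i (A B : nat -> R -> 'cV[K]_d) : chain N A -> chain N B ->
    integrableK (fun t => dotv (P n.+1 *m A n.+1 t) (B 0%N t)).
  by move=> cA cB; exact: integrable_pH_form.
have E : pH_form n.+1 Z Z = (pH_form n.+1 Y Y + pH_form n.+1 Y D) +
    (pH_form n.+1 D Y + pH_form n.+1 D D).
  rewrite /pH_form -!integralKD; try exact: i; try by apply: integrableKD; exact: i.
  apply: eq_integralK => t _; rewrite -!dotvDr -dotvDl -mulmxDr.
  by rewrite /D ![Y _ _ + (_ - _)]addrC !subrK.
move: (pH_form_skew cY cD D0 hn) (pH_form_skew cD cD D0 hn); rewrite E !reKD.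
rewrite -[_ + reK (pH_form n.+1 D D)]mulr2n => s1 /eqP; rewrite mulrn_eq0 /= => /eqP s2.
by rewrite s2 addr0 -addrA s1 addr0.
Qed.

Lemma pH_energyE x Z : L2 x -> chain N Z -> ae01 (Hmul H x) (Z 0%N) ->
  reK (inner_X H (pH_A N P H x) x) =
  reK (integralK (fun t => dotv (P 0%N *m Z 0%N t) (Z 0%N t))) + pH_energy Z.
Proof.
move=> Lx cZ xZ; rewrite (inner_pH_A Lx cZ xZ) raddf_sum /= big_ord_recl.
by congr (_ + _); apply: eq_bigr.
Qed.

(** In the passivity inequality [x] is replaced by boundary layers with the same
    boundary values: the energy and the ports do not change, while the
    contribution of [P_0] tends to 0. *)
Lemma pH_energy_le (WB WC : 'M[K]_(bdim N d, bdim N d + bdim N d)) Z : impedance_passive P H WB WC -> chain N Z ->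
  pH_energy Z <= reK (dotv (WB *m (R0 P *m chain_traces (N := N) Z))
                           (WC *m (R0 P *m chain_traces (N := N) Z))).
Proof.
move=> pass cZ; set tau := chain_traces _; set b := reK _.
pose e M := reK (integralK (fun t =>
  dotv (P 0%N *m layer_chain tau M 0 t) (layer_chain tau M 0 t))).
have le M : (N <= M)%N -> pH_energy Z <= b - e M.
  move=> NM; have cL : chain N (layer_chain tau M) by exact: chain_layer.
  have tL := layer_chain_traces tau NM.
  have [x [Lx xL _ [dx _ port]]] := chain_pH P hH m0 Hcoer cL.
  have := pass x dx; rewrite (pH_energyE Lx cL xL) !port tL -/b -/(e M).
  rewrite (pH_energy_traces cL cZ tL) => h; lra.
have ce : b - e M @[M --> \oo] --> b.
  rewrite -[X in _ --> X](subr0 b); apply: cvgB; first exact: cvg_cst.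
  exact: layer_chain_form_cvg.
rewrite -(cvg_lim _ ce); last exact: Rhausdorff.
apply: limr_ge; first by apply/cvg_ex; exists b.
by exists N => // M /= NM; exact: le.
Qed.

Lemma norm2_X_le x : L2 x ->
  m * norm2_X H x <= int01 (fun t => reK (dotv (Hmul H x t) (Hmul H x t))).
Proof.
move=> Lx; rewrite /norm2_X /inner_X reK_integral.
have [ir _] := L2_dotv Lx (L2_Hmul hH Lx).
have [ir' _] := L2_dotv (L2_Hmul hH Lx) (L2_Hmul hH Lx).
rewrite -int01Z//; apply: int01_le => //; first exact: integrable01Z.
apply: aeS Hcoer => t /[apply] -[_ cH].
have := coercive_solution_le (x t) m0 cH; have := dotv_young m (x t) (H t *m x t).
by rewrite /Hmul; lra.
Qed.

(** The conservative part is bounded by the ports, and [P_0] contributes at most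
    [-(nu/2) |Hx|^2], where [|Hx|^2] is at least [m] times the squared norm of
    [x] in [X]. *)
Lemma passive_strict (WB WC : 'M[K]_(bdim N d, bdim N d + bdim N d)) (nu : R) : impedance_passive P H WB WC -> 0 < nu ->
  negative_definite (P 0%N + ctmx (P 0%N) + (ofR nu)%:M) ->
  passive_up_to P H WB WC (- (nu * m / 2)).
Proof.
move=> pass nu0 neg x dx; have [Lx sx] := dx.
have [Z [cZ xZ]] := sobolev_chain sx.
have [_ _ port] := pH_chain P hH Lx cZ xZ.
rewrite (pH_energyE Lx cZ xZ) !port.
have LZ : L2 (Z 0%N) by exact: cZ.1.
have := pH_energy_le pass cZ; set E := pH_energy Z; set b := reK (dotv _ _) => Eb.
have P0le (v : 'cV[K]_d) : 2 * reK (dotv (P 0%N *m v) v) + nu * reK (dotv v v) <= 0.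
  have [->|v0] := eqVneq v 0; first by rewrite mulmx0 dotv0r raddf0 !mulr0 addr0.
  have /ltKW := neg v v0; rewrite raddf0 !mulmxDl !dotvDr mul_scalar_mx dotvZr !reKD.
  rewrite reKM reK_ofR imK_ofR mul0r subr0.
  rewrite -[in dotv v (P 0%N *m v)](ctmxK (P 0%N)) -dotv_adj.
  have -> : reK (dotv (ctmx (P 0%N) *m v) v) = reK (dotv (P 0%N *m v) v).
    by rewrite dotv_adj ctmxK -conj_dotv reK_conj.
  have -> : reK (dotv v (ctmx (P 0%N) *m v)) = reK (dotv (P 0%N *m v) v).
    by rewrite -dotv_adj.
  move=> h; lra.
have [iP _] := L2_dotv (L2_mulmx (P 0%N) LZ) LZ.
have [iZ _] := L2_dotv LZ LZ.
have le1 : reK (integralK (fun t => dotv (P 0%N *m Z 0%N t) (Z 0%N t))) <=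
    - (nu / 2) * int01 (fun t => reK (dotv (Z 0%N t) (Z 0%N t))).
  rewrite reK_integral -int01Z//; apply: int01_le => //; first exact: integrable01Z.
  by apply: ae_everywhere => t _; have := P0le (Z 0%N t); lra.
have : m * norm2_X H x <= int01 (fun t => reK (dotv (Z 0%N t) (Z 0%N t))).
  apply: le_trans (norm2_X_le Lx) _; rewrite le_eqVlt; apply/orP; left; apply/eqP.
  have [iH _] := L2_dotv (L2_Hmul hH Lx) (L2_Hmul hH Lx).
  apply: int01_ae; try exact: integrable01_measurable.
  by apply: aeS xZ => t /[apply] ->.
have nu20 : 0 < nu / 2 by rewrite divr_gt0.
move=> le2; have := ler_wpM2l (ltW nu20) le2; lra.
Qed.

(** Any boundary values are those of some chain, and the matrices between boundary
    values and ports are invertible. *)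
Lemma ports_surjectiveP (WB WC : 'M[K]_(bdim N d, bdim N d + bdim N d)) : col_mx WB WC \in unitmx -> ports_surjective P H WB WC.
Proof.
move=> uW u y; pose tau := invmx (R0 P) *m (invmx (col_mx WB WC) *m col_mx u y).
have [x [_ _ _ [dx _ port]]] := chain_pH P hH m0 Hcoer (chain_layer tau N).
exists x; rewrite !port layer_chain_traces//.
have /eq_col_mx[-> ->] : col_mx (WB *m (R0 P *m tau)) (WC *m (R0 P *m tau)) = col_mx u y.
  by rewrite -mul_col_mx /tau mulKVmx ?R0_unit// mulKVmx.
by [].
Qed.

End Energy.

Theorem theorem4p3 (R : realType) (k : scalar_kind) (N d : nat)
  (P : nat -> 'M[Kfield R k]_d)
  (WB WC : 'M[Kfield R k]_(bdim N d, bdim N d + bdim N d))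
  (H : R -> 'M[Kfield R k]_d) (m M : R)
  (hPk : forall n, (0 < n <= N)%N -> P n = (-1) ^+ n.+1 *: ctmx (P n))
  (hPN : P N \in unitmx)
  (hP0 : loewner_le (P 0%N + ctmx (P 0%N)) 0)
  (hW : col_mx WB WC \in unitmx)
  (hH : Linfty H)
  (hm : 0 < m) (hM : 0 < M)
  (hHae : {ae @lebesgue_measure R, forall t : R, I01 t ->
     [/\ H t = ctmx (H t), loewner_le (ofR m)%:M (H t)
       & loewner_le (H t) (ofR M)%:M]})
  (hpass : impedance_passive P H WB WC) :
  (exists alpha : R,
     [/\ passive_up_to P H WB WC alpha,
         exists beta : R, alpha <= beta /\ range_ker_eq_X P H WC beta
       & ports_surjective P H WB WC])
  /\ ((exists mu : R, 0 < mu /\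
         negative_definite (P 0%N + ctmx (P 0%N) + (ofR mu)%:M)) ->
      exists alpha : R, alpha < 0 /\ passive_up_to P H WB WC alpha).
Proof.
have Hcoer : {ae @lebesgue_measure R, forall t, I01 t -> H t = ctmx (H t) /\ coercive m (H t)}.
  apply: aeS hHae => t /[apply] -[sH lH _]; split => // w.
  have /leKP[_] := lH w.
  by rewrite mul_scalar_mx dotvZr reKM reK_ofR imK_ofR mul0r subr0.
split; last first.
  move=> [nu [nu0 neg]]; exists (- (nu * m / 2)); split; last exact: passive_strict.
  by rewrite oppr_lt0 divr_gt0// mulr_gt0.
exists 0; split; last exact: (ports_surjectiveP hH hm Hcoer).
  by move=> x dx; rewrite mul0r addr0; exact: hpass.
exists 1; split; first exact: ler01.
split=> [x dx _|y Ly].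
  have := L2D (L2_pH_A P dx) (L2Z (- ofR 1) dx.1); congr L2.
  by apply/funext => t; rewrite scaleNr.
case: (posnP N) => [N0|N0]; last exact: (range_ker_pos hH hm Hcoer hPN N0 ltr01 hpass Ly).
exact: (range_ker_zero hH hm Hcoer WC N0 hP0 Ly).
Qed.
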